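(* Let $k$ be an algebraically closed field and let $\Lambda=\widehat{kQ}/\overline{I}$ be a complete special biserial algebra over $k$. Then $\Lambda$ is $g$-tame, that is, $\overline{|\mathcal{F}(\Lambda)|}=\mathbb{R}^{n}$, where $n$ is the number of isomorphism classes of indecomposable projective $\Lambda$-modules.
   Context: Complete special biserial algebras. For a finite connected quiver $Q$, $\widehat{kQ}$ is the completion of the path algebra $kQ$ with respect to the $kQ_+$-adic topology, where $kQ_+$ is the arrow ideal. For an arrow $\alpha$, $s(\alpha)$ and $t(\alpha)$ are its starting and terminal points; $\alpha\beta$ denotes the path from $s(\alpha)$ to $t(\beta)$. Let $I$ be an ideal of $kQ$ and $\overline{I}$ its closure in $\widehat{kQ}$. The algebra $\widehat{kQ}/\overline{I}$ is a complete special biserial algebra if: (SB1) for each vertex $i$ of $Q$ there are at most two arrows starting at $i$ and at most two arrows ending at $i$; (SB2) for every arrow $\alpha$ there is at most one arrow $\beta$ with $t(\alpha)=s(\beta)$ and $\alpha\beta\notin I$; (SB3) for every arrow $\alpha$ there is at most one arrow $\gamma$ with $s(\alpha)=t(\gamma)$ and $\gamma\alpha\notin I$. These algebras are not assumed finite dimensional; they are module-finite $k[[t]]$-algebras (i.e. $k[[t]]$-algebras finitely generated as modules over the formal power series ring $k[[t]]$ in one variable). $g$-tameness. Let $A$ be a basic module-finite $k[[t]]$-algebra. $\mathsf{K}^{\rm b}(\mathrm{proj}\,A)$ is the homotopy category of bounded complexes of finitely generated projective right $A$-modules (a Krull-Schmidt category). A complex $P=(P^i,f^i)$ in it is two-term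 if $P^i=0$ for $i\neq 0,-1$; presilting if $\mathrm{Hom}_{\mathsf{K}^{\rm b}(\mathrm{proj}\,A)}(P,P[m])=0$ for all integers $m>0$; basic if its indecomposable direct summands are pairwise non-isomorphic. Write $A=\bigoplus_{i=1}^{n}P_i$ with $P_i$ indecomposable projective. The $g$-vector of a two-term complex $P=[P^{-1}\to P^0]$ is $g(P)=(m_1-n_1,\dots,m_n-n_n)\in\mathbb{Z}^n$, where $m_i$ (resp. $n_i$) is the multiplicity of $P_i$ as a direct summand of $P^0$ (resp. $P^{-1}$). For a basic two-term presilting complex $P$, its $g$-vector cone is $C(P)=\{\sum_X a_X g(X)\mid a_X\in\mathbb{R}_{\ge 0}\}\subseteq\mathbb{R}^n$, where $X$ runs over all indecomposable direct summands of $P$. $\mathcal{F}(A)$ is the collection of the cones $C(P)$ of all basic two-term presilting complexes $P$ for $A$, and $|\mathcal{F}(A)|=\bigcup_{C\in\mathcal{F}(A)}C\subseteq\mathbb{R}^n$. The algebra $A$ is $g$-tame if $\overline{|\mathcal{F}(A)|}=\mathbb{R}^n$, the closure being taken in the natural topology of $\mathbb{R}^n$. *)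

(* Defs.v *)
From HB Require Import structures.
From mathcomp Require Import all_boot all_order all_algebra.
From mathcomp Require Import all_classical all_reals all_analysis.
Set Implicit Arguments.
Unset Strict Implicit.
Unset Printing Implicit Defensive.
Import Order.TTheory GRing.Theory Num.Theory.
Import numFieldNormedType.Exports.
Local Open Scope classical_set_scope.
Local Open Scope ring_scope.

Record quiver := Quiver {
  vertex : finType;
  arrow : finType;
  src : arrow -> vertex;
  tgt : arrow -> vertex }.

Definition quiver_connected (Q : quiver) : Prop :=
  forall u v : vertex Q,
    connect (fun x y => [exists a : arrow Q,
      ((src a == x) && (tgt a == y)) || ((src a == y) && (tgt a == x))]) u v.

Section Paths.
Variable Q : quiver.

Fixpoint composable (i : vertex Q) (w : seq (arrow Q)) : bool :=
  if w is a :: w' then (src a == i) && composable (tgt a) w' else true.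

(* A path is its starting vertex together with its arrows in the order in which
   they are travelled, so that [:: a; b] is the path ab from src a to tgt b; the
   empty sequence of arrows gives the trivial path at the vertex. *)
Definition qpath := {p : vertex Q * seq (arrow Q) | composable p.1 p.2}.

Definition plen (p : qpath) : nat := size (val p).2.

Definition walk_end (i : vertex Q) (w : seq (arrow Q)) : vertex Q :=
  last i (map (@tgt Q) w).

Lemma composable_cat i w1 w2 :
  composable i (w1 ++ w2) = composable i w1 && composable (walk_end i w1) w2.
Proof. by elim: w1 i => //= a w IHw i; rewrite IHw andbA. Qed.

Lemma take_path_subproof n (p : qpath) :
  composable (val p).1 (take n (val p).2).
Proof.
have := valP p; rewrite -{1}(cat_take_drop n (val p).2) composable_cat.
by case/andP.
Qed.

Lemma drop_path_subproof n (p : qpath) :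
  composable (walk_end (val p).1 (take n (val p).2)) (drop n (val p).2).
Proof.
have := valP p; rewrite -{1}(cat_take_drop n (val p).2) composable_cat.
by case/andP.
Qed.

Definition take_path n (p : qpath) : qpath :=
  exist _ ((val p).1, take n (val p).2) (take_path_subproof n p).

Definition drop_path n (p : qpath) : qpath :=
  exist _ (walk_end (val p).1 (take n (val p).2), drop n (val p).2)
    (drop_path_subproof n p).

Lemma trivial_path_subproof (i : vertex Q) :
  composable (i, [::] : seq (arrow Q)).1 (i, [::] : seq (arrow Q)).2.
Proof. by []. Qed.

Definition trivial_path (i : vertex Q) : qpath :=
  exist _ (i, [::]) (trivial_path_subproof i).

Lemma arrow_path_subproof (a : arrow Q) :
  composable (src a, [:: a]).1 (src a, [:: a]).2.
Proof. by rewrite /= eqxx. Qed.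

Definition arrow_path (a : arrow Q) : qpath :=
  exist _ (src a, [:: a]) (arrow_path_subproof a).

Lemma qpath_inj (p q : qpath) :
  (val p).1 = (val q).1 -> (val p).2 = (val q).2 -> p = q.
Proof.
move=> e1 e2; apply: val_inj; move: e1 e2.
by case: (val p) (val q) => [? ?] [? ?] /= -> ->.
Qed.

Lemma plen_take n p : (n <= plen p)%N -> plen (take_path n p) = n.
Proof. by move=> le_n; rewrite /plen /= size_takel. Qed.

Lemma plen_take_le n p : (plen (take_path n p) <= plen p)%N.
Proof. by rewrite /plen /= size_take_min geq_minr. Qed.

Lemma plen_drop n p : plen (drop_path n p) = (plen p - n)%N.
Proof. by rewrite /plen /= size_drop. Qed.

Lemma take_take_path i j p :
  (j <= i)%N -> take_path j (take_path i p) = take_path j p.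
Proof. by move=> le_ji; apply: qpath_inj => //=; rewrite take_takel. Qed.

Lemma drop_drop_path i j p :
  drop_path i (drop_path j p) = drop_path (i + j) p.
Proof.
apply: qpath_inj => /=; last by rewrite drop_drop.
by rewrite /walk_end addnC takeD map_cat last_cat.
Qed.

Lemma drop_take_path i j p :
  drop_path j (take_path (i + j) p) = take_path i (drop_path j p).
Proof.
apply: qpath_inj => /=; last by rewrite take_drop.
by rewrite take_takel // leq_addl.
Qed.

Lemma take0_path p : take_path 0 p = trivial_path (val p).1.
Proof. by apply: qpath_inj => //=; rewrite take0. Qed.

Lemma drop0_path p : drop_path 0 p = p.
Proof. by apply: qpath_inj => /=; rewrite ?take0 ?drop0. Qed.

Lemma take_plen_path p : take_path (plen p) p = p.
Proof. by apply: qpath_inj => //=; rewrite take_size. Qed.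

Lemma plen0_path p : plen p = 0%N -> p = trivial_path (val p).1.
Proof. by move=> /size0nil p0; apply: qpath_inj. Qed.

End Paths.

(* The kQ_+-adic completion is the inverse limit of the kQ / (kQ_+)^N.  As Q is
   finite, there are finitely many paths of each length, so it is the product of
   the spans kQ_N of the paths of length N, that is, the set of all families of
   coefficients indexed by the paths (formal, possibly infinite, combinations of
   paths), multiplied by concatenation of paths. *)
Definition cpath_alg (k : fieldType) (Q : quiver) : Type := qpath Q -> k.

Section CompletedPathAlgebra.
Variables (k : fieldType) (Q : quiver).
Local Notation kQhat := (cpath_alg k Q).

HB.instance Definition _ := gen_eqMixin kQhat.
HB.instance Definition _ := gen_choiceMixin kQhat.

Definition cpa_zero : kQhat := fun=> 0.
Definition cpa_opp (f : kQhat) : kQhat := fun p => - f p.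
Definition cpa_add (f g : kQhat) : kQhat := fun p => f p + g p.
Definition cpa_one : kQhat := fun p => (plen p == 0)%:R.
Definition cpa_mul (f g : kQhat) : kQhat :=
  fun p => \sum_(i < (plen p).+1) f (take_path i p) * g (drop_path i p).

Lemma cpa_addA : associative cpa_add.
Proof. by move=> f g h; apply: funext => p; apply: addrA. Qed.
Lemma cpa_addC : commutative cpa_add.
Proof. by move=> f g; apply: funext => p; apply: addrC. Qed.
Lemma cpa_add0 : left_id cpa_zero cpa_add.
Proof. by move=> f; apply: funext => p; apply: add0r. Qed.
Lemma cpa_addN : left_inverse cpa_zero cpa_opp cpa_add.
Proof. by move=> f; apply: funext => p; apply: addNr. Qed.

HB.instance Definition _ :=
  GRing.isZmodule.Build kQhat cpa_addA cpa_addC cpa_add0 cpa_addN.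

Lemma cpa_mulA : associative cpa_mul.
Proof.
move=> f g h; apply: funext => p; rewrite /cpa_mul; set n := plen p.
pose F i j := f (take_path j p) * g (take_path (i - j) (drop_path j p)) *
              h (drop_path i p).
transitivity (\sum_(0 <= j < n.+1) \sum_(0 <= i < n.+1 | (j <= i)%N) F i j).
  rewrite big_mkord; apply: eq_bigr => j _.
  rewrite big_distrr /= plen_drop -/n -subSn; last by rewrite -ltnS.
  rewrite -(big_mkord xpredT (fun i => f (take_path j p) *
    (g (take_path i (drop_path j p)) *
     h (drop_path i (drop_path j p))))).
  rewrite -[RHS](big_nat_widenl j 0 n.+1 xpredT) //.
  rewrite -[X in _ = bigop _ (index_iota X _) _]add0n big_addn.
  by apply: eq_bigr => i _; rewrite /F addnK drop_drop_path mulrA.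
rewrite (exchange_big_dep_nat xpredT) //= big_mkord; apply: eq_bigr => i _.
rewrite big_distrl /= plen_take; last by rewrite -ltnS.
rewrite -(big_mkord xpredT (fun j => f (take_path j (take_path i p)) *
    g (drop_path j (take_path i p)) * h (drop_path i p))).
rewrite (big_nat_widen 0 i.+1 n.+1) ?ltn_ord //.
apply: eq_big => [j|j le_ji]; first by rewrite ltnS.
rewrite /F take_take_path //; congr (_ * _ * _).
by rewrite -drop_take_path subnK.
Qed.

Lemma cpa_mul1l : left_id cpa_one cpa_mul.
Proof.
move=> f; apply: funext => p; rewrite /cpa_mul big_ord_recl /= drop0_path.
rewrite /cpa_one plen_take // mul1r big1 ?addr0 // => i _.
by rewrite plen_take ?mul0r // lift0 ltn_ord.
Qed.

Lemma cpa_mul1r : right_id cpa_one cpa_mul.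
Proof.
move=> f; apply: funext => p; rewrite /cpa_mul big_ord_recr /= take_plen_path.
rewrite /cpa_one plen_drop subnn mulr1 big1 ?add0r // => i _.
by rewrite plen_drop subn_eq0 leqNgt ltn_ord mulr0.
Qed.

Lemma cpa_mulDl : left_distributive cpa_mul +%R.
Proof.
move=> f g h; apply: funext => p.
transitivity (cpa_mul f h p + cpa_mul g h p) => //; rewrite /cpa_mul -big_split.
by apply: eq_bigr => i _; apply: mulrDl.
Qed.

Lemma cpa_mulDr : right_distributive cpa_mul +%R.
Proof.
move=> f g h; apply: funext => p.
transitivity (cpa_mul f g p + cpa_mul f h p) => //; rewrite /cpa_mul -big_split.
by apply: eq_bigr => i _; apply: mulrDr.
Qed.

HB.instance Definition _ := GRing.Zmodule_isPzRing.Build kQhat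
  cpa_mulA cpa_mul1l cpa_mul1r cpa_mulDl cpa_mulDr.

Definition path_elt (p : qpath Q) : kQhat := fun q => (q == p)%:R.

Definition arrow_elt (a : arrow Q) : kQhat := path_elt (arrow_path a).

(* kQ, as a subring of its completion.  As Q is finite, a family of coefficients
   has finite support if and only if it vanishes on all sufficiently long
   paths. *)
Definition path_algebra : set kQhat :=
  [set f | exists N : nat, forall p, (N <= plen p)%N -> f p = 0].

Record path_ideal := PathIdeal {
  in_path_ideal : set kQhat;
  path_ideal_sub : in_path_ideal `<=` path_algebra;
  path_ideal0 : in_path_ideal 0;
  path_idealD : forall x y,
    in_path_ideal x -> in_path_ideal y -> in_path_ideal (x + y);
  path_idealMl : forall a x,
    path_algebra a -> in_path_ideal x -> in_path_ideal (a * x);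
  path_idealMr : forall a x,
    path_algebra a -> in_path_ideal x -> in_path_ideal (x * a) }.

(* Two elements of the completion are congruent modulo the N-th neighbourhood of
   0 when they have the same coefficients at the paths of length < N. *)
Definition adic_closure (S : set kQhat) : set kQhat :=
  [set f | forall N : nat, exists2 g, S g &
     forall p, (plen p < N)%N -> f p = g p].

End CompletedPathAlgebra.

Record ideal2 (A : pzRingType) := Ideal2 {
  in_ideal2 : set A;
  ideal2_0 : in_ideal2 0;
  ideal2_D : forall x y, in_ideal2 x -> in_ideal2 y -> in_ideal2 (x + y);
  ideal2_Ml : forall a x, in_ideal2 x -> in_ideal2 (a * x);
  ideal2_Mr : forall a x, in_ideal2 x -> in_ideal2 (x * a) }.

Section IdealQuotient.
Variables (A : pzRingType) (J : ideal2 A).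
Local Open Scope quotient_scope.

Definition ideal2_pred : {pred A} := fun x => `[< in_ideal2 J x >].

Lemma ideal2_predE x : (x \in ideal2_pred) = `[< in_ideal2 J x >].
Proof. by []. Qed.

Lemma ideal2_zmod_closed : zmod_closed ideal2_pred.
Proof.
split=> [|x y]; rewrite !ideal2_predE; first by apply/asboolP/ideal2_0.
move=> /asboolP Jx /asboolP Jy; apply/asboolP/ideal2_D => //.
by rewrite -mulN1r; apply: ideal2_Ml.
Qed.

HB.instance Definition _ :=
  GRing.isZmodClosed.Build A ideal2_pred ideal2_zmod_closed.

Definition quot_ring : Type := Quotient.quot ideal2_pred.

HB.instance Definition _ := GRing.Zmodule.on quot_ring.
HB.instance Definition _ := EqQuotient.on quot_ring.

Definition quot_pi (x : A) : quot_ring := \pi_(Quotient.quot ideal2_pred) x.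

Lemma quot_pi_eq x y : (quot_pi x = quot_pi y) <-> in_ideal2 J (x - y).
Proof.
rewrite /quot_pi; split=> [/eqP|Jxy].
  by rewrite -Quotient.idealrBE => /asboolP.
by apply/eqP; rewrite -Quotient.idealrBE; apply/asboolP.
Qed.

Lemma quot_pi_surj (x : quot_ring) : quot_pi (repr x) = x.
Proof. exact: reprK. Qed.

Lemma quot_piD x y : quot_pi (x + y) = quot_pi x + quot_pi y.
Proof. exact: raddfD. Qed.

Definition quot_one : quot_ring := quot_pi 1.
Definition quot_mul (x y : quot_ring) : quot_ring := quot_pi (repr x * repr y).

Lemma quot_piM x y : quot_mul (quot_pi x) (quot_pi y) = quot_pi (x * y).
Proof.
apply/quot_pi_eq; set x' := repr _; set y' := repr _.
have Jx : in_ideal2 J (x' - x) by apply/quot_pi_eq; rewrite quot_pi_surj.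
have Jy : in_ideal2 J (y' - y) by apply/quot_pi_eq; rewrite quot_pi_surj.
rewrite -[_ * _](subrK (x * y')) -mulrBl -addrA -mulrBr.
by apply: ideal2_D; [apply: ideal2_Mr | apply: ideal2_Ml].
Qed.

Lemma quot_mulA : associative quot_mul.
Proof.
move=> x y z; rewrite -(quot_pi_surj x) -(quot_pi_surj y) -(quot_pi_surj z).
by rewrite !quot_piM mulrA.
Qed.
Lemma quot_mul1l : left_id quot_one quot_mul.
Proof. by move=> x; rewrite -(quot_pi_surj x) quot_piM mul1r. Qed.
Lemma quot_mul1r : right_id quot_one quot_mul.
Proof. by move=> x; rewrite -(quot_pi_surj x) quot_piM mulr1. Qed.
Lemma quot_mulDl : left_distributive quot_mul +%R.
Proof.
move=> x y z; rewrite -(quot_pi_surj x) -(quot_pi_surj y) -(quot_pi_surj z).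
by rewrite -quot_piD !quot_piM mulrDl quot_piD.
Qed.
Lemma quot_mulDr : right_distributive quot_mul +%R.
Proof.
move=> x y z; rewrite -(quot_pi_surj x) -(quot_pi_surj y) -(quot_pi_surj z).
by rewrite -quot_piD !quot_piM mulrDr quot_piD.
Qed.

HB.instance Definition _ := GRing.Zmodule_isPzRing.Build quot_ring
  quot_mulA quot_mul1l quot_mul1r quot_mulDl quot_mulDr.

End IdealQuotient.

Section SpecialBiserial.
Variables (k : fieldType) (Q : quiver) (I : path_ideal k Q).
Local Notation kQhat := (cpath_alg k Q).
Local Notation Ibar := (adic_closure (in_path_ideal I)).

Lemma cpa_truncate (a : kQhat) N : exists2 b, path_algebra b &
  forall p, (plen p < N)%N -> a p = b p.
Proof.
exists (fun p => if (plen p < N)%N then a p else 0) => [|p ->//].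
by exists N => p; rewrite leqNgt => /negbTE ->.
Qed.

Lemma cpa_mul_trunc (a b c d : kQhat) N :
  (forall p, (plen p < N)%N -> a p = c p) ->
  (forall p, (plen p < N)%N -> b p = d p) ->
  forall p, (plen p < N)%N -> (a * b) p = (c * d) p.
Proof.
move=> eq_ac eq_bd p ltpN; apply: eq_bigr => i _.
rewrite eq_ac ?eq_bd //.
  by rewrite plen_drop (leq_ltn_trans _ ltpN) ?leq_subr.
exact: leq_ltn_trans (plen_take_le _ _) ltpN.
Qed.

Lemma adic_closure0 : Ibar 0.
Proof. by move=> N; exists 0 => //; apply: path_ideal0. Qed.

Lemma adic_closureD x y : Ibar x -> Ibar y -> Ibar (x + y).
Proof.
move=> Ix Iy N; have [x' Ix' eqx] := Ix N; have [y' Iy' eqy] := Iy N.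
exists (x' + y'); first exact: path_idealD.
by move=> p ltpN; congr (_ + _); [apply: eqx | apply: eqy].
Qed.

Lemma adic_closureMl a x : Ibar x -> Ibar (a * x).
Proof.
move=> Ix N; have [x' Ix' eqx] := Ix N; have [b kQb eqb] := cpa_truncate a N.
by exists (b * x'); [apply: path_idealMl | apply: cpa_mul_trunc].
Qed.

Lemma adic_closureMr a x : Ibar x -> Ibar (x * a).
Proof.
move=> Ix N; have [x' Ix' eqx] := Ix N; have [b kQb eqb] := cpa_truncate a N.
by exists (x' * b); [apply: path_idealMr | apply: cpa_mul_trunc].
Qed.

Definition closure_ideal : ideal2 kQhat :=
  Ideal2 adic_closure0 adic_closureD adic_closureMl adic_closureMr.

(* Only the ring structure is recorded: g-tameness does not involve the scalars. *)
Definition complete_path_quotient : pzRingType := quot_ring closure_ideal.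

Record special_biserial : Prop := SpecialBiserial {
  SB1_src : forall i : vertex Q, (#|[set a : arrow Q | src a == i]%SET| <= 2)%N;
  SB1_tgt : forall i : vertex Q, (#|[set a : arrow Q | tgt a == i]%SET| <= 2)%N;
  SB2 : forall a b b' : arrow Q,
    tgt a = src b -> ~ in_path_ideal I (arrow_elt k a * arrow_elt k b) ->
    tgt a = src b' -> ~ in_path_ideal I (arrow_elt k a * arrow_elt k b') ->
    b = b';
  SB3 : forall a c c' : arrow Q,
    src a = tgt c -> ~ in_path_ideal I (arrow_elt k c * arrow_elt k a) ->
    src a = tgt c' -> ~ in_path_ideal I (arrow_elt k c' * arrow_elt k a) ->
    c = c' }.

End SpecialBiserial.

Section RightModules.
Variable A : pzRingType.

(* A right A-module is a left module over the converse ring: v a is a *: v. *)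
Local Notation rmod := (lmodType A^c).

Definition mod_iso (M N : rmod) : Prop :=
  exists f : {linear M -> N}, bijective f.

Definition mod_sum (M N : rmod) : rmod := (M * N)%type.

Definition mod_zero : rmod := 'rV[A^c]_0.

Definition is_zero_mod (M : rmod) : Prop := forall x : M, x = 0.

Definition fg_projective (M : rmod) : Prop :=
  exists (n : nat) (N : rmod), mod_iso (mod_sum M N) 'rV[A^c]_n.

Definition mod_indecomposable (M : rmod) : Prop :=
  ~ is_zero_mod M /\
  forall X Y : rmod, mod_iso M (mod_sum X Y) -> is_zero_mod X \/ is_zero_mod Y.

Definition regular_mod : rmod := (A^c)^o.

(* The existence of such a P says that A is basic. *)
Definition basic_decomposition (n : nat) (P : 'I_n -> rmod) : Prop :=
  [/\ forall i, mod_indecomposable (P i),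
      forall i j, mod_iso (P i) (P j) -> i = j &
      mod_iso regular_mod (\big[mod_sum/mod_zero]_(i < n) P i)].

Definition has_multiplicities (n : nat) (P : 'I_n -> rmod) (M : rmod)
    (m : 'I_n -> nat) : Prop :=
  mod_iso M
    (\big[mod_sum/mod_zero]_(i < n) \big[mod_sum/mod_zero]_(j < m i) P i).

(* The differential is given between any two degrees and vanishes unless it
   raises the degree by exactly one; this avoids transports along equalities
   between degrees. *)
Record complex := Complex {
  cobj :> int -> rmod;
  diff : forall i j : int, {linear cobj i -> cobj j};
  diff_shape : forall i j, j != i + 1 -> forall x, diff i j x = 0;
  diff_diff : forall i j l x, diff j l (diff i j x) = 0 }.

Arguments diff : clear implicits.

Record cx_hom (C D : complex) := CxHom {
  cx_fun :> forall i : int, {linear C i -> D i};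
  cx_comm : forall i j x, diff D i j (cx_fun i x) = cx_fun j (diff C i j x) }.

Definition cx_id (C : complex) : cx_hom C C :=
  @CxHom C C (fun i => idfun) (fun i j x => erefl).

Definition cx_null (C D : complex) : cx_hom C D :=
  @CxHom C D (fun i => \0) (fun i j x => linear0 (diff D i j)).

Lemma cx_comp_comm (C D E : complex) (g : cx_hom D E) (f : cx_hom C D) i j x :
  diff E i j ((g i \o f i) x) = (g j \o f j) (diff C i j x).
Proof. by rewrite /= !cx_comm. Qed.

Definition cx_comp (C D E : complex) (g : cx_hom D E) (f : cx_hom C D) :
    cx_hom C E :=
  @CxHom C E (fun i => g i \o f i) (cx_comp_comm g f).

Definition homotopic (C D : complex) (f g : cx_hom C D) : Prop :=
  exists h : forall i j : int, {linear C i -> D j},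
    forall i x, f i x - g i x =
      diff D (i - 1) i (h i (i - 1) x) + h (i + 1) i (diff C i (i + 1) x).

(* Isomorphism in the homotopy category. *)
Definition hiso (C D : complex) : Prop :=
  exists (f : cx_hom C D) (g : cx_hom D C),
    homotopic (cx_comp g f) (cx_id C) /\ homotopic (cx_comp f g) (cx_id D).

Section ComplexSum.
Variables C D : complex.

Section SumDiff.
Variables i j : int.

Definition sum_diff_fun (x : mod_sum (C i) (D i)) : mod_sum (C j) (D j) :=
  (diff C i j x.1, diff D i j x.2).

Lemma sum_diff_linear : linear sum_diff_fun.
Proof. by move=> a x y; rewrite /sum_diff_fun /= !linearP. Qed.

HB.instance Definition _ := GRing.isLinear.Build A^c
  (mod_sum (C i) (D i)) (mod_sum (C j) (D j)) *:%R sum_diff_fun sum_diff_linear.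

Definition sum_diff : {linear mod_sum (C i) (D i) -> mod_sum (C j) (D j)} :=
  sum_diff_fun.
End SumDiff.

Lemma sum_diff_shape i j : j != i + 1 -> forall x, sum_diff i j x = 0.
Proof. by move=> ne x; rewrite /= /sum_diff_fun !diff_shape. Qed.

Lemma sum_diff_diff i j l x : sum_diff j l (sum_diff i j x) = 0.
Proof. by rewrite /= /sum_diff_fun /= !diff_diff. Qed.

Definition cx_sum : complex := Complex sum_diff_shape sum_diff_diff.

End ComplexSum.

Definition cx_zero : complex :=
  @Complex (fun=> mod_zero) (fun i j => \0) (fun _ _ _ _ => erefl)
    (fun _ _ _ _ => erefl).

Section Shift.
Variables (C : complex) (m : int).

Definition opp_diff (i j : int) : {linear C i -> C j} := \- (diff C i j).

Definition shift_diff (i j : int) : {linear C (i + m) -> C (j + m)} :=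
  if odd `|m|%N then opp_diff (i + m) (j + m) else diff C (i + m) (j + m).

Lemma shift_diff_shape i j : j != i + 1 -> forall x, shift_diff i j x = 0.
Proof.
move=> ne x; rewrite /shift_diff; have ne' : j + m != i + m + 1.
  by rewrite addrAC (inj_eq (addIr m)).
by case: odd => /=; rewrite diff_shape ?oppr0.
Qed.

Lemma shift_diff_diff i j l x : shift_diff j l (shift_diff i j x) = 0.
Proof.
by rewrite /shift_diff; case: odd => /=; rewrite ?linearN /= diff_diff ?oppr0.
Qed.

(* C[m], with C[m]^i = C^(i + m) and differential (-1)^m d. *)
Definition shift : complex :=
  @Complex (fun i => C (i + m)) shift_diff shift_diff_shape shift_diff_diff.

End Shift.

(* An object of the homotopy category K^b(proj A). *)
Definition bounded_proj (C : complex) : Prop :=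
  (forall i, fg_projective (C i)) /\
  exists N : nat, forall i : int, (N < `|i|)%N -> is_zero_mod (C i).

Definition cx_indecomposable (C : complex) : Prop :=
  ~ hiso C cx_zero /\
  forall X Y, bounded_proj X -> bounded_proj Y -> hiso C (cx_sum X Y) ->
    hiso X cx_zero \/ hiso Y cx_zero.

Definition direct_summand (X C : complex) : Prop :=
  bounded_proj X /\ exists2 Y, bounded_proj Y & hiso C (cx_sum X Y).

Definition two_term (C : complex) : Prop :=
  bounded_proj C /\ forall i : int, i != 0 -> i != -1 -> is_zero_mod (C i).

Definition presilting (C : complex) : Prop :=
  forall m : int, 0 < m ->
    forall f : cx_hom C (shift C m), homotopic f (cx_null C (shift C m)).

Definition basic_cx (C : complex) : Prop :=
  exists (r : nat) (X : 'I_r -> complex),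
    [/\ forall j, bounded_proj (X j) /\ cx_indecomposable (X j),
        forall j l, hiso (X j) (X l) -> j = l &
        hiso C (\big[cx_sum/cx_zero]_(j < r) X j)].

Section GVectors.
Variables (R : realType) (n : nat) (P : 'I_n -> rmod).

Definition is_gvector (C : complex) (g : 'rV[int]_n) : Prop :=
  exists m0 m1 : 'I_n -> nat,
    [/\ has_multiplicities P (C 0) m0,
        has_multiplicities P (C (-1)) m1 &
        g = \row_i ((m0 i)%:Z - (m1 i)%:Z)].

(* Repetitions among the X j do not affect the cone, so the X j need not be
   pairwise non-isomorphic.  Every direct summand of a two-term complex is
   isomorphic to a two-term complex; its g-vector is computed on the latter. *)
Definition gcone (C : complex) : set 'rV[R]_n :=
  [set v | exists (r : nat) (X : 'I_r -> complex) (g : 'I_r -> 'rV[int]_n)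
             (a : 'I_r -> R),
     (forall j, [/\ two_term (X j), cx_indecomposable (X j),
                    direct_summand (X j) C, is_gvector (X j) (g j) &
                    0 <= a j]) /\
     v = \sum_(j < r) a j *: map_mx intr (g j)].

Definition gfan : set (set 'rV[R]_n) :=
  [set S | exists C : complex,
     [/\ two_term C, presilting C, basic_cx C & S = gcone C]].

Definition gfan_support : set 'rV[R]_n := \bigcup_(S in gfan) S.

End GVectors.

(* By the Krull-Schmidt property, a basic decomposition is unique up to a
   permutation and isomorphisms of the summands, so n is the number of isomorphism
   classes of indecomposable projectives and the choice of P is immaterial. *)
Definition g_tame (R : realType) : Prop :=
  exists (n : nat) (P : 'I_n -> rmod),
    basic_decomposition P /\ closure (@gfan_support R n P) = [set: 'rV[R]_n].

End RightModules.

(* Main.v *)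
(* By (SB1)-(SB3) the two sides of each vertex can be attached to the arrows so
   that a product ab of arrows is nonzero only if a enters its target by the side
   from which b leaves.  Leaving a vertex along an arrow is then described by a
   permutation sigma of the sides, nonzero paths follow the orbits of sigma, and
   continuing along sigma on the other side of a vertex gives the product 0.

   A weight h : V -> Z is drawn by |h v| strands at each vertex v, which belong to
   P^0 if h v > 0 and to P^-1 if h v < 0.  Leaves issuing from the strands of P^0
   run along sigma at a level which is shifted by the heights of the sides they
   pass, until they run into a strand of P^-1; the paths they follow are the
   entries of a presentation P^-1 -> P^0 with g-vector h.  If no leaf closes up, a
   monomial map P^-1 -> P^0 is moved along two parallel leaves by a homotopy until
   these diverge, where it vanishes; so the presentation is rigid.

   Closed leaves may exist for h, but not for N h + 1 for suitable large N: the
   leaves of N h + 1 follow those of h, displaced by one level after N steps, so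
   that a closed leaf would have to be displaced for ever.

   The corner rings of the algebra at its vertices are local, so by an exchange
   argument a rigid two-term complex splits into indecomposable ones, whose cone
   contains its g-vector.  As (N g + 1) / (N M) is close to g / M, these
   g-vectors span a dense set of directions.

   Right modules over A are spaces of row vectors over R = A^c, so that products
   in R are read from right to left. *)

(* The obstacle is the closed leaf: moved along it, a monomial may come back to where it started
   without ever meeting a place where it vanishes. Density leaves room to perturb the weight. Adding
   1 to N h at every vertex makes the total height over one turn of sigma (its order) equal to N D
   plus or minus that order, which is non-zero once N exceeds the order. Non-zero drift confines
   closed leaves to a zone near level 0 whose depth, measured in units of N, depends only on h. So N
   can be chosen after this zone is known, as a multiple of every period possible in it.

   Infinite dimension matters at two places. An entry of a map is a series of paths along one orbit;
   only the finitely many arrows of one leaf are peeled off it, and the whole tail factors through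
   that leaf, so that no limit of homotopies is taken. And completeness makes a series in a corner
   invertible as soon as its constant term is non-zero, which is where locality comes from. *)
From HB Require Import structures.
From mathcomp Require Import all_boot all_order all_algebra all_fingroup.
From mathcomp Require Import all_classical all_reals all_analysis.
From mathcomp Require Import zify ring lra.
Require Import Defs.
Set Implicit Arguments.
Unset Strict Implicit.
Unset Printing Implicit Defensive.
Import Order.TTheory GRing.Theory Num.Theory.
Import numFieldNormedType.Exports.
Local Open Scope ring_scope.

(** * Leaves of a weight *)

Section Leaf.
Variables (V : finType) (sigma : {perm V * bool}).
Implicit Types (g h : V -> int) (s : V * bool) (b : bool) (l : int).
Local Notation state := (bool * (V * bool) * int)%type.

Definition flip s : V * bool := (s.1, ~~ s.2).

Lemma flipK : involutive flip.
Proof. by case=> v c; rewrite /flip /= negbK. Qed.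

Definition nxt b : {perm V * bool} := if b then sigma else sigma^-1%g.

Definition sg b (x : int) : int := if b then x else - x.

(* A leaf at level l < 0 travels along sigma (b = true) or against it.  It passes
   the side s, which shifts its level by the height, unless it runs into an end
   at s: it then crosses the vertex and leaves by the opposite side, in the
   opposite direction. *)
Definition step h (x : state) : state :=
  let: (b, s, l) := x in
  if sg b (h s.1) <= l then (~~ b, nxt (~~ b) (flip s), sg b (h s.1) - l - 1)
  else (b, nxt b s, l - sg b (h s.1)).

Lemma step_neg h x : x.2 < 0 -> (step h x).2 < 0.
Proof. by case: x => [[b s] l] /=; case: ifP => /=; lia. Qed.

Lemma iter_step_neg h n x : x.2 < 0 -> (iter n (step h) x).2 < 0.
Proof. by elim: n => //= n IHn /IHn; apply: step_neg. Qed.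

(** The image tells which branch was taken. If a crossing has incoming direction [b] and
    [H = sg b (h s.1)], it lands at a level at least [H], while passing the same vertex in the
    outgoing direction lands below [H]. *)
Lemma step_inj h x y : x.2 < 0 -> y.2 < 0 -> step h x = step h y -> x = y.
Proof.
case: x => [[b s] l]; case: y => [[c t] m] /= l0 m0.
case: ifP => hl; case: ifP => hm [eb].
- rewrite (negb_inj eb) => /perm_inj/(can_inj flipK) es; rewrite es => el.
  by congr (_, _, _); lia.
- rewrite -eb => /perm_inj es; rewrite -es /= => el.
  by move: el; rewrite /sg; case: (b) => /=; lia.
- rewrite eb => /perm_inj es; rewrite es /= => el.
  by move: el; rewrite /sg; case: (c) => /=; lia.
- rewrite eb => /perm_inj es; rewrite es => el.
  by congr (_, _, _); lia.
Qed.

Lemma iter_step_inj h n x y : x.2 < 0 -> y.2 < 0 ->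
  iter n (step h) x = iter n (step h) y -> x = y.
Proof.
elim: n x y => //= n IHn x y x0 y0 /step_inj e.
by apply: IHn => //; apply: e; apply: iter_step_neg.
Qed.

Definition periodic h (x : state) :=
  x.2 < 0 /\ exists2 p, (0 < p)%N & iter p (step h) x = x.

Definition acyclic_leaves h := forall x, ~ periodic h x.

Lemma periodic_iter h n x : periodic h x -> periodic h (iter n (step h) x).
Proof.
move=> [x0 [p p0 px]]; split; first exact: iter_step_neg.
by exists p => //; rewrite -iterD addnC iterD px.
Qed.

Lemma iter_mul_fix (T : Type) (f : T -> T) p n x :
  iter p f x = x -> iter (n * p) f x = x.
Proof. by move=> px; elim: n => //= n IHn; rewrite mulSn iterD IHn. Qed.

Definition drift h b s n : int := \sum_(r < n) sg b (h (iter r (nxt b) s).1).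

Definition turn := #[sigma]%g.
Definition mass h : int := \sum_(s : V * bool) `|h s.1|.

Lemma turn_gt0 : (0 < turn)%N. Proof. exact: order_gt0. Qed.

Lemma iter_turn b s : iter turn (nxt b) s = s.
Proof.
rewrite -permX; have -> : (nxt b ^+ turn = 1)%g; last by rewrite perm1.
by rewrite /nxt; case: b; rewrite ?expVgn expg_order ?invg1.
Qed.

Lemma normr_sg b x : `|sg b x| = `|x|.
Proof. by case: b; rewrite //= normrN. Qed.

Lemma drift_le h b s n : `|drift h b s n| <= mass h *+ n.
Proof.
apply: le_trans (ler_norm_sum _ _ _) _; rewrite -[n in X in _ <= X]card_ord.
rewrite -sumr_const; apply: ler_sum => r _; rewrite normr_sg.
rewrite /mass (bigD1 (iter r (nxt b) s)) //= lerDl.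
by apply: sumr_ge0 => ? _.
Qed.

Lemma mass_ge0 h : 0 <= mass h.
Proof. by apply: sumr_ge0. Qed.

(** A turn changes the level by at most [mass h *+ turn], so from below that depth no end is met
    during a whole turn. *)
Lemma deep_iter h b s l j : (j <= turn)%N -> l < - (mass h *+ turn) ->
  iter j (step h) (b, s, l) = (b, iter j (nxt b) s, l - drift h b s j).
Proof.
move=> + ldeep; elim: j => [|j IHj] lejm; first by rewrite /drift big_ord0 subr0.
rewrite /= IHj 1?ltnW //=.
have le1 := drift_le h b s j.+1; move: le1.
have: mass h *+ j.+1 <= mass h *+ turn by apply: ler_wpMn2l => //; exact: mass_ge0.
rewrite /drift big_ord_recr /= -/(drift h b s j) => le2 le1.
case: ifP => [le3|_]; last by congr (_, _, _); rewrite opprD addrA.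
exfalso; lia.
Qed.

(** A deep leaf with non-zero drift sinks for ever, in forward time if the drift is positive and in
    backward time if it is negative. *)
Lemma periodic_ge h x : (forall b s, drift h b s turn != 0) ->
  periodic h x -> - (mass h *+ turn) <= x.2.
Proof.
move=> nz [x0 [p p0 px]]; rewrite leNgt; apply/negP.
case: x x0 px => [[b s] l] /= l0 px deep; have := nz b s.
set D := drift h b s turn => D0.
have deepk k (l' : int) : l' < - (mass h *+ turn) -> 0 < D ->
  iter (k * turn) (step h) (b, s, l') = (b, s, l' - D * k%:Z).
  elim: k l' => [|k IHk] l' ltl Dk; first by rewrite mulr0 subr0.
  by rewrite mulSnr iterD deep_iter // iter_turn -/D IHk //;
    [congr (_, _, _)|]; lia.
have deepNk k (l' : int) : l' < - (mass h *+ turn) -> D < 0 ->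
  iter (k * turn) (step h) (b, s, l' + D * k%:Z) = (b, s, l').
  elim: k l' => [|k IHk] l' ltl Dk; first by rewrite mulr0 addr0.
  rewrite mulSn iterD (_ : l' + _ = (l' + D) + D * k%:Z); last by lia.
  by rewrite IHk ?deep_iter ?iter_turn -/D ?addrK //; lia.
have := iter_mul_fix turn px; rewrite mulnC.
have [Dlt|Dgt|De] := ltrgt0P D; last by rewrite De eqxx in D0.
  by rewrite deepk // => -[] e; move: p0 e Dlt; nia.
(* Negative drift: the state at level [l + D * p] reaches level [l] in the same number of steps that
   bring the closed leaf back to [l], against injectivity. *)
move=> e; have e' := deepNk p l deep Dgt.
have neg : l + D * p%:Z < 0 by move: Dgt l0; nia.
have [] := @iter_step_inj h (p * turn) (b, s, l) (b, s, l + D * p%:Z) l0 neg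
  (etrans e (esym e')).
by move=> {}e; move: p0 e Dgt; nia.
Qed.

(* The level N l + c of the system of N g + 1 is seen as the cell l of the
   system of g together with a clock c, which ticks at each step. *)
Definition emb (N c : nat) (x : state) : state :=
  let: (b, s, l) := x in
  (b, s, N%:Z * l + (if b then c%:Z else N%:Z - 1 - c%:Z)).

(** When the clock stands at 0, the extra unit of height carries over into a whole cell. A leaf
    travelling backwards in the top cell then meets the additional strand, which turns it around. *)
Definition jump (x : state) : state :=
  let: (b, s, l) := x in
  if b then (true, s, l - 1)
  else if l == -1 then (true, flip s, -1) else (false, s, l + 1).

Lemma jump_neg x : x.2 < 0 -> (jump x).2 < 0.
Proof. by case: x => [[[] s] l] //=; [lia|case: eqP => //=; lia]. Qed.

Definition blowup g N : V -> int := fun v => N%:Z * g v + 1.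

Lemma step_emb g N c x : (c.+1 < N)%N -> x.2 < 0 ->
  step (blowup g N) (emb N c.+1 x) = emb N c (step g x).
Proof.
case: x => [[b s] l] /= ltcN l0; rewrite /blowup.
have NE : N%:Z > c%:Z + 1 by lia.
case: b => /=.
  case: (leP (g s.1) l) => le1; case: leP => le2.
  - by congr (_, _, _); rewrite mulrBr mulrBr; lia.
  - by exfalso; nia.
  - by exfalso; nia.
  - by congr (_, _, _); rewrite mulrBr; lia.
case: (leP (- g s.1) l) => le1; case: leP => le2.
- by congr (_, _, _); rewrite !mulrBr !mulrN; lia.
- by exfalso; nia.
- by exfalso; nia.
- by congr (_, _, _); rewrite opprK mulrDr; lia.
Qed.

Lemma step_emb0 g N x : (0 < N)%N -> x.2 < 0 ->
  step (blowup g N) (emb N 0 x) = emb N N.-1 (step g (jump x)).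
Proof.
case: x => [[b s] l] /= N0 l0; rewrite /blowup.
have NE : N.-1%:Z = N%:Z - 1 by lia.
case: b => /=.
  case: (leP (g s.1) (l - 1)) => le1; case: leP => le2.
  - by congr (_, _, _); rewrite !(mulrBr, NE); lia.
  - by exfalso; nia.
  - by exfalso; nia.
  - by congr (_, _, _); rewrite !(mulrBr, NE); lia.
case: eqP => [->|l1] /=.
  case: (leP (g s.1) (-1)) => le1; case: leP => le2.
  - by exfalso; nia.
  - by rewrite flipK; congr (_, _, _); rewrite !(mulrBr, NE); lia.
  - by congr (_, _, _); rewrite !(mulrBr, NE); lia.
  - by exfalso; nia.
case: (leP (- g s.1) (l + 1)) => le1; case: leP => le2.
- by congr (_, _, _); rewrite !(mulrBr, mulrDr, mulrN, NE); lia.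
- by exfalso; nia.
- by exfalso; nia.
- by congr (_, _, _); rewrite !(mulrBr, mulrDr, mulrN, NE); lia.
Qed.

Lemma iter_step_emb g N i c x : (i + c < N)%N -> x.2 < 0 ->
  iter i (step (blowup g N)) (emb N (i + c) x) = emb N c (iter i (step g) x).
Proof.
elim: i x => //= i IHi x lt x0.
by rewrite -iterS iterSr step_emb // IHi -?iterSr ?step_neg // ltnW.
Qed.

Lemma drift_blowup g N b s n :
  drift (blowup g N) b s n = N%:Z * drift g b s n + sg b n%:Z.
Proof.
have -> : n%:Z = \sum_(r < n) 1 by rewrite sumr_const card_ord natz.
rewrite /drift mulr_sumr.
case: b; rewrite /sg -?sumrN -big_split /=; apply: eq_bigr => i _ //.
by rewrite /blowup opprD mulrN.
Qed.

(** The drift is congruent to plus or minus [turn] modulo [N], and [0 < turn < N]. *)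
Lemma drift_blowup_neq0 g N b s : (turn < N)%N ->
  drift (blowup g N) b s turn != 0.
Proof.
move=> ltN; rewrite drift_blowup; apply/eqP; have := turn_gt0.
move: (drift _ _ _ _) => D; case: (ltrgt0P D) => D0; case: b => /=; nia.
Qed.

Lemma mass_blowup g N : mass (blowup g N) <= N%:Z * mass g + #|{: V * bool}|%:Z.
Proof.
have -> : #|{: V * bool}|%:Z = \sum_(s : V * bool) 1 by rewrite sumr_const natz.
rewrite /mass mulr_sumr -big_split /=.
apply: ler_sum => s _; rewrite /blowup; apply: le_trans (ler_normD _ _) _.
by rewrite normrM lerD2l.
Qed.

(** A backward state climbs to level -1, is turned around there, and from then on sinks by one at
    each jump. *)
Lemma iter_jump_unbounded (x : state) (K : int) : x.2 < 0 ->
  exists k, (iter k jump x).2 < - K.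
Proof.
have fwd (s : V * bool) (l : int) k :
    iter k jump (true, s, l) = (true, s, l - k%:Z).
  elim: k => [|k IHk]; first by rewrite subr0.
  by rewrite iterS IHk /=; congr (_, _, _); lia.
have ub s l : exists k, (iter k jump (true, s, l)).2 < - K.
  by exists (`|l| + `|K| + 1)%N; rewrite fwd /=; lia.
case: x => [[[] s] l] /= l0; first exact: ub.
have [m lE] : exists m : nat, l = - 1 - m%:Z by exists (`|l| - 1)%N; lia.
elim: m l lE {l0} => [|m IHm] l ->.
  by have [k ?] := ub (flip s) (-1); exists k.+1; rewrite iterSr.
have [k ?] := IHm _ erefl; exists k.+1; rewrite iterSr.
move lE : (-1 - m.+1%:Z) => l' /=; case: (l' =P -1) => [|_]; first by lia.
by rewrite (_ : l' + 1 = -1 - m%:Z) //; lia.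
Qed.

Lemma pigeonhole (T : Type) (A : finType) (f : T -> A) (u : nat -> T) :
  (forall i j, (i <= #|A|)%N -> (j <= #|A|)%N -> f (u i) = f (u j) -> u i = u j) ->
  exists i j, [/\ (i < j)%N, (j <= #|A|)%N & u i = u j].
Proof.
move=> inj; have /injectivePn[x [y neq fxy]] :
    ~~ injectiveb (fun i : 'I_#|A|.+1 => f (u i)).
  by apply/negP => /injectiveP/leq_card; rewrite card_ord ltnn.
have uxy : u x = u y by apply: inj => //; rewrite -ltnS.
have [lt|lt|e] := ltngtP x y; last by rewrite (val_inj e) eqxx in neq.
  by exists x, y; split => //; rewrite -ltnS.
by exists y, x; split => //; rewrite -ltnS.
Qed.

(** Euclidean division of the level by [N] yields a cell and a clock; the closed leaf is then
    followed until the clock is at 0. *)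
Lemma periodic_emb0 g N x : (0 < N)%N -> periodic (blowup g N) x ->
  exists2 y, y.2 < 0 & periodic (blowup g N) (emb N 0 y).
Proof.
move=> N0 px; have x0 := px.1.
have [c [y [ltcN y0 e]]] : exists c y, [/\ (c < N)%N, y.2 < 0 & x = emb N c y].
  case: x x0 {px} => [[b s] l] /= l0.
  have := divz_eq l N%:Z; have := modz_ge0 l (_ : N%:Z != 0).
  have := ltz_pmod l (_ : 0 < N%:Z).
  set q := (l %/ _)%Z; set r := (l %% _)%Z => rlt r0 lE.
  have {}r0 : 0 <= r by apply: r0; lia.
  have {}rlt : r < N%:Z by apply: rlt; lia.
  have q0 : q < 0 by nia.
  case: b; first by exists `|r|%N, (true, s, q); split => //=; [lia|congr (_, _, _); lia].
  exists (N - 1 - `|r|)%N, (false, s, q); split => //=; first lia.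
  by congr (_, _, _); lia.
exists (iter c (step g) y); first exact: iter_step_neg.
by rewrite -iter_step_emb ?addn0 // -e; apply: periodic_iter.
Qed.

Lemma iter_cycle_emb g N x : (0 < N)%N -> x.2 < 0 ->
  iter N (step (blowup g N)) (emb N 0 x) = emb N 0 (iter N (step g) (jump x)).
Proof.
move=> N0 x0; rewrite -{1}(prednK N0) iterSr step_emb0 //.
have e := @iter_step_emb g N N.-1 0 (step g (jump x)); rewrite addn0 in e.
by rewrite e ?prednK // -?iterSr ?prednK //; apply/step_neg/jump_neg.
Qed.

(* Running N steps from clock 0 is a jump followed by N steps of the system of
   g, which fix the bounded orbits when N is divisible enough; so a closed leaf
   would be moved arbitrarily far down by the jumps. *)
Theorem blowup_acyclic g (N0 : nat) :
  exists2 N, (N0 < N)%N & acyclic_leaves (blowup g N).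
Proof.
(* [periodic_ge] bounds the levels of the blown-up system by its mass times [turn]. Divided by [N],
   this bound stays below [Kg] for the [N] chosen next, although [Kg] is defined from [g] alone. *)
pose Kg : nat := (`|mass g| * turn + 2 + #|{: V * bool}| * turn)%N.
pose A : finType := (bool * (V * bool) * 'I_Kg.+1)%type.
(* The factorial makes [N] divisible by every period up to [#|A|]; the second factor makes [N]
   exceed [N0], [turn], [#|A|] and the correction in [mass_blowup]. *)
pose N := ((#|A| + N0 + turn)`! * (N0 + turn + #|A| + 2 + #|{: V * bool}| * turn))%N.
have fac0 := fact_gt0 (#|A| + N0 + turn).
have NE : (N0 + turn + #|A| + 2 + #|{: V * bool}| * turn <= N)%N by rewrite leq_pmull.
have dvdN q : (0 < q)%N -> (q <= #|A|)%N -> (q %| N)%N.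
  by move=> q0 le; rewrite dvdn_mulr // dvdn_fact // q0 -addnA (leq_trans le) ?leq_addr.
have N_gt0 : (0 < N)%N by lia.
exists N; first lia.
have bound x : x.2 < 0 -> forall c, (c < N)%N ->
    periodic (blowup g N) (emb N c x) -> - Kg%:Z <= x.2.
  have ltN : (turn < N)%N by lia.
  move=> x0 c ltc /(periodic_ge (fun b s => drift_blowup_neq0 g b s ltN)).
  have := mass_blowup g N; have := mass_ge0 g; have := turn_gt0.
  have NA : (#|{: V * bool}| * turn <= N)%N. by lia.
  have -> : Kg%:Z = mass g * turn%:Z + 2 + #|{: V * bool}|%:Z * turn%:Z.
    rewrite /Kg !PoszD !PoszM; have := mass_ge0 g; lia.
  case: x x0 => [[b s] l] /= l0.
  rewrite -mulr_natr natz; move: (mass _) => m; move: (mass g) => m'.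
  move: #|_| turn NA => n t NA t0 m0 le1; case: b; nia.
have jumpP y : y.2 < 0 -> periodic (blowup g N) (emb N 0 y) ->
    periodic (blowup g N) (emb N 0 (jump y)).
  move=> y0 py; have z0 := jump_neg y0.
  suff e : iter N (step g) (jump y) = jump y.
    by rewrite -e -iter_cycle_emb //; apply: periodic_iter.
  (* [u i] is the cell occupied while the clock runs down from [N - 1], hence bounded for [i] up to
     [#|A|], which is below [N]. A repetition then gives [jump y] a period dividing [N]. *)
  pose u i := iter i.+1 (step g) (jump y).
  pose f (x : state) : A := (x.1.1, x.1.2, inord `|x.2|).
  have uP i : (i <= #|A|)%N -> - Kg%:Z <= (u i).2 < 0.
    move=> le; have u0 : (u i).2 < 0 by apply: iter_step_neg.
    rewrite u0 andbT; apply: (bound _ u0 (N.-1 - i)%N); first lia.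
    have eN : N.-1 = (i + (N.-1 - i))%N by lia.
    have /(periodic_iter i.+1) := py; rewrite iterSr step_emb0 // {1}eN.
    by rewrite iter_step_emb /u ?iterSr //; [lia | apply: step_neg].
  have [|i [j [ltij lej euij]]] := @pigeonhole _ A f u.
    move=> i j /uP/andP[]; case: (u i) => [[b s] l] /= l1 l0.
    move=> /uP/andP[]; case: (u j) => [[c t] m] /= m1 m0.
    rewrite /f /= => -[-> -> /(congr1 (@nat_of_ord _))]; rewrite !inordK //=; last 2 first.
    - by rewrite ltnS; lia.
    - by rewrite ltnS; lia.
    by move=> e; congr (_, _, _); lia.
  have e : iter (j - i) (step g) (jump y) = jump y.
    apply/esym/(@iter_step_inj g i.+1) => //; first exact: iter_step_neg.
    by rewrite -iterD addSn subnKC ?(ltnW ltij).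
  have /dvdnP[q ->] : (j - i %| N)%N by apply: dvdN; lia.
  exact: iter_mul_fix.
move=> x /(periodic_emb0 N_gt0)[y y0 py].
have iterP k : (iter k jump y).2 < 0 /\ periodic (blowup g N) (emb N 0 (iter k jump y)).
  by elim: k => //= k [IH0 IHp]; split; [apply: jump_neg | apply: jumpP].
have [k] := iter_jump_unbounded Kg y0; have [k0 pk] := iterP k.
by rewrite ltNge (bound _ k0 0%N).
Qed.
End Leaf.

(** * Ends matched by the leaves *)

Section Matching.
Variables (V : finType) (sigma : {perm V * bool}) (h : V -> int).
Local Notation S := (V * bool)%type.
Implicit Types (s t : S) (a b : int) (k : nat).

Definition hgt (s : S) : int := h s.1.

Lemma stepE (b : bool) s (l : int) : step sigma h (b, s, l) =
  if sg b (hgt s) <= l then (~~ b, nxt sigma (~~ b) (flip s), sg b (hgt s) - l - 1)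
  else (b, nxt sigma b s, l - sg b (hgt s)).
Proof. by []. Qed.

Definition sh k (s : S) : S := iter k sigma s.

Lemma shD i j s : sh (i + j) s = sh i (sh j s).
Proof. exact: iterD. Qed.

Lemma sh_inj k : injective (sh k).
Proof. by elim: k => //= n IHn x y /perm_inj/IHn. Qed.

Definition phi s a k : int := a - \sum_(r < k) hgt (sh r s).

Lemma phi0 s a : phi s a 0 = a. Proof. by rewrite /phi big_ord0 subr0. Qed.

Lemma phiS s a k : phi s a k.+1 = phi s a k - hgt (sh k s).
Proof. by rewrite /phi big_ord_recr opprD addrA. Qed.

Lemma phiDl s a c k : phi s (a + c) k = phi s a k + c.
Proof. by rewrite /phi addrAC. Qed.

Lemma phi_add s a i j : phi s a (i + j) = phi (sh i s) (phi s a i) j.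
Proof.
elim: j => [|j IHj]; first by rewrite addn0 phi0.
by rewrite addnS !phiS IHj -shD addnC.
Qed.

(** The level would become non-negative just after the side [sh k s]: there the leaf of [(s, a)]
    runs into a strand of P^-1, and [k] is the number of arrows of its path. *)
Definition matched s a k : bool :=
  [&& (0 < k)%N, [forall j : 'I_k, phi s a j.+1 < 0] & 0 <= phi s a k.+1].

Lemma matchedP s a k : reflect
  [/\ (0 < k)%N, forall j, (0 < j <= k)%N -> phi s a j < 0 & 0 <= phi s a k.+1]
  (matched s a k).
Proof.
apply: (iffP and3P) => -[k0 neg kS]; split=> //.
  case=> // j /= ltj; exact: (forallP neg (Ordinal ltj)).
by apply/forallP => j; apply: neg; rewrite /= ltn_ord.
Qed.

Definition pos_end s a := 0 <= a < hgt s.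
Definition neg_end s a := hgt s <= a < 0.

Lemma matched_end s a k : matched s a k -> neg_end (sh k s) (phi s a k).
Proof.
case/matchedP => k0 neg pos; have := neg k; rewrite k0 leqnn => /(_ isT).
by move: pos; rewrite phiS /neg_end; lia.
Qed.

Lemma matched_uniq s a k k' : matched s a k -> matched s a k' -> k = k'.
Proof.
move=> /matchedP[k0 neg1 pos1] /matchedP[k0' neg2 pos2].
have [lt|lt|//] := ltngtP k k'.
  by have := neg2 k.+1 lt; lia.
by have := neg1 k'.+1 lt; lia.
Qed.

(** Of two leaves with a common end, the longer would contain the start of the shorter, at a level
    that has to be both negative and non-negative. *)
Lemma matched_back s a s' a' k k' : pos_end s a -> pos_end s' a' ->
  matched s a k -> matched s' a' k' ->
  sh k s = sh k' s' -> phi s a k = phi s' a' k' ->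
  [/\ s = s', a = a' & k = k'].
Proof.
wlog lekk' : s a s' a' k k' / (k <= k')%N.
  move=> W; have [|/ltnW] := leqP k k'; first exact: W.
  by move=> le p p' m m' e e'; have [] := W _ _ _ _ _ _ le p' p m' m (esym e) (esym e').
move=> ps ps' mk mk' et eb; have [d dE] : exists d, k' = (d + k)%N.
  by exists (k' - k)%N; rewrite subnK.
have es : sh d s' = s.
  by apply: (@sh_inj k); rewrite -shD addnC -dE.
move: eb; rewrite dE phi_add es => eb.
have ea : a = phi s' a' d by apply: addIr eb.
case: d dE es ea {eb} => [|d] dE es ea.
  by split; rewrite ?dE // -?es // ea phi0.
have /matchedP[_ neg _] := mk'; have := neg d.+1; rewrite -ea dE.
by move: ps; rewrite /pos_end leq_addr => /andP[a0 _] /(_ isT); lia.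
Qed.

(** After a full turn the leaf is back on the same side at a lower level, where it stays below its
    own earlier course and cannot return to level 0. This bound makes [link] a finite type. *)
Lemma matched_turn s a k : 0 <= a -> matched s a k -> (k < turn sigma)%N.
Proof.
move=> a0 /matchedP[k0 neg pos]; rewrite ltnNge; apply/negP => le.
have t0 := turn_gt0 sigma; have et : sh (turn sigma) s = s.
  exact: (iter_turn sigma true).
have e : phi s a k.+1 = phi s (phi s a (turn sigma)) (k.+1 - turn sigma).
  by rewrite -[in LHS](subnKC (leqW le)) phi_add et.
have n1 : phi s a (turn sigma) < 0 by apply: neg; rewrite t0.
have n2 : phi s a (k.+1 - turn sigma) < 0 by apply: neg; lia.
move: pos; rewrite e -[phi s a (turn _)](subrK a) addrC phiDl; lia.
Qed.

(* A leaf entering at a height above that of an end must stop before it. *)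
Lemma matched_fwd s a b k : pos_end s a -> (0 < k)%N ->
  neg_end (sh k s) b -> b <= phi s a k ->
  exists2 k', (k' <= k)%N & matched s a k'.
Proof.
move=> ps k0 nt le.
pose P j := (0 < j)%N && (0 <= phi s a j.+1).
have Pk : P k by rewrite /P k0 phiS; move: nt; rewrite /neg_end; lia.
have [k' /andP[k'0 pos] min] := ex_minnP (ex_intro P k Pk).
exists k'; first exact: min.
apply/matchedP; split=> // -[//|j] /= lej; rewrite ltNge; apply/negP => ge0.
case: j lej ge0 => [_|j lej ge0].
  by rewrite phiS phi0 /=; move: ps; rewrite /pos_end; lia.
by have := min j.+1; rewrite /P ge0 => /(_ isT); lia.
Qed.

(** Raise the leaf by [c] so that it arrives at [b]. The last side before the end at which the
    raised level is non-negative carries the strand of P^0 that is joined to [b]. *)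
Lemma matched_bwd s a b k : 0 <= a -> (0 < k)%N ->
  neg_end (sh k s) b -> phi s a k <= b ->
  exists s' a' k', [/\ (0 < k' <= k)%N, pos_end s' a', matched s' a' k',
    s' = sh (k - k') s & phi s' a' k' = b].
Proof.
move=> a0 k0 nt le; have [c cE] : exists c : int, c = b - phi s a k by exists (b - phi s a k).
pose P j := (j < k)%N && (0 <= phi s (a + c) j).
have P0 : P 0%N by rewrite /P k0 phi0; lia.
have Pub j : P j -> (j <= k)%N by case/andP => /ltnW.
have [j /andP[ltj pos] max] := ex_maxnP (ex_intro P 0%N P0) Pub.
have neg i : (j < i <= k)%N -> phi s (a + c) i < 0.
  move=> /andP[lti]; rewrite leq_eqVlt => /orP[/eqP->|ltk].
    by move: nt; rewrite phiDl /neg_end; lia.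
  rewrite ltNge; apply/negP => ge0; have := max i; rewrite /P ltk ge0 => /(_ isT); lia.
have kE : k = (j + (k - j))%N by rewrite subnKC // ltnW.
have eb : phi (sh j s) (phi s (a + c) j) (k - j) = b.
  by rewrite -phi_add -kE phiDl; lia.
exists (sh j s), (phi s (a + c) j), (k - j)%N; split=> //; first lia.
- by rewrite /pos_end pos /=; have := neg j.+1; rewrite phiS ltnSn ltj => /(_ isT); lia.
- apply/matchedP; split; first lia.
    by move=> i /andP[i0 lei]; rewrite -phi_add; apply: neg; lia.
  by rewrite phiS eb -shD subnK ?(ltnW ltj) //; move: nt; rewrite /neg_end; lia.
- by rewrite subKn // ltnW.
Qed.

(** The level of the same strand seen from the opposite side of its vertex, where the order of the
    strands is reversed. *)
Definition cross s a : int := hgt s - 1 - a.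

(** An end of P^0 has a non-negative level, whereas [step] describes negative ones; so the leaf is
    recorded when [s] has already been passed. *)
Definition fwd s a : bool * S * int := (true, sigma s, a - hgt s).

Lemma step_fwd s a k : matched s a k ->
  iter k (step sigma h) (fwd s a) =
  (false, (sigma^-1)%g (flip (sh k s)), cross (sh k s) (phi s a k)).
Proof.
case/matchedP=> k0 neg pos.
have run j : (j < k)%N ->
    iter j (step sigma h) (fwd s a) = (true, sh j.+1 s, phi s a j.+1).
  elim: j => [|j IHj] ltj; first by rewrite /fwd phiS phi0.
  rewrite iterS IHj ?(ltnW ltj) // stepE /= -phiS.
  have := neg j.+2; rewrite phiS /= => /(_ ltj) n2.
  by case: ifP => [|_]; first by move: n2 => /=; lia.
case: k k0 neg pos run => // k _ neg pos run; rewrite iterS run // stepE /=.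
move: pos; rewrite phiS => pos; rewrite ifT; last by move: pos => /=; lia.
by congr (_, _, _); rewrite /cross /hgt /=; lia.
Qed.

Lemma step_bwd s a k : pos_end s a -> matched s a k ->
  iter k (step sigma h) (false, (sigma^-1)%g (sh k s), phi s a k) =
  fwd (flip s) (cross s a).
Proof.
move=> ps /matchedP[k0 neg pos].
have run j : (j < k)%N -> iter j (step sigma h)
    (false, (sigma^-1)%g (sh k s), phi s a k) =
    (false, sh (k - j.+1) s, phi s a (k - j)).
  elim: j => [|j IHj] ltj.
    by rewrite subn0 subn1 -[in sh k s](prednK k0) /= permK.
  rewrite iterS IHj ?(ltnW ltj) // stepE /=.
  have e : phi s a (k - j) = phi s a (k - j.+1) - hgt (sh (k - j.+1) s).
    by rewrite (_ : k - j = (k - j.+1).+1)%N ?phiS //; lia.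
  have n1 : phi s a (k - j.+1) < 0 by apply: neg; lia.
  rewrite ifF; last by move: n1 => /=; lia.
  have e' : sh (k - j.+1) s = sigma (sh (k - j.+2) s).
    by rewrite (_ : k - j.+1 = (k - j.+2).+1)%N //; lia.
  by rewrite {1}e' /= permK; congr (_, _, _); lia.
case: k k0 neg pos run => // k _ neg pos run; rewrite iterS run // stepE /=.
rewrite subnn subSn // subnn phiS phi0 -[sh 0 s]/s /= ifT; last by move: ps; rewrite /pos_end; lia.
by rewrite /fwd /cross -[hgt (flip s)]/(hgt s); congr (_, _, _); lia.
Qed.

Lemma cross_pos s a : pos_end s a -> pos_end (flip s) (cross s a).
Proof. by rewrite /pos_end /cross /hgt /=; lia. Qed.
Lemma cross_neg s a : neg_end s a -> neg_end (flip s) (cross s a).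
Proof. by rewrite /neg_end /cross /hgt /=; lia. Qed.
Definition width : nat := (\sum_v `|h v|)%N.

Lemma width_ge v : (`|h v| <= width)%N.
Proof. by rewrite /width (bigD1 v) //= leq_addr. Qed.

(* The copies of the vertex v are numbered along its side (v, false). *)
Definition strand := (V * 'I_width.+1)%type.

(** A strand has the two ends [(s, a)] and [(flip s, cross s a)]; counting backwards on the sides
    with [s.2] gives both the same number. *)
Definition pt s a : strand :=
  (s.1, inord `|(if 0 < hgt s then (if s.2 then cross s a else a)
                 else (if s.2 then a - hgt s else - 1 - a))%R|%N).

Lemma pt_flip s a : pos_end s a || neg_end s a -> pt (flip s) (cross s a) = pt s a.
Proof.
rewrite /pos_end /neg_end /pt /cross /hgt; case: s => v c /= hv; congr (_, inord _).
by case: ifP => h0; case: c => /=; lia.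
Qed.

Lemma pt_inj s a s' a' : pos_end s a && pos_end s' a' || neg_end s a && neg_end s' a' ->
  pt s a = pt s' a' -> (s' = s /\ a' = a) \/ (s' = flip s /\ a' = cross s a).
Proof.
case: s => v c; case: s' => v' c'; rewrite /pos_end /neg_end /pt /cross /hgt /= => val.
case=> ev /(congr1 (@nat_of_ord _)); subst v'; have w := width_ge v; rewrite !inordK; first last.
- by case: ifP; case: (c); lia.
- by case: ifP; case: (c'); lia.
rewrite /flip /=; case: ifP => h0; case: c; case: c' => /= e;
  by [left; split=> //; lia | right; split=> //; lia].
Qed.

Definition plus_strand (i : strand) : bool := (i.2%:Z < h i.1).
Definition minus_strand (i : strand) : bool := (i.2%:Z < - h i.1).

Lemma strand_signs i j : i.1 = j.1 -> plus_strand i -> ~ minus_strand j.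
Proof.
by case: i j => [v y] [w z]; rewrite /plus_strand /minus_strand /= => ->; lia.
Qed.

Lemma plus_pt s a : pos_end s a -> plus_strand (pt s a).
Proof.
case: s => v c; rewrite /pos_end /hgt /plus_strand /pt /cross /hgt /= => ps.
have := width_ge v => w; rewrite inordK; first by case: ifP; case: c; lia.
by case: ifP; case: c; lia.
Qed.

Lemma minus_pt s a : neg_end s a -> minus_strand (pt s a).
Proof.
case: s => v c; rewrite /neg_end /hgt /minus_strand /pt /cross /hgt /= => ps.
have := width_ge v => w; rewrite inordK; first by case: ifP; case: c; lia.
by case: ifP; case: c; lia.
Qed.

Lemma plus_strand_end (i : strand) s : plus_strand i -> s.1 = i.1 ->
  exists2 a, pos_end s a & pt s a = i.
Proof.
case: i => v y; case: s => v' c /= py ->; move: py; rewrite /plus_strand /= => py.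
exists (if c then h v - 1 - y%:Z else y%:Z); first by rewrite /pos_end /hgt /=; case: c; lia.
rewrite /pt /cross /hgt /=; congr (_, _); apply: val_inj => /=.
by rewrite inordK; case: c; case: ifP; rewrite ?ltnS; have := ltn_ord y; lia.
Qed.

Lemma minus_strand_end (i : strand) s : minus_strand i -> s.1 = i.1 ->
  exists2 a, neg_end s a & pt s a = i.
Proof.
case: i => v y; case: s => v' c /= py ->; move: py; rewrite /minus_strand /= => py.
exists (if c then h v + y%:Z else -1 - y%:Z); first by rewrite /neg_end /hgt /=; case: c; lia.
rewrite /pt /cross /hgt /=; congr (_, _); apply: val_inj => /=.
by rewrite inordK; case: c; case: ifP; rewrite ?ltnS; have := ltn_ord y; lia.
Qed.

(* A property inherited along a leaf would hold for infinitely many ends. *)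
Lemma acyclic_ends (P : S -> int -> Prop) : acyclic_leaves sigma h ->
  (forall s a, P s a -> pos_end s a /\ exists s' a' m,
    [/\ P s' a', (0 < m)%N & iter m (step sigma h) (fwd s a) = fwd s' a']) ->
  forall s a, ~ P s a.
Proof.
move=> acyc next s0 a0 P0.
pose Q (x y : S * int) := P x.1 x.2 -> P y.1 y.2 /\
  exists2 m, (0 < m)%N & iter m (step sigma h) (fwd x.1 x.2) = fwd y.1 y.2.
have /choice[f fP] x : exists y, Q x y.
  have [Px|NPx] := pselect (P x.1 x.2); last by exists x.
  by have [_ [s [a [m [Ps m0 e]]]]] := next _ _ Px; exists (s, a); split=> //; exists m.
pose u n := iter n f (s0, a0).
have uP n : P (u n).1 (u n).2 by elim: n => // n /fP[].
pose c (x : S * int) : S * 'I_width.+1 := (x.1, inord `|x.2|).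
have [|i [j [ltij _ eu]]] := @pigeonhole _ _ c u.
  move=> i j _ _; have := (next _ _ (uP i)).1; have := (next _ _ (uP j)).1.
  case: (u i) (u j) => [s a] [s' a']; rewrite /pos_end /hgt /= => pa' pa.
  rewrite /c /= => -[es]; subst s'; have w := width_ge s.1.
  move=> /(congr1 (@nat_of_ord _)); rewrite !inordK; [|lia|lia] => e.
  by congr (_, _); lia.
have reach n : (i < n)%N -> exists2 m, (0 < m)%N &
    iter m (step sigma h) (fwd (u i).1 (u i).2) = fwd (u n).1 (u n).2.
  elim: n => // n IHn; rewrite ltnS leq_eqVlt => /orP[/eqP<-|/IHn[m m0 e]].
    by have [_ ?] := fP _ (uP i).
  have [_ [m' m'0 e']] := fP _ (uP n).
  by exists (m' + m)%N; rewrite ?addn_gt0 ?m'0 // iterD e.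
have [m m0 e] := reach j ltij; apply: (acyc (fwd (u i).1 (u i).2)).
split; last by exists m; rewrite // e -eu.
by have [/andP[_]] := next _ _ (uP i); rewrite /= subr_lt0.
Qed.
End Matching.

(** * Rigidity of the generic presentation *)

Section ElementaryMatrix.
Variables (R : pzRingType) (T : finType).

Definition emx (j i : T) (x : R) : 'M[R]_#|T| :=
  \matrix_(a, b) (x *+ ((a == enum_rank j) && (b == enum_rank i))).

Lemma emxD j i : {morph emx j i : x y / x + y}.
Proof. by move=> x y; apply/matrixP => a b; rewrite !mxE mulrnDl. Qed.

Lemma emx0 j i : emx j i 0 = 0.
Proof. by apply/matrixP => a b; rewrite !mxE mul0rn. Qed.

Lemma emx_sum j i (A : finType) (P : pred A) (F : A -> R) :
  emx j i (\sum_(a | P a) F a) = \sum_(a | P a) emx j i (F a).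
Proof. exact: (big_morph _ (emxD j i) (emx0 j i)). Qed.

Lemma mul_emx j i k l (x y : R) :
  emx j i x *m emx k l y = emx j l (x * y) *+ (i == k).
Proof.
apply/matrixP => a b; rewrite mulmxnE !mxE (bigD1 (enum_rank i)) //= big1 => [|c ne].
  rewrite !mxE eqxx andbT addr0 (can_eq enum_rankK).
  by case: (a == _); case: (i == k); case: (b == _); rewrite /= ?mulr1n ?mulr0n ?mulr0 ?mul0r ?mul0rn.
by rewrite !mxE (negbTE ne) andbF mulr0n mul0r.
Qed.

Lemma emx_decomp (M : 'M[R]_#|T|) :
  M = \sum_(j : T) \sum_(i : T) emx j i (M (enum_rank j) (enum_rank i)).
Proof.
apply/matrixP => a b; rewrite summxE (bigD1 (enum_val a)) //= summxE.
rewrite (bigD1 (enum_val b)) //= !mxE !enum_valK !eqxx mulr1n.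
rewrite big1 ?addr0 => [|i ne].
  rewrite big1 ?addr0 // => j ne; rewrite summxE big1 // => i _.
  by rewrite !mxE -(can_eq enum_valK) enum_rankK eq_sym (negbTE ne).
by rewrite !mxE -[b == _](can_eq enum_valK) enum_rankK [_ == i]eq_sym (negbTE ne) andbF.
Qed.
End ElementaryMatrix.

Arguments sh : simpl never.

(** * Homotopies along parallel leaves *)

Section Rigid.
Variables (R : pzRingType) (V : finType) (sigma : {perm V * bool}) (h : V -> int).
Local Notation S := (V * bool)%type.
Local Notation sh := (sh sigma).
Local Notation phi := (phi sigma h).
Local Notation matched := (matched sigma h).
Local Notation pos_end := (pos_end h).
Local Notation neg_end := (neg_end h).
Local Notation cross := (cross h).
Local Notation strand := (strand h).
Local Notation pt := (pt h).
Implicit Types (s t : S) (a b : int) (k : nat).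

(** Interface to the algebra: [al s] stands for the arrow leaving by the side [s], or 0, and
    [Pst s t x] says that [x] is a possibly infinite combination of non-trivial strings from [s] to
    [t]. *)
Variables (e : V -> R) (al : S -> R) (Pst : S -> S -> R -> Prop).

Definition central (c : R) := forall z, c * z = z * c.

Hypothesis e_idem : forall v, e v * e v = e v.
Hypothesis al_e : forall s, e (sigma s).1 * al s * e s.1 = al s.
Hypothesis al_flip : forall s, al (flip (sigma s)) * al s = 0.
Hypothesis Pst_e : forall s t x, Pst s t x -> e t.1 * x * e s.1 = x.
Hypothesis Pst_left : forall s t x, Pst s t x -> exists c y,
  [/\ central c, Pst (sigma s) t y &
      x = (c * e (sigma s).1 *+ (sigma s == t) + y) * al s].
Hypothesis Pst_right : forall s t x, Pst s t x -> exists c y,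
  [/\ central c, Pst s ((sigma^-1)%g t) y &
      x = al ((sigma^-1)%g t) * (c * e s.1 *+ (s == (sigma^-1)%g t) + y)].
Hypothesis Pst_orbit : forall s t x, Pst s t x -> x = 0 \/ exists k, t = sh k.+1 s.
Hypothesis Pst_decomp : forall v w x, v != w -> e w * x * e v = x ->
  exists2 x' : S -> S -> R, (forall s t, s.1 = v -> t.1 = w -> Pst s t (x' s t)) &
    x = \sum_(s | s.1 == v) \sum_(t | t.1 == w) x' s t.

Fixpoint pp s k : R := if k is k'.+1 then al (sh k' s) * pp s k' else e s.1.

Lemma e_al s : e (sigma s).1 * al s = al s.
Proof. by rewrite -(al_e s) !mulrA e_idem. Qed.

Lemma al_er s : al s * e s.1 = al s.
Proof. by rewrite -(al_e s) -!mulrA e_idem. Qed.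

Lemma pp_er s k : pp s k * e s.1 = pp s k.
Proof. by elim: k => [|k IHk] /=; rewrite ?e_idem // -mulrA IHk. Qed.

Lemma e_pp s k : e (sh k s).1 * pp s k = pp s k.
Proof. by case: k => [|k] /=; rewrite ?e_idem // mulrA; congr (_ * _); apply: e_al. Qed.

Lemma pp_add s i j : pp (sh i s) j * pp s i = pp s (i + j).
Proof.
elim: j => [|j IHj] /=; first by rewrite addn0 e_pp.
by rewrite -mulrA IHj addnS /= -shD addnC.
Qed.

Lemma ppS s k : pp s k.+1 = pp (sigma s) k * al s.
Proof. by rewrite -[k.+1]add1n -pp_add /= al_er. Qed.

Lemma flip_pp0 s t k y : sh k.+1 s = flip t -> y * al t * pp s k.+1 = 0.
Proof.
by move=> st; rewrite /= -!mulrA (mulrA (al t)) -[t]flipK -st al_flip mul0r mulr0.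
Qed.

Lemma pp_flip0 s k y : pp (flip s) k.+1 * (al ((sigma^-1)%g s) * y) = 0.
Proof.
have := al_flip ((sigma^-1)%g s); rewrite permKV => al0.
by rewrite ppS -!mulrA (mulrA (al _)) al0 mul0r mulr0.
Qed.

(** Only [n] arrows are peeled off, so the infinite tail stays in the single remainder [y * pp s n].
    Central coefficients can be moved past paths. *)
Lemma Pst_left_iter s t x n : Pst s t x -> exists c y,
  [/\ forall k, central (c k), Pst (sh n s) t y &
      x = \sum_(k < n) c k * pp s k.+1 *+ (sh k.+1 s == t) + y * pp s n].
Proof.
elim: n => [|n IHn] Px.
  exists (fun=> 0), x; split=> //; first by move=> k z; rewrite mul0r mulr0.
  by rewrite big_ord0 add0r /= -(Pst_e Px) -!mulrA e_idem.
have [c [y [cc Py xE]]] := IHn Px; have [d [z [dc Pz yE]]] := Pst_left Py.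
exists (fun k => if (k < n)%N then c k else d), z; split=> //.
  by move=> k; case: ifP.
rewrite big_ord_recr /= ltnn xE yE -addrA; congr (_ + _).
  by apply: eq_bigr => k _; rewrite ltn_ord.
rewrite -[sh n.+1 s]/(sigma (sh n s)) !mulrDl; congr (_ + _); last by rewrite mulrA.
by rewrite !mulrnAl -!mulrA (mulrA (e _)) e_al.
Qed.

Lemma Pst_right_iter s t x n : Pst s t x -> exists c y,
  [/\ forall k, central (c k), exists2 t', sh n t' = t & Pst s t' y /\
      x = \sum_(k < n) c k * pp s k.+1 *+ (sh k.+1 s == t) + pp t' n * y &
      True].
Proof.
elim: n => [|n IHn] Px.
  exists (fun=> 0), x; split=> //; first by move=> k z; rewrite mul0r mulr0.
  by exists t => //; split=> //; rewrite big_ord0 add0r /= -(Pst_e Px) !mulrA e_idem.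
have [c [y [cc [t' tE [Py xE]] _]]] := IHn Px.
have [d [z [dc Pz yE]]] := Pst_right Py.
exists (fun k => if (k < n)%N then c k else d), z; split=> //.
  by move=> k; case: ifP.
exists ((sigma^-1)%g t'); first by rewrite -addn1 shD /= /sh /= permKV.
split=> //; rewrite big_ord_recr /= ltnn xE yE -addrA; congr (_ + _).
  by apply: eq_bigr => k _; rewrite ltn_ord.
set u := (sigma^-1)%g t'; have ut : t' = sigma u by rewrite permKV.
rewrite mulrDr mulrDr ut !mulrA -ppS -/(pp u n.+1); congr (_ + _).
have -> : (sh n.+1 s == t) = (s == u).
  by rewrite -tE ut -[sigma u]/(sh 1 u) -shD addn1 (inj_eq (@sh_inj _ sigma n.+1)).
case: eqP => [->|_]; rewrite ?mulr0n ?mulr0 // !mulr1n.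
transitivity (d * pp u n.+1); last by rewrite /= mulrA.
by rewrite mulrA -dc -mulrA pp_er.
Qed.

Definition link := (S * 'I_(width h).+1 * 'I_(turn sigma))%type.
Definition lsrc (z : link) : S * int := (z.1.1, z.1.2%:Z).
Definition is_link (z : link) : bool :=
  pos_end (lsrc z).1 (lsrc z).2 && matched (lsrc z).1 (lsrc z).2 z.2.
Definition ltgt (z : link) : S * int :=
  (sh z.2 (lsrc z).1, phi (lsrc z).1 (lsrc z).2 z.2).
Definition lpath (z : link) : R := pp (lsrc z).1 z.2.

(* The generic presentation of weight h: the strands of P^-1 and P^0 are joined
   by the paths along which the leaves turn around. *)
Definition pres : 'M[R]_#|{: strand}| :=
  \sum_(z | is_link z) emx (pt (ltgt z).1 (ltgt z).2) (pt (lsrc z).1 (lsrc z).2) (lpath z).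

Lemma ltgt_inj z z' : is_link z -> is_link z' -> ltgt z = ltgt z' -> z = z'.
Proof.
move=> /andP[p m] /andP[p' m'] [e1 e2].
have [es ea ek] := matched_back p p' m m' e1 e2.
case: z z' es ea ek {p m p' m' e1 e2} => [[s a] k] [[s' a'] k'] /= -> [/val_inj->] /val_inj->.
by [].
Qed.

Lemma lsrc_inj z z' : is_link z -> is_link z' -> lsrc z = lsrc z' -> z = z'.
Proof.
move=> /andP[p m] /andP[p' m'] ee; move: m'; rewrite -ee => m'.
have ek := matched_uniq m m'; case: ee => es ea.
case: z z' es ea ek {p m p' m'} => [[s a] k] [[s' a'] k'] /= -> /val_inj-> /val_inj->.
by [].
Qed.

Lemma is_link_ex s a k : pos_end s a -> matched s a k ->
  exists z, [/\ is_link z, lsrc z = (s, a), z.2 = k :> nat & lpath z = pp s k].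
Proof.
move=> ps mk; have a0 : 0 <= a by case/andP: ps.
have la : (`|a| < (width h).+1)%N.
  by have := width_ge h s.1; move: ps; rewrite /pos_end /hgt; lia.
have lk := matched_turn a0 mk.
exists (s, Ordinal la, Ordinal lk); rewrite /is_link /lpath /lsrc /= gez0_abs //.
by rewrite ps mk.
Qed.

Lemma sum_link_one (M : nmodType) (F : link -> M) (proj : link -> S * int) z :
  (forall z z', is_link z -> is_link z' -> proj z = proj z' -> z = z') ->
  is_link z -> \sum_(z' | is_link z' && (proj z' == proj z)) F z' = F z.
Proof.
move=> inj lz; rewrite (bigD1 z) ?lz ?eqxx //= big1 ?addr0 // => z'.
by move=> /andP[/andP[lz' /eqP/inj-> //]]; rewrite eqxx.
Qed.

Lemma sum_link_two (M : nmodType) (F : link -> M) (proj : link -> S * int) (i : strand) s a :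
  (forall z, is_link z -> (pt (proj z).1 (proj z).2 == i) =
     (proj z == (s, a)) || (proj z == (flip s, cross s a))) ->
  \sum_(z | is_link z) F z *+ (pt (proj z).1 (proj z).2 == i) =
  \sum_(z | is_link z && (proj z == (s, a))) F z +
  \sum_(z | is_link z && (proj z == (flip s, cross s a))) F z.
Proof.
move=> iE; rewrite (eq_bigr _ (fun z _ => mulrb _ _)) -big_mkcondr /= (bigID (fun z => proj z == (s, a))) /=.
have sf : s == flip s = false by case: (s) => v []; rewrite /flip xpair_eqE /= eqxx.
congr (_ + _); apply: eq_bigl => z; case lz: (is_link z) => //=; rewrite iE //.
  by case: (proj z == (s, a)); rewrite ?andbF ?andbT.
by case: (proj z) => t b; rewrite !xpair_eqE; case: (t =P s) => [->|_]; rewrite ?sf /= ?andbF ?andbT //; case: (b == a).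
Qed.

Lemma pt_end_eq (proj : link -> S * int) z s a :
  pos_end s a && pos_end (proj z).1 (proj z).2 ||
    neg_end s a && neg_end (proj z).1 (proj z).2 ->
  (pt (proj z).1 (proj z).2 == pt s a) =
    (proj z == (s, a)) || (proj z == (flip s, cross s a)).
Proof.
move=> val; apply/eqP/orP => [/esym/(pt_inj val)|].
  by case: (proj z) => s' a' /= [[-> ->]|[-> ->]]; rewrite !eqxx; [left|right].
by case=> /eqP -> //=; rewrite pt_flip //; case/orP: val => /andP[->]; rewrite ?orbT.
Qed.

Lemma is_link_ends z : is_link z ->
  pos_end (lsrc z).1 (lsrc z).2 /\ neg_end (ltgt z).1 (ltgt z).2.
Proof. by case/andP=> ps /matched_end. Qed.

(** The strand at the end of a leaf has only one other end, so at most one further leaf contributes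
    to the product; it arrives by the opposite side. *)
Lemma emx_pres j s a k y : pos_end s a -> matched s a k ->
  let t := sh k s in let b := phi s a k in
  emx j (pt t b) y *m pres = emx j (pt s a) (y * pp s k) \/
  exists s' a' k', [/\ pos_end s' a', matched s' a' k',
    sh k' s' = flip t, phi s' a' k' = cross t b &
    emx j (pt t b) y *m pres =
      emx j (pt s a) (y * pp s k) + emx j (pt s' a') (y * pp s' k')].
Proof.
move=> ps mk t b; have [z [lz sz kz pz]] := is_link_ex ps mk.
have tz : ltgt z = (t, b) by rewrite /ltgt sz kz.
pose F z := emx j (pt (lsrc z).1 (lsrc z).2) (y * lpath z).
have -> : emx j (pt t b) y *m pres = emx j (pt s a) (y * pp s k) +
    \sum_(z | is_link z && (ltgt z == (flip t, cross t b))) F z.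
  have <- : \sum_(z | is_link z && (ltgt z == (t, b))) F z = emx j (pt s a) (y * pp s k).
    by rewrite -tz (sum_link_one _ ltgt_inj lz) /F sz pz.
  rewrite -(@sum_link_two _ F ltgt (pt t b)) => [|w lw].
    by rewrite mulmx_sumr; apply: eq_bigr => w _; rewrite mul_emx eq_sym.
  by apply: pt_end_eq; rewrite (matched_end mk) (is_link_ends lw).2 orbT.
have [|no] := pselect (exists z', is_link z' /\ ltgt z' = (flip t, cross t b)).
  move=> [w [lw tw]]; right; have [pw mw] := andP lw.
  have [w1 w2] : ltgt w = (flip t, cross t b) := tw.
  exists (lsrc w).1, (lsrc w).2, w.2; split=> //.
  by rewrite -tw (sum_link_one _ ltgt_inj lw).
left; rewrite [X in _ + X]big1 ?addr0 // => w /andP[lw /eqP tw].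
by case: no; exists w.
Qed.

Lemma pres_emx i s a k y : pos_end s a -> matched s a k ->
  pres *m emx (pt s a) i y = emx (pt (sh k s) (phi s a k)) i (pp s k * y) \/
  exists k', matched (flip s) (cross s a) k' /\
    pres *m emx (pt s a) i y =
      emx (pt (sh k s) (phi s a k)) i (pp s k * y) +
      emx (pt (sh k' (flip s)) (phi (flip s) (cross s a) k')) i (pp (flip s) k' * y).
Proof.
move=> ps mk; have [z [lz sz kz pz]] := is_link_ex ps mk.
pose F z := emx (pt (ltgt z).1 (ltgt z).2) i (lpath z * y).
have -> : pres *m emx (pt s a) i y = emx (pt (sh k s) (phi s a k)) i (pp s k * y) +
    \sum_(z | is_link z && (lsrc z == (flip s, cross s a))) F z.
  have <- : \sum_(z | is_link z && (lsrc z == (s, a))) F z =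
      emx (pt (sh k s) (phi s a k)) i (pp s k * y).
    by rewrite -sz (sum_link_one _ lsrc_inj lz) /F /ltgt sz kz pz.
  rewrite -(@sum_link_two _ F lsrc (pt s a)) => [|w lw].
    by rewrite mulmx_suml; apply: eq_bigr => w _; rewrite mul_emx.
  by apply: pt_end_eq; rewrite ps (is_link_ends lw).1.
have [|no] := pselect (exists z', is_link z' /\ lsrc z' = (flip s, cross s a)).
  move=> [w [lw sw]]; right; have [pw mw] := andP lw.
  exists w.2; split; first by move: mw; rewrite sw.
  by rewrite -sw (sum_link_one _ lsrc_inj lw) /F /ltgt /lpath sw.
left; rewrite [X in _ + X]big1 ?addr0 // => w /andP[lw /eqP tw].
by case: no; exists w.
Qed.

Definition null (f : 'M[R]_#|{: strand}|) : Prop :=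
  exists u v, f = pres *m u + v *m pres.

Lemma null0 : null 0.
Proof. by exists 0, 0; rewrite mulmx0 mul0mx addr0. Qed.

Lemma nullD f g : null f -> null g -> null (f + g).
Proof.
move=> [u [v ->]] [u' [v' ->]]; exists (u + u'), (v + v').
by rewrite mulmxDr mulmxDl addrACA.
Qed.

Lemma nullN f : null f -> null (- f).
Proof.
by move=> [u [v ->]]; exists (- u), (- v); rewrite mulmxN mulNmx opprD.
Qed.

Lemma null_sum (A : finType) (P : pred A) (F : A -> 'M[R]_#|{: strand}|) :
  (forall x, P x -> null (F x)) -> null (\sum_(x | P x) F x).
Proof. by move=> nF; apply: big_ind => //; [apply: null0 | apply: nullD]. Qed.

Lemma null_mull u : null (pres *m u).
Proof. by exists u, 0; rewrite mul0mx addr0. Qed.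

Lemma null_mulr v : null (v *m pres).
Proof. by exists 0, v; rewrite mulmx0 add0r. Qed.

Lemma matched_gt0 s a k : matched s a k -> (0 < k)%N.
Proof. by case/and3P. Qed.

(* A path running strictly beyond the end of the leaf of s factors through it. *)
Lemma null_prefix s a k j y : pos_end s a -> matched s a k ->
  null (emx j (pt s a) (y * al (sh k s) * pp s k)).
Proof.
move=> ps mk; have [<-|[s' [a' [k' [_ mk' es _]]]]] :=
  emx_pres j (y * al (sh k s)) ps mk; first exact: null_mulr.
have := matched_gt0 mk'; case: k' es {mk'} => // k' es _.
by rewrite (flip_pp0 _ es) emx0 addr0 => <-; apply: null_mulr.
Qed.

(** Mirror image of [null_prefix]: the other leaf of the strand leaves by the side opposite to [s],
    and its path is killed by an arrow entering at [s]. *)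
Lemma null_suffix s a k i y : pos_end s a -> matched s a k ->
  null (emx (pt (sh k s) (phi s a k)) i (pp s k * (al ((sigma^-1)%g s) * y))).
Proof.
move=> ps mk; have [<-|[k' [mk']]] :=
  pres_emx i (al ((sigma^-1)%g s) * y) ps mk; first exact: null_mull.
have := matched_gt0 mk'; case: k' {mk'} => // k' _.
by rewrite pp_flip0 emx0 addr0 => <-; apply: null_mull.
Qed.

(* The pair of the leaf of (s, a) with a leaf running parallel to it, below. *)
Definition obstruction s a := exists b k c,
  [/\ pos_end s a, (0 < k)%N, neg_end (sh k s) b, b <= phi s a k & central c /\
    ~ null (emx (pt (sh k s) b) (pt s a) (c * pp s k))].

(** Trace back the leaf that ends at [b]. If it is shorter than the path, [null_suffix] applies.
    Otherwise it runs parallel and above, and a homotopy replaces the monomial by one along the leaf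
    leaving on the other side of its strand; crossing reverses the order of the levels, so that leaf
    is again the lower one. *)
Lemma obstruction_bwd s a b k c : pos_end s a -> (0 < k)%N ->
  neg_end (sh k s) b -> phi s a k <= b -> central c ->
  ~ null (emx (pt (sh k s) b) (pt s a) (c * pp s k)) ->
  exists2 a', obstruction (flip s) (cross s a) & matched s a' k.
Proof.
move=> ps k0 nt le cc nn; have a0 : 0 <= a by case/andP: ps.
have [s' [a' [k' [/andP[k'0 lek'] ps' mk' sE bE]]]] := matched_bwd a0 k0 nt le.
have tE : sh k' s' = sh k s by rewrite sE -shD subnKC.
move: lek'; rewrite leq_eqVlt => /orP[/eqP ek|ltk]; last first.
  case: nn; rewrite -tE -bE -(subnK (ltnW ltk)) -pp_add -sE.
  have -> : c * (pp s' k' * pp s (k - k')) =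
      pp s' k' * (al ((sigma^-1)%g s') * (c * pp s (k - k').-1)).
    rewrite mulrA cc -mulrA; congr (_ * _).
    have e1 : sigma (sh (k - k').-1 s) = s'.
      by rewrite sE -[sigma _]/(sh 1 _) -shD add1n prednK ?subn_gt0.
    rewrite -e1 permK mulrA -cc -mulrA; congr (_ * _).
    by rewrite -{1}(prednK (_ : 0 < k - k')%N) ?subn_gt0.
  exact: null_suffix.
rewrite ek subnn -[sh 0 s]/s in sE; subst s' k'; exists a' => //.
have [nE|[k3 [mk3 nE]]] := pres_emx (pt s a) (c * e s.1) ps' mk'.
  case: nn; rewrite -bE cc -(pp_er s k) -mulrA -cc -nE; exact: null_mull.
have ps3 := cross_pos ps'.
exists (phi (flip s) (cross s a') k3), k3, c; split.
- exact: cross_pos.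
- exact: matched_gt0 mk3.
- exact: matched_end mk3.
- have e2 : a <= a' by move: le; rewrite -bE /phi lerD2r.
  by rewrite /phi lerD2r /cross lerD2l lerN2.
split=> // n3; case: nn.
have -> : emx (pt (sh k s) b) (pt s a) (c * pp s k) =
    emx (pt (sh k s) (phi s a' k)) (pt s a) (pp s k * (c * e s.1)).
  by rewrite bE mulrA -cc -mulrA pp_er.
rewrite (canRL (addrK _) (esym nE)); apply: nullD; first exact: null_mull.
apply: nullN; move: n3; rewrite pt_flip ?ps // cc.
by rewrite -{1}(pp_er (flip s) k3) -mulrA -cc.
Qed.

(** The leaf of [(s, a)] must end where the path does, or [null_prefix] would apply. One homotopy
    passes to the leaf reaching the same strand from the other side, and [obstruction_bwd] crosses
    at its start; together they follow the leaf of [(s, a)] for [k + k'] steps. *)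
Lemma obstruction_next s a : obstruction s a -> pos_end s a /\
  exists s' a' m, [/\ obstruction s' a', (0 < m)%N &
    iter m (step sigma h) (fwd sigma h s a) = fwd sigma h s' a'].
Proof.
move=> [b [k [c [ps k0 nt le [cc nn]]]]]; split=> //.
have [k1 lek1 mk1] := matched_fwd ps k0 nt le.
move: lek1; rewrite leq_eqVlt => /orP[/eqP ek|ltk]; last first.
  case: nn; rewrite -(subnKC (ltnW ltk)) -pp_add.
  rewrite -(prednK (_ : 0 < k - k1)%N) ?subn_gt0 // ppS !mulrA.
  exact: null_prefix.
subst k1; set t := sh k s in nt nn *.
have eb : c * pp s k = c * e t.1 * pp s k by rewrite -mulrA e_pp.
have [nE|[s' [a' [k' [ps' mk' es' ea' nE]]]]] := emx_pres (pt t b) (c * e t.1) ps mk1.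
  by case: nn; rewrite eb -nE; apply: null_mulr.
have ks' : (0 < k')%N by exact: matched_gt0 mk'.
have nt' : neg_end (sh k' s') (cross t b) by rewrite es'; apply: cross_neg.
have le' : phi s' a' k' <= cross t b by rewrite ea' /cross lerD2l lerN2.
have nn' : ~ null (emx (pt (sh k' s') (cross t b)) (pt s' a') (c * pp s' k')).
  rewrite es' pt_flip ?nt ?orbT // => n1; case: nn; rewrite eb.
  rewrite (canRL (addrK _) (esym nE)); apply: nullD; first exact: null_mulr.
  apply: nullN; rewrite -mulrA -[t.1]/((flip t).1) -es' e_pp; exact: n1.
have [a2 obs _] := obstruction_bwd ps' ks' nt' le' cc nn'.
exists (flip s'), (cross s' a'), (k' + k)%N; split; rewrite ?addn_gt0 ?ks' //.
rewrite iterD (step_fwd mk1) -/t -es' -[X in iter k' _ (_, _, X)]ea'.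
exact: step_bwd.
Qed.

Hypothesis acyclic : acyclic_leaves sigma h.

Lemma null_monomial s a b k c : pos_end s a -> neg_end (sh k.+1 s) b -> central c ->
  null (emx (pt (sh k.+1 s) b) (pt s a) (c * pp s k.+1)).
Proof.
move=> ps nt cc; apply: contrapT => nn.
have no := acyclic_ends acyclic obstruction_next.
have [le|/ltW le] := lerP b (phi s a k.+1).
  by apply: (no s a); exists b, k.+1, c.
by have [a' obs _] := obstruction_bwd ps (ltn0Sn k) nt le cc nn; apply: no obs.
Qed.

(** If the leaf of [(s, a)] has an end, the first [k] arrows are peeled off and the tail runs past
    that end. Otherwise [b] is above the leaf, the leaf ending at [b] is traced back, and the last
    [k'] arrows are peeled off instead. What is peeled off consists of monomials. *)
Lemma null_Pst s a t b x : pos_end s a -> neg_end t b -> Pst s t x ->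
  null (emx (pt t b) (pt s a) x).
Proof.
move=> ps nt Px.
have mono n (c : nat -> R) : (forall k, central (c k)) -> null (emx (pt t b) (pt s a)
    (\sum_(k < n) c k * pp s k.+1 *+ (sh k.+1 s == t))).
  move=> cc; rewrite emx_sum; apply: null_sum => k _.
  case: eqP => [et|_]; last by rewrite mulr0n emx0; apply: null0.
  by rewrite mulr1n -et; apply: null_monomial; rewrite ?et.
have [[k mk]|no] := pselect (exists k, matched s a k).
  have [c [y [cc Py ->]]] := Pst_left_iter k Px.
  rewrite emxD; apply: nullD; first exact: mono.
  have [d [z [_ _ ->]]] := Pst_left Py; exact: null_prefix.
have [->|[k et]] := Pst_orbit Px; first by rewrite emx0; apply: null0.
have a0 : 0 <= a by case/andP: ps.
have [le|/ltW le] := lerP b (phi s a k.+1).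
  by rewrite et in nt; have [k' _ mk] := matched_fwd ps (ltn0Sn k) nt le; case: no; exists k'.
rewrite {}et in nt Px mono *.
have [s' [a' [k' [/andP[k'0 lek'] ps' mk' sE bE]]]] := matched_bwd a0 (ltn0Sn k) nt le.
have [c [y [cc [t' tE [Py ->]] _]]] := Pst_right_iter k' Px.
have ts : t' = s' by apply: (@sh_inj _ sigma k'); rewrite tE sE -shD subnKC.
rewrite emxD; apply: nullD; first exact: mono.
subst t'; have [d [z [_ _ ->]]] := Pst_right Py.
by rewrite -tE -bE; apply: null_suffix.
Qed.

Definition plus_vertex (i : strand) : option V := if plus_strand i then Some i.1 else None.
Definition minus_vertex (i : strand) : option V := if minus_strand i then Some i.1 else None.

Definition eo (o : option V) : R := if o is Some v then e v else 0.

Theorem pres_rigid (f : 'M[R]_#|{: strand}|) :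
  (forall j i, eo (minus_vertex (enum_val j)) * f j i * eo (plus_vertex (enum_val i)) = f j i) ->
  null f.
Proof.
move=> fE; rewrite (emx_decomp f).
apply: null_sum => j _; apply: null_sum => i _; have := fE (enum_rank j) (enum_rank i).
rewrite !enum_rankK /minus_vertex /plus_vertex; set x := f _ _.
case: ifP => mj; last by rewrite /= !mul0r => <-; rewrite emx0; apply: null0.
case: ifP => pi; last by rewrite /= mulr0 => <-; rewrite emx0; apply: null0.
(* No vertex carries strands of both signs, so the entry joins different vertices and contains no
   trivial path. *)
move=> /= xE; have ne : i.1 != j.1.
  by apply/eqP => e1; move: pi mj; apply: strand_signs.
have [x' Px ->] := Pst_decomp ne xE.
rewrite emx_sum; apply: null_sum => s /eqP es; rewrite emx_sum; apply: null_sum => t /eqP et.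
have [a ps <-] := plus_strand_end pi es; have [b nt <-] := minus_strand_end mj et.
exact: null_Pst (Px _ _ es et).
Qed.

Lemma pres_support j i :
  eo (minus_vertex (enum_val j)) * pres j i * eo (plus_vertex (enum_val i)) = pres j i.
Proof.
rewrite /pres summxE mulr_sumr mulr_suml; apply: eq_bigr => z lz.
rewrite !mxE -!(can2_eq enum_valK enum_rankK).
have [ps nt] := is_link_ends lz.
case: eqP => [->|_]; last by rewrite mulr0n mulr0 mul0r.
case: eqP => [->|_]; last by rewrite mulr0n mulr0 mul0r.
rewrite /= mulr1n /minus_vertex /plus_vertex (minus_pt nt) (plus_pt ps) /=.
by rewrite /lpath e_pp pp_er.
Qed.
End Rigid.

(** * Complexes of projective modules *)

Section FixedModule.
Variables (R : pzRingType) (r : nat) (E : 'M[R]_r).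

Definition fixed_rows : {pred 'rV[R]_r} := fun x => x *m E == x.

Lemma fixed_rows_submod : submod_closed fixed_rows.
Proof.
split=> [|a x y]; rewrite !unfold_in; first by rewrite mul0mx.
by move=> /eqP ex /eqP ey; rewrite mulmxDl -scalemxAl ex ey.
Qed.

HB.instance Definition _ :=
  GRing.isSubmodClosed.Build R 'rV[R]_r fixed_rows fixed_rows_submod.

Record fmod := Fmod { fmod_val : 'rV[R]_r; _ : fmod_val \in fixed_rows }.
HB.instance Definition _ := [isSub for fmod_val].
HB.instance Definition _ := [Choice of fmod by <:].
HB.instance Definition _ := [SubChoice_isSubLmodule of fmod by <:].

Lemma fmodP (x : fmod) : val x *m E = val x.
Proof. by have /eqP := valP x. Qed.

Hypothesis EE : E *m E = E.

Lemma fmod_subproof (x : 'rV[R]_r) : x *m E \in fixed_rows.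
Proof. by rewrite unfold_in -mulmxA EE. Qed.

Definition tofmod (x : 'rV[R]_r) : fmod := Fmod (fmod_subproof x).

Lemma val_tofmod x : val (tofmod x) = x *m E. Proof. by []. Qed.

End FixedModule.

(* Idempotent matrices stand for finitely generated projective modules, and
   R = A^c turns right A-modules into row spaces on which matrices act. *)
Section MatrixMaps.
Variable R : pzRingType.
Implicit Types r s : nat.

Record idmx r := Idmx { idmx_val :> 'M[R]_r; idmxK : idmx_val *m idmx_val = idmx_val }.

Lemma corner_l r s (E : idmx r) (F : idmx s) M : E *m M *m F = M -> E *m M = M.
Proof. by move=> <-; rewrite !mulmxA idmxK. Qed.

Lemma corner_r r s (E : idmx r) (F : idmx s) M : E *m M *m F = M -> M *m F = M.
Proof. by move=> <-; rewrite -!mulmxA idmxK. Qed.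

Section Map.
Variables (r s : nat) (E : idmx r) (F : idmx s) (M : 'M[R]_(r, s)).

Definition fmap_fun (x : fmod E) : fmod F := tofmod (idmxK F) (val x *m M).

Lemma fmap_linear : linear fmap_fun.
Proof.
move=> a x y; apply: val_inj; rewrite /fmap_fun [RHS]linearP !val_tofmod [val _]linearP.
by rewrite mulmxDl -scalemxAl mulmxDl -scalemxAl.
Qed.

HB.instance Definition _ :=
  GRing.isLinear.Build R (fmod E) (fmod F) *:%R fmap_fun fmap_linear.

Definition fmap : {linear fmod E -> fmod F} := fmap_fun.

Lemma val_fmap x : E *m M *m F = M -> val (fmap x) = val x *m M.
Proof. by move=> e; rewrite /= -e -!mulmxA idmxK. Qed.
End Map.

Lemma fmap_full r s (E : idmx r) (F : idmx s) (f : {linear fmod E -> fmod F}) :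
  exists2 M, E *m M *m F = M & f =1 fmap E F M.
Proof.
pose N := \matrix_i val (f (tofmod (idmxK E) (delta_mx 0 i))).
have NF : N *m F = N by apply/row_matrixP => i; rewrite row_mul rowK fmodP.
exists (E *m N) => [|x]; first by rewrite mulmxA idmxK -mulmxA NF.
apply: val_inj; rewrite [RHS]/= !mulmxA fmodP -mulmxA NF mulmx_sum_row.
have xE : x = \sum_i val x 0 i *: tofmod (idmxK E) (delta_mx 0 i).
  apply: val_inj; rewrite linear_sum -[LHS]fmodP [in LHS](row_sum_delta (val x)).
  by rewrite mulmx_suml; apply: eq_bigr => i _; rewrite linearZ /= -scalemxAl.
by rewrite {1}xE !linear_sum; apply: eq_bigr => i _; rewrite !linearZ rowK.
Qed.

Lemma fmap_ext r s (E : idmx r) (M N : 'M[R]_(r, s)) :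
  (forall x : fmod E, val x *m M = val x *m N) -> E *m M = E *m N.
Proof.
move=> eMN; apply/row_matrixP => i; rewrite !row_mul.
have e : row i E = val (tofmod (idmxK E) (row i E)) by rewrite /= -row_mul idmxK.
by rewrite e; apply: eMN.
Qed.
End MatrixMaps.

(** * The homotopy category of complexes *)

Section Homotopy.
Variable A : pzRingType.
Implicit Types C D : complex A.
Local Notation rmod := (lmodType A^c).

Section Pairs.
Variables (M N K : rmod) (f : {linear K -> M}) (g : {linear K -> N}).

Definition mkpair_fun (x : K) : mod_sum M N := (f x, g x).
Lemma mkpair_linear : linear mkpair_fun.
Proof. by move=> a x y; rewrite /mkpair_fun !linearP. Qed.
HB.instance Definition _ :=
  GRing.isLinear.Build A^c K (mod_sum M N) *:%R mkpair_fun mkpair_linear.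
Definition mkpair : {linear K -> mod_sum M N} := mkpair_fun.

Definition proj1_fun (x : mod_sum M N) : M := x.1.
Lemma proj1_linear : linear proj1_fun. Proof. by []. Qed.
HB.instance Definition _ :=
  GRing.isLinear.Build A^c (mod_sum M N) M *:%R proj1_fun proj1_linear.
Definition proj1 : {linear mod_sum M N -> M} := proj1_fun.

Definition proj2_fun (x : mod_sum M N) : N := x.2.
Lemma proj2_linear : linear proj2_fun. Proof. by []. Qed.
HB.instance Definition _ :=
  GRing.isLinear.Build A^c (mod_sum M N) N *:%R proj2_fun proj2_linear.
Definition proj2 : {linear mod_sum M N -> N} := proj2_fun.
End Pairs.

Lemma mod_sum_eta (M N : rmod) (x : mod_sum M N) : x = (x.1, 0) + (0, x.2).
Proof. by case: x => x y; congr (_, _); rewrite /= ?addr0 ?add0r. Qed.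

(** Stated for maps that agree pointwise, because [cx_hom] also carries proofs; associativity and
    units of composition enter through it. *)
Lemma homotopic_refl C D (f g : cx_hom C D) :
  (forall i x, f i x = g i x) -> homotopic f g.
Proof.
move=> fg; exists (fun i j => \0) => i x.
by rewrite fg subrr /= linear0 addr0.
Qed.

Lemma homotopic_sym C D (f g : cx_hom C D) : homotopic f g -> homotopic g f.
Proof.
move=> [h hE]; exists (fun i j => \- (h i j)) => i x.
by rewrite -opprB hE opprD /= linearN.
Qed.

Lemma homotopic_trans C D (f g k : cx_hom C D) :
  homotopic f g -> homotopic g k -> homotopic f k.
Proof.
move=> [h hE] [h' hE']; exists (fun i j => h i j \+ h' i j) => i x.
by rewrite -[f i x](subrK (g i x)) -addrA hE hE' /= linearD addrACA.
Qed.

Lemma homotopic_compl C D E (u : cx_hom D E) (f g : cx_hom C D) :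
  homotopic f g -> homotopic (cx_comp u f) (cx_comp u g).
Proof.
move=> [h hE]; exists (fun i j => u j \o h i j) => i x.
by rewrite /= -linearB hE linearD /= cx_comm.
Qed.

Lemma homotopic_compr C D E (f g : cx_hom D E) (u : cx_hom C D) :
  homotopic f g -> homotopic (cx_comp f u) (cx_comp g u).
Proof.
move=> [h hE]; exists (fun i j => h i j \o u i) => i x.
by rewrite /= hE /= cx_comm.
Qed.

Lemma hiso_refl C : hiso C C.
Proof. by exists (cx_id C), (cx_id C); split; apply: homotopic_refl. Qed.

Lemma hiso_sym C D : hiso C D -> hiso D C.
Proof. by move=> [f [g [gf fg]]]; exists g, f. Qed.

Lemma hiso_trans C D E : hiso C D -> hiso D E -> hiso C E.
Proof.
move=> [f [g [gf fg]]] [f' [g' [gf' fg']]].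
exists (cx_comp f' f), (cx_comp g g'); split.
  apply: homotopic_trans gf.
  apply: (@homotopic_trans _ _ _ (cx_comp g (cx_comp (cx_comp g' f') f))).
    exact: homotopic_refl.
  apply: (@homotopic_trans _ _ _ (cx_comp g (cx_comp (cx_id D) f))).
    by apply/homotopic_compl/homotopic_compr.
  exact: homotopic_refl.
apply: homotopic_trans fg'.
apply: (@homotopic_trans _ _ _ (cx_comp f' (cx_comp (cx_comp f g) g'))).
  exact: homotopic_refl.
apply: (@homotopic_trans _ _ _ (cx_comp f' (cx_comp (cx_id D) g'))).
  by apply/homotopic_compl/homotopic_compr.
exact: homotopic_refl.
Qed.

Lemma hiso_zero C : homotopic (cx_id C) (cx_null C C) -> hiso C (cx_zero A).
Proof.
move=> h0; exists (cx_null C (cx_zero A)), (cx_null (cx_zero A) C); split.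
  by apply: homotopic_trans (homotopic_sym h0); apply: homotopic_refl.
by apply: homotopic_refl => i x; rewrite [RHS]thinmx0 [LHS]thinmx0.
Qed.

Lemma hiso_zero_id C : hiso C (cx_zero A) -> homotopic (cx_id C) (cx_null C C).
Proof.
move=> [f [g [gf _]]]; apply: homotopic_trans (homotopic_sym gf) _.
by apply: homotopic_refl => i x /=; rewrite [f i x]thinmx0 linear0.
Qed.

Section SumMaps.
Variables C D : complex A.

Definition cx_proj1 : cx_hom (cx_sum C D) C :=
  @CxHom A (cx_sum C D) C (fun i => proj1 (C i) (D i)) (fun i j x => erefl).
Definition cx_proj2 : cx_hom (cx_sum C D) D :=
  @CxHom A (cx_sum C D) D (fun i => proj2 (C i) (D i)) (fun i j x => erefl).

Section Pair.
Variables (K : complex A) (f : cx_hom K C) (g : cx_hom K D).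
Lemma cx_pair_comm i j x : diff (cx_sum C D) i j (mkpair (f i) (g i) x) =
  mkpair (f j) (g j) (diff K i j x).
Proof. by rewrite /= /sum_diff_fun /mkpair_fun /= !cx_comm. Qed.
Definition cx_pair : cx_hom K (cx_sum C D) :=
  @CxHom A K (cx_sum C D) (fun i => mkpair (f i) (g i)) cx_pair_comm.
End Pair.

Definition cx_inj1 := cx_pair (cx_id C) (cx_null C D).
Definition cx_inj2 := cx_pair (cx_null D C) (cx_id D).
End SumMaps.

Lemma homotopic_pair K C D (f f' : cx_hom K C) (g g' : cx_hom K D) :
  homotopic f f' -> homotopic g g' -> homotopic (cx_pair f g) (cx_pair f' g').
Proof.
move=> [h hE] [k kE]; exists (fun i j => mkpair (h i j) (k i j)) => i x.
by rewrite /= /mkpair_fun /sum_diff_fun /=; congr (_, _); rewrite ?hE ?kE.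
Qed.

Lemma hiso_sum C C' D D' : hiso C C' -> hiso D D' -> hiso (cx_sum C D) (cx_sum C' D').
Proof.
move=> [f [g [gf fg]]] [f' [g' [gf' fg']]].
exists (cx_pair (cx_comp f (cx_proj1 C D)) (cx_comp f' (cx_proj2 C D))).
exists (cx_pair (cx_comp g (cx_proj1 C' D')) (cx_comp g' (cx_proj2 C' D'))).
split.
  apply: (@homotopic_trans _ _ _ (cx_pair
     (cx_comp (cx_comp g f) (cx_proj1 C D)) (cx_comp (cx_comp g' f') (cx_proj2 C D)))).
    exact: homotopic_refl.
  apply: (@homotopic_trans _ _ _ (cx_pair
     (cx_comp (cx_id C) (cx_proj1 C D)) (cx_comp (cx_id D) (cx_proj2 C D)))).
    by apply: homotopic_pair; apply: homotopic_compr.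
  by apply: homotopic_refl => i [].
apply: (@homotopic_trans _ _ _ (cx_pair
  (cx_comp (cx_comp f g) (cx_proj1 C' D')) (cx_comp (cx_comp f' g') (cx_proj2 C' D')))).
  exact: homotopic_refl.
apply: (@homotopic_trans _ _ _ (cx_pair
   (cx_comp (cx_id C') (cx_proj1 C' D')) (cx_comp (cx_id D') (cx_proj2 C' D')))).
  by apply: homotopic_pair; apply: homotopic_compr.
by apply: homotopic_refl => i [].
Qed.

Lemma hiso_sum_swap B C D : hiso (cx_sum B (cx_sum C D)) (cx_sum C (cx_sum B D)).
Proof.
pose sw (B C D : complex A) : cx_hom (cx_sum B (cx_sum C D)) (cx_sum C (cx_sum B D)) :=
  cx_pair (cx_comp (cx_proj1 C D) (cx_proj2 B (cx_sum C D)))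
    (cx_pair (cx_proj1 B (cx_sum C D))
             (cx_comp (cx_proj2 C D) (cx_proj2 B (cx_sum C D)))).
exists (sw B C D), (sw C B D); split; apply: homotopic_refl => i [x [y z]] //.
Qed.

(** [e] is the projection to [X] carried over to [C]. If it is null, so is the identity of [X]; if
    it is homotopic to the identity, the projection to [Y] is null. *)
Lemma split_idempotent C X Y : hiso C (cx_sum X Y) -> exists e : cx_hom C C,
  [/\ homotopic (cx_comp e e) e,
      homotopic e (cx_null C C) -> hiso X (cx_zero A) &
      homotopic e (cx_id C) -> hiso Y (cx_zero A)].
Proof.
move=> [f [g [gf fg]]].
have part (Z : complex A) (p : cx_hom (cx_sum X Y) Z) (i : cx_hom Z (cx_sum X Y)) :
    (forall j x, cx_comp p i j x = x) -> let e := cx_comp (cx_comp g i) (cx_comp p f) in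
    homotopic (cx_comp e e) e /\ (homotopic e (cx_null C C) -> hiso Z (cx_zero A)).
  move=> pi e.
  have mid : homotopic (cx_comp (cx_comp p f) (cx_comp g i)) (cx_id Z).
    apply: (@homotopic_trans _ _ _ (cx_comp p (cx_comp (cx_comp f g) i))).
      exact: homotopic_refl.
    apply: (@homotopic_trans _ _ _ (cx_comp p (cx_comp (cx_id _) i))).
      by apply/homotopic_compl/homotopic_compr.
    by apply: homotopic_refl => j x; apply: pi.
  split=> [|e0].
    apply: (@homotopic_trans _ _ _
      (cx_comp (cx_comp g i) (cx_comp (cx_id Z) (cx_comp p f)))).
      apply: (@homotopic_trans _ _ _ (cx_comp (cx_comp g i)
        (cx_comp (cx_comp (cx_comp p f) (cx_comp g i)) (cx_comp p f)))).
        exact: homotopic_refl.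
      by apply/homotopic_compl/homotopic_compr.
    exact: homotopic_refl.
  apply: hiso_zero; pose m := cx_comp (cx_comp p f) (cx_comp g i).
  apply: (@homotopic_trans _ _ _ (cx_comp m m)).
    apply: homotopic_sym; apply: (@homotopic_trans _ _ _ (cx_comp m (cx_id Z))).
      exact: homotopic_compl.
    by apply: (@homotopic_trans _ _ _ m); first exact: homotopic_refl.
  apply: (@homotopic_trans _ _ _
    (cx_comp (cx_comp p f) (cx_comp e (cx_comp g i)))); first exact: homotopic_refl.
  apply: (@homotopic_trans _ _ _
    (cx_comp (cx_comp p f) (cx_comp (cx_null C C) (cx_comp g i)))).
    by apply/homotopic_compl/homotopic_compr.
  by apply: homotopic_refl => j x /=; rewrite !linear0.
have [idX X0] := part X (cx_proj1 X Y) (cx_inj1 X Y) (fun j x => erefl).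
have [_ Y0] := part Y (cx_proj2 X Y) (cx_inj2 X Y) (fun j x => erefl).
exists (cx_comp (cx_comp g (cx_inj1 X Y)) (cx_comp (cx_proj1 X Y) f)); split=> //.
move=> e1; apply: Y0; have [h hE] := gf; have [k kE] := e1.
exists (fun i j => h i j \- k i j) => i x.
rewrite [LHS](_ : _ = (g i (f i x) - x) - (g i (mkpair_fun (idfun) (\0) (f i x).1) - x)).
  have {}hE := hE i x; have {}kE := kE i x.
  rewrite [g i (f i x) - x]hE [g i (mkpair_fun _ _ _) - x]kE.
  by rewrite /= linearB opprD addrACA.
rewrite /= subr0 opprB addrA subrK -linearB; congr (g i _).
rewrite /mkpair_fun /=; case: (f i x) => u v.
by rewrite -[RHS]/(u - u, v - 0) subrr subr0.
Qed.
End Homotopy.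

(** * Two-term complexes given by matrices *)

Section TwoTermComplex.
Variable A : pzRingType.
Local Notation R := (A^c).

(** Both terms are summands of one free module, just as P^-1 and P^0 are cut out of the module on
    all strands; hence the square matrix. *)
Record mcx := Mcx {
  mdim : nat;
  mE1 : idmx R mdim;
  mE0 : idmx R mdim;
  mM : 'M[R]_mdim;
  mMP : mE1 *m mM *m mE0 = mM }.

Section Complex.
Variable X : mcx.

Definition mcx_obj (i : int) : lmodType A^c :=
  match i with
  | Posz 0 => fmod (mE0 X)
  | Negz 0 => fmod (mE1 X)
  | _ => mod_zero A
  end.

Definition mcx_diff (i j : int) : {linear mcx_obj i -> mcx_obj j} :=
  match i return {linear mcx_obj i -> mcx_obj j} with
  | Negz 0 =>
    match j return {linear fmod (mE1 X) -> mcx_obj j} with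
    | Posz 0 => fmap (mE1 X) (mE0 X) (mM X)
    | _ => \0
    end
  | _ => \0
  end.

Lemma mcx_diff_shape i j : j != i + 1 -> forall x, mcx_diff i j x = 0.
Proof. by case: i => [n|[|n]] //; case: j => [[|m]|m]. Qed.

Lemma mcx_diff_diff i j l x : mcx_diff j l (mcx_diff i j x) = 0.
Proof.
case: i x => [n|[|n]] x; rewrite ?linear0 //.
by case: j => [[|m]|m] //; rewrite linear0.
Qed.

Definition cx_of : complex A := Complex mcx_diff_shape mcx_diff_diff.

Lemma cx_of_zero i : i != 0 -> i != -1 -> is_zero_mod (cx_of i).
Proof.
by case: i => [[|n]|[|n]] // _ _ x; apply: thinmx0.
Qed.
End Complex.

Implicit Types X Y : mcx.

Lemma cx_of_hom X Y (f : cx_hom (cx_of X) (cx_of Y)) : exists F1 F0,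
  [/\ mE1 X *m F1 *m mE1 Y = F1, mE0 X *m F0 *m mE0 Y = F0,
      mM X *m F0 = F1 *m mM Y,
      f (-1) =1 fmap (mE1 X) (mE1 Y) F1 & f 0 =1 fmap (mE0 X) (mE0 Y) F0].
Proof.
have [F1 E1 f1] := fmap_full (f (Negz 0)).
have [F0 E0 f0] := fmap_full (f (Posz 0)).
exists F1, F0; split=> //.
rewrite -(corner_l (mMP X)) -[in RHS](corner_l E1) -!mulmxA; apply: fmap_ext => x.
have /(congr1 val) := @cx_comm _ _ _ f (Negz 0) (Posz 0) x.
rewrite f1 [f 0 _]f0 /= !mulmxA -[_ *m mM X *m mE0 X]mulmxA -[_ *m F1 *m mE1 Y]mulmxA.
rewrite (corner_r (mMP X)) (corner_r E1) -[_ *m mM Y *m mE0 Y]mulmxA (corner_r (mMP Y)).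
by rewrite -[_ *m F0 *m mE0 Y]mulmxA (corner_r E0).
Qed.

Definition cx_of_homotopy X Y (H : 'M[R]_(mdim X, mdim Y)) (i j : int) :
    {linear cx_of X i -> cx_of Y j} :=
  match i return {linear cx_of X i -> cx_of Y j} with
  | Posz 0 =>
    match j return {linear fmod (mE0 X) -> cx_of Y j} with
    | Negz 0 => fmap (mE0 X) (mE1 Y) H
    | _ => \0
    end
  | _ => \0
  end.

Lemma homotopic_cx_of X Y (f g : cx_hom (cx_of X) (cx_of Y)) F1 F0 G1 G0 H :
  f (-1) =1 fmap (mE1 X) (mE1 Y) F1 -> f 0 =1 fmap (mE0 X) (mE0 Y) F0 ->
  g (-1) =1 fmap (mE1 X) (mE1 Y) G1 -> g 0 =1 fmap (mE0 X) (mE0 Y) G0 ->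
  F1 - G1 = mM X *m H -> F0 - G0 = H *m mM Y ->
  mE0 X *m H *m mE1 Y = H -> homotopic f g.
Proof.
move=> f1 f0 g1 g0 e1 e0 eH; exists (cx_of_homotopy H).
case=> [[|n]|[|n]] x.
- rewrite f0 g0; apply: val_inj; rewrite linearB /=.
  rewrite -mulmxBl -mulmxBr e0 addr0 !mulmxA -[_ *m H *m mE1 Y]mulmxA.
  by rewrite (corner_r eH).
- by rewrite [LHS]thinmx0 [RHS]thinmx0.
- rewrite f1 g1; apply: val_inj; rewrite linearB /=.
  rewrite -mulmxBl -mulmxBr e1 add0r !mulmxA -[_ *m mM X *m mE0 X]mulmxA.
  by rewrite (corner_r (mMP X)).
- by rewrite [LHS]thinmx0 [RHS]thinmx0.
Qed.

Lemma homotopic_mx X Y (f g : cx_hom (cx_of X) (cx_of Y)) F1 F0 G1 G0 :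
  mE1 X *m F1 *m mE1 Y = F1 -> mE0 X *m F0 *m mE0 Y = F0 ->
  mE1 X *m G1 *m mE1 Y = G1 -> mE0 X *m G0 *m mE0 Y = G0 ->
  f (-1) =1 fmap (mE1 X) (mE1 Y) F1 -> f 0 =1 fmap (mE0 X) (mE0 Y) F0 ->
  g (-1) =1 fmap (mE1 X) (mE1 Y) G1 -> g 0 =1 fmap (mE0 X) (mE0 Y) G0 ->
  homotopic f g -> exists H,
    [/\ mE0 X *m H *m mE1 Y = H, F1 - G1 = mM X *m H & F0 - G0 = H *m mM Y].
Proof.
move=> eF1 eF0 eG1 eG0 f1 f0 g1 g0 [h hE].
have [H eH hH] := fmap_full (h (Posz 0) (Negz 0)); exists H; split=> //.
  rewrite -(corner_l eF1) -(corner_l eG1) -mulmxBr -(corner_l (mMP X)) -mulmxA.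
  apply: fmap_ext => x; have /(congr1 val) := hE (Negz 0) x.
  rewrite f1 g1 add0r -[h (Negz 0 + 1) (Negz 0) _]/(h (Posz 0) (Negz 0) _) hH linearB /=.
  rewrite -!mulmxA (corner_r eF1) (corner_r eG1) -mulmxBr => ->.
  by rewrite (corner_r eH) (mulmxA _ (mE0 X)) (corner_r (mMP X)).
rewrite -(corner_l eF0) -(corner_l eG0) -mulmxBr -(corner_l eH) -mulmxA.
apply: fmap_ext => x; have /(congr1 val) := hE (Posz 0) x.
rewrite f0 g0 -[h (Posz 0) (Posz 0 - 1) _]/(h (Posz 0) (Negz 0) _) hH linear0 addr0 linearB /=.
rewrite -!mulmxA (corner_r eF0) (corner_r eG0) -mulmxBr => ->.
by rewrite (corner_r (mMP Y)) (mulmxA _ (mE1 Y)) (corner_r eH).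
Qed.

Definition null_mcx X := exists H, [/\ mE0 X *m H *m mE1 X = H,
  mM X *m H = mE1 X & H *m mM X = mE0 X].

Lemma idmx_corner r (E : idmx R r) : E *m E *m E = E.
Proof. by rewrite !idmxK. Qed.

Lemma corner0 r s (E : idmx R r) (F : idmx R s) : E *m 0 *m F = 0.
Proof. by rewrite mulmx0 mul0mx. Qed.

Lemma fmap_id r (E : idmx R r) : (idfun : {linear fmod E -> fmod E}) =1 fmap E E E.
Proof. by move=> x; apply: val_inj; rewrite /= !fmodP. Qed.

Lemma fmap_null r s (E : idmx R r) (F : idmx R s) :
  (\0 : {linear fmod E -> fmod F}) =1 fmap E F 0.
Proof. by move=> x; apply: val_inj; rewrite /= mulmx0 mul0mx. Qed.

Lemma hiso_zero_null X : hiso (cx_of X) (cx_zero A) -> null_mcx X.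
Proof.
move=> /hiso_zero_id h0.
have [H [eH e1 e0]] := @homotopic_mx X X (cx_id _) (cx_null _ _) _ _ _ _ (idmx_corner _) (idmx_corner _) (corner0 _ _)
  (corner0 _ _) (@fmap_id _ _) (@fmap_id _ _) (@fmap_null _ _ _ _) (@fmap_null _ _ _ _) h0.
by exists H; rewrite -e1 -e0 !subr0.
Qed.

Definition null_endo X (a1 a0 : 'M[R]_(mdim X)) := exists H,
  [/\ mE0 X *m H *m mE1 X = H, a1 = mM X *m H & a0 = H *m mM X].

Definition idem_endo X (a1 a0 : 'M[R]_(mdim X)) :=
  [/\ mE1 X *m a1 *m mE1 X = a1, mE0 X *m a0 *m mE0 X = a0,
      mM X *m a0 = a1 *m mM X & null_endo (a1 *m a1 - a1) (a0 *m a0 - a0)].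

Lemma indecomposable_criterion X : ~ null_mcx X ->
  (forall a1 a0, @idem_endo X a1 a0 ->
     null_endo a1 a0 \/ null_endo (idmx_val (mE1 X) - a1) (idmx_val (mE0 X) - a0)) ->
  cx_indecomposable (cx_of X).
Proof.
move=> nn idem; split=> [/hiso_zero_null//|Y Z _ _ /split_idempotent[e [ee eY eZ]]].
have [a1 [a0 [c1 c0 comm e1 e0]]] := cx_of_hom e.
have ee1 : (cx_comp e e (-1)) =1 fmap (mE1 X) (mE1 X) (a1 *m a1).
  move=> x; rewrite /= e1 e1; apply: val_inj; rewrite /= -!mulmxA.
  by rewrite !(mulmxA _ (mE1 X)) (corner_r c1).
have ee0 : (cx_comp e e 0) =1 fmap (mE0 X) (mE0 X) (a0 *m a0).
  move=> x; rewrite /= e0 e0; apply: val_inj; rewrite /= -!mulmxA.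
  by rewrite !(mulmxA _ (mE0 X)) (corner_r c0).
have cc1 : mE1 X *m (a1 *m a1) *m mE1 X = a1 *m a1.
  by rewrite !mulmxA (corner_l c1) -mulmxA (corner_r c1).
have cc0 : mE0 X *m (a0 *m a0) *m mE0 X = a0 *m a0.
  by rewrite !mulmxA (corner_l c0) -mulmxA (corner_r c0).
have null_e := homotopic_mx cc1 cc0 c1 c0 ee1 ee0 e1 e0 ee.
have [] := idem a1 a0 (And4 c1 c0 comm null_e).
  move=> [H [eH h1 h0]]; left; apply: eY.
  by apply: (@homotopic_cx_of X X e (cx_null _ _) _ _ _ _ H e1 e0 (@fmap_null _ _ _ _)
    (@fmap_null _ _ _ _)) => //; rewrite subr0.
move=> [H [eH h1 h0]]; right; apply/eZ/homotopic_sym.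
exact: (@homotopic_cx_of X X (cx_id _) e _ _ _ _ H (@fmap_id _ _) (@fmap_id _ _) e1 e0 h1 h0 eH).
Qed.

(* Hom(X, Y[1]) = 0 *)
Definition ext_mx X Y := forall f, mE1 X *m f *m mE0 Y = f ->
  exists a b, f = mM X *m a + b *m mM Y.

Definition ext_zero (C D : complex A) := forall m : int, 0 < m ->
  forall f : cx_hom C (shift D m), homotopic f (cx_null C (shift D m)).

Lemma ext_zero_suml (C C' D : complex A) :
  ext_zero C D -> ext_zero C' D -> ext_zero (cx_sum C C') D.
Proof.
move=> z z' m m0 f.
have [h hE] := z m m0 (cx_comp f (cx_inj1 C C')).
have [h' hE'] := z' m m0 (cx_comp f (cx_inj2 C C')).
exists (fun i j => (h i j \o proj1 _ _) \+ (h' i j \o proj2 _ _)) => i x.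
rewrite [x in f i x]mod_sum_eta linearD.
have {}hE := hE i x.1; have {}hE' := hE' i x.2.
rewrite subr0 in hE; rewrite subr0 in hE'; rewrite subr0.
rewrite [X in X + _](_ : _ = f i (mkpair_fun idfun \0 x.1)) //.
rewrite [X in _ + X](_ : _ = f i (mkpair_fun \0 idfun x.2)) //.
by rewrite [f i _]hE [f i _]hE' /= linearD addrACA.
Qed.

Lemma shift_proj1_comm (D D' : complex A) m i j x :
  diff (shift D m) i j (proj1 (D (i + m)) (D' (i + m)) x) =
  proj1 (D (j + m)) (D' (j + m)) (diff (shift (cx_sum D D') m) i j x).
Proof. by rewrite /= /shift_diff; case: odd. Qed.

Lemma shift_proj2_comm (D D' : complex A) m i j x :
  diff (shift D' m) i j (proj2 (D (i + m)) (D' (i + m)) x) =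
  proj2 (D (j + m)) (D' (j + m)) (diff (shift (cx_sum D D') m) i j x).
Proof. by rewrite /= /shift_diff; case: odd. Qed.

Lemma ext_zero_sumr (C D D' : complex A) :
  ext_zero C D -> ext_zero C D' -> ext_zero C (cx_sum D D').
Proof.
move=> z z' m m0 f.
pose p1 : cx_hom (shift (cx_sum D D') m) (shift D m) :=
  @CxHom A (shift (cx_sum D D') m) (shift D m) _ (@shift_proj1_comm D D' m).
pose p2 : cx_hom (shift (cx_sum D D') m) (shift D' m) :=
  @CxHom A (shift (cx_sum D D') m) (shift D' m) _ (@shift_proj2_comm D D' m).
have [h hE] := z m m0 (cx_comp p1 f); have [h' hE'] := z' m m0 (cx_comp p2 f).
exists (fun i j => mkpair (h i j) (h' i j)) => i x.
have {}hE := hE i x; have {}hE' := hE' i x.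
rewrite subr0 in hE; rewrite subr0 in hE'; rewrite subr0.
transitivity ((cx_comp p1 f i x, cx_comp p2 f i x) : mod_sum (D (i + m)) (D' (i + m))).
  by rewrite /=; case: (f i x).
by rewrite hE hE' /= /shift_diff; case: odd.
Qed.

Lemma ext_zero_zerol (D : complex A) : ext_zero (cx_zero A) D.
Proof.
move=> m m0 f; apply: homotopic_refl => i x.
by rewrite (thinmx0 x) !linear0.
Qed.

Lemma ext_zero_zeror (C : complex A) : ext_zero C (cx_zero A).
Proof.
by move=> m m0 f; apply: homotopic_refl => i x; rewrite [LHS]thinmx0 [RHS]thinmx0.
Qed.

Section ShiftHomotopy.
Variables (X Y : mcx) (a : {linear fmod (mE0 X) -> fmod (mE0 Y)})
  (b : {linear fmod (mE1 X) -> fmod (mE1 Y)}).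

Definition shift_homotopy (i j : int) : {linear cx_of X i -> shift (cx_of Y) 1 j} :=
  match i return {linear cx_of X i -> cx_of Y (j + 1)} with
  | Posz 0 =>
    match j return {linear fmod (mE0 X) -> cx_of Y (j + 1)} with
    | Negz 0 => a
    | _ => \0
    end
  | Negz 0 =>
    match j return {linear fmod (mE1 X) -> cx_of Y (j + 1)} with
    | Negz 1 => b
    | _ => \0
    end
  | _ => \0
  end.
End ShiftHomotopy.

Lemma ext_zero_cx_of X Y : ext_mx X Y -> ext_zero (cx_of X) (cx_of Y).
Proof.
(* The shifts by at least 2 come first: there the complex and the shifted one have no common
   degree. *)
move=> ext [[|[|m]]|m] // _ f; last first.
  apply: homotopic_refl => -[[|n]|[|n]] x; try by rewrite (thinmx0 x) !linear0.
    by rewrite [LHS]thinmx0 [RHS]thinmx0.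
  by rewrite [LHS]thinmx0 [RHS]thinmx0.
have [F eF fF] := fmap_full (f (Negz 0)).
have [a [b FE]] := ext F eF.
(* Shifting by 1 negates the differential of [Y], hence the sign at [b]. *)
exists (shift_homotopy (fmap (mE0 X) (mE0 Y) (mE0 X *m a)) (\- (fmap (mE1 X) (mE1 Y) (b *m mE1 Y)))).
case=> [[|n]|[|n]] x; try by rewrite (thinmx0 x) !linear0.
  by rewrite [LHS]thinmx0 [RHS]thinmx0.
rewrite subr0 fF.
pose bx := fmap (mE1 X) (mE1 Y) (b *m mE1 Y) x.
transitivity (fmap (mE1 Y) (mE0 Y) (mM Y) bx +
  fmap (mE0 X) (mE0 Y) (mE0 X *m a) (fmap (mE1 X) (mE0 X) (mM X) x)); last first.
  rewrite [LHS](_ : _ = - fmap (mE1 Y) (mE0 Y) (mM Y) (- bx) +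
    fmap (mE0 X) (mE0 Y) (mE0 X *m a) (fmap (mE1 X) (mE0 X) (mM X) x)) //.
  by rewrite linearN opprK.
apply: val_inj; rewrite linearD /= !mulmxA -[_ *m mM X *m mE0 X]mulmxA (corner_r (mMP X)).
rewrite -[_ *m mM X *m mE0 X]mulmxA (corner_r (mMP X)) -[_ *m b *m mE1 Y *m mE1 Y]mulmxA idmxK.
rewrite -[_ *m mE1 Y *m mM Y]mulmxA (corner_l (mMP Y)) FE addrC mulmxDr mulmxDl !mulmxA.
by [].
Qed.

Lemma is_zero_mod_sum (M N : lmodType A^c) :
  is_zero_mod M -> is_zero_mod N -> is_zero_mod (mod_sum M N).
Proof. by move=> m0 n0 [x y]; rewrite (m0 x) (n0 y). Qed.

Lemma mod_iso_refl (M : lmodType A^c) : mod_iso M M.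
Proof. by exists idfun; exists idfun. Qed.

Lemma mod_iso_trans (M N K : lmodType A^c) : mod_iso M N -> mod_iso N K -> mod_iso M K.
Proof. by move=> [f bf] [g bg]; exists (g \o f); apply: bij_comp. Qed.

Lemma can_mod_iso (M N : lmodType A^c) (f : {linear M -> N}) (g : N -> M) :
  cancel f g -> cancel g f -> mod_iso M N.
Proof. by move=> fg gf; exists f; exists g. Qed.

Lemma mod_iso_sym (M N : lmodType A^c) : mod_iso M N -> mod_iso N M.
Proof.
move=> [f [g fg gf]].
have glin : linear g by move=> a x y; apply: (can_inj fg); rewrite linearP !gf.
pose gl := GRing.isLinear.Build A^c N M *:%R g glin.
pose G : {linear N -> M} := HB.pack g gl.
by exists G; exists f.
Qed.

Lemma mod_iso_sum (M M' N N' : lmodType A^c) :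
  mod_iso M M' -> mod_iso N N' -> mod_iso (mod_sum M N) (mod_sum M' N').
Proof.
move=> [f [f' ff' f'f]] [g [g' gg' g'g]].
apply: (@can_mod_iso _ _ (mkpair (f \o proj1 M N) (g \o proj2 M N))
  (fun x => (f' x.1, g' x.2))) => -[x y] /=; rewrite /mkpair_fun /=.
  by rewrite ff' gg'.
by rewrite f'f g'g.
Qed.

Lemma fg_projective_sum (M N : lmodType A^c) :
  fg_projective M -> fg_projective N -> fg_projective (mod_sum M N).
Proof.
move=> [m [M' [f [f' ff' f'f]]]] [n [N' [g [g' gg' g'g]]]].
exists (m + n)%N, (mod_sum M' N').
pose F (x : mod_sum (mod_sum M N) (mod_sum M' N')) : 'rV[A^c]_(m + n) :=
  row_mx (f (x.1.1, x.2.1)) (g (x.1.2, x.2.2)).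
have Flin : linear F.
  move=> a x y; rewrite /F scale_row_mx add_row_mx -!linearP.
  by [].
pose Fl := GRing.isLinear.Build A^c _ _ *:%R F Flin.
pose FL : {linear mod_sum (mod_sum M N) (mod_sum M' N') -> 'rV[A^c]_(m + n)} := HB.pack F Fl.
apply: (@can_mod_iso _ _ FL (fun v => let: x := f' (lsubmx v) in let: y := g' (rsubmx v) in
  ((x.1, y.1), (x.2, y.2)))) => [[[x y] [x' y']]|v] /=.
  by rewrite /F row_mxKl row_mxKr /= ff' gg'.
rewrite /F /=; case: (f' _) (f'f (lsubmx v)) => x x' /= ->.
by case: (g' _) (g'g (rsubmx v)) => y y' /= ->; rewrite hsubmxK.
Qed.

Lemma fg_projective_zero (M : lmodType A^c) : is_zero_mod M -> fg_projective M.
Proof.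
move=> M0; exists 0%N, M.
apply: (@can_mod_iso _ _ \0 (fun=> 0)) => [[x y]|v]; first by rewrite (M0 x) (M0 y).
by rewrite [LHS]thinmx0 [RHS]thinmx0.
Qed.

Lemma fg_projective_fmod r (E : idmx A^c r) : fg_projective (fmod E).
Proof.
have EK : (1%:M - idmx_val E) *m (1%:M - idmx_val E) = 1%:M - idmx_val E.
  by rewrite mulmxBl mul1mx mulmxBr mulmx1 idmxK subrr subr0.
pose E' := Idmx EK; exists r, (fmod E').
pose F (x : mod_sum (fmod E) (fmod E')) : 'rV[A^c]_r := val x.1 + val x.2.
have Flin : linear F.
  move=> a [x1 x2] [y1 y2].
  by rewrite -[LHS]/(val (a *: x1 + y1) + val (a *: x2 + y2)) !linearP scalerDr addrACA.
pose Fl := GRing.isLinear.Build A^c _ _ *:%R F Flin.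
pose FL : {linear mod_sum (fmod E) (fmod E') -> 'rV[A^c]_r} := HB.pack F Fl.
apply: (@can_mod_iso _ _ FL (fun v => (tofmod (idmxK E) v, tofmod (idmxK E') v))).
  move=> [x y] /=; rewrite /F /=; congr (_, _); apply: val_inj; rewrite /= mulmxDl.
    rewrite fmodP -[val y]fmodP -mulmxA mulmxBl mul1mx idmxK subrr mulmx0 addr0.
    by [].
  rewrite [val y *m _]fmodP -[val x]fmodP -mulmxA mulmxBr mulmx1 idmxK subrr mulmx0.
  by rewrite add0r.
by move=> v /=; rewrite /F /= -mulmxDr addrC subrK mulmx1.
Qed.
End TwoTermComplex.

(** * Decomposition of two-term complexes *)

Section Graded.
Variables (R : pzRingType) (n : nat) (e : 'I_n -> R).
Hypothesis e_orth : forall i j, e i * e j = if i == j then e i else 0.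
Hypothesis e_neq0 : forall i, e i != 0.
(** Two facts in one: the corner at [v] is local, and maps through the other projectives never add
    up to the identity of the one at [v]. *)
Hypothesis e_local : forall v m (u : 'I_m -> option 'I_n) (c y : 'I_m -> R),
  (forall l, e v * c l * eo e (u l) = c l) ->
  (forall l, eo e (u l) * y l * e v = y l) ->
  \sum_l c l * y l = e v ->
  exists l z, [/\ u l = Some v, e v * z * e v = z, z * y l = e v & y l * z = e v].

Local Notation eo := (eo e).

Lemma eoK o : eo o * eo o = eo o.
Proof. by case: o => [i|] /=; rewrite ?mulr0 // e_orth eqxx. Qed.

Section Diag.
Variables (r : nat) (w : 'I_r -> option 'I_n).

Definition emat : 'M[R]_r := \matrix_(i, j) (eo (w i) *+ (i == j)).

Lemma mul_emat s (M : 'M[R]_(r, s)) i j : (emat *m M) i j = eo (w i) * M i j.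
Proof.
rewrite !mxE (bigD1 i) //= mxE eqxx big1 ?addr0 // => k ne.
by rewrite mxE eq_sym (negbTE ne) mul0r.
Qed.

Lemma mulmx_emat s (M : 'M[R]_(s, r)) i j : (M *m emat) i j = M i j * eo (w j).
Proof.
rewrite !mxE (bigD1 j) //= mxE eqxx big1 ?addr0 // => k ne.
by rewrite mxE (negbTE ne) mulr0.
Qed.

Lemma ematK : emat *m emat = emat.
Proof.
apply/matrixP => i j; rewrite mul_emat !mxE.
by case: eqP => _; rewrite ?mulr0 // mulr1n eoK.
Qed.

Definition eid : idmx R r := Idmx ematK.
End Diag.

Definition inverse_pair r (w : 'I_r -> option 'I_n) (G G' : 'M[R]_r) :=
  [/\ eid w *m G *m eid w = G, eid w *m G' *m eid w = G',
      G *m G' = eid w & G' *m G = eid w].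

Lemma inverse_pair_id r (w : 'I_r -> option 'I_n) : inverse_pair w (eid w) (eid w).
Proof. by split; rewrite ?idmxK. Qed.

Lemma row_none r s (w : 'I_r -> option 'I_n) (G : 'M[R]_(r, s)) i :
  eid w *m G = G -> w i = None -> row i G = 0.
Proof.
by move=> <- wi; apply/rowP => j; rewrite mxE mul_emat wi mul0r mxE.
Qed.

(* Steinitz exchange: a generating family of homogeneous rows contains a basis;
   each basis element is replaced by a generator with a unit coordinate. *)
Lemma exchange m r (u : 'I_m -> option 'I_n) (w : 'I_r -> option 'I_n)
    (X : 'M[R]_(m, r)) (C : 'M[R]_(r, m)) :
  eid w *m C *m eid u = C -> eid u *m X *m eid w = X -> C *m X = eid w ->
  exists (l : 'I_r -> option 'I_m) (G G' : 'M[R]_r), inverse_pair w G G' /\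
    forall i, w i != None -> exists l0, [/\ l i = Some l0, u l0 = w i & row i G = row l0 X].
Proof.
move=> cC cX CX.
suff ind k : (k <= r)%N -> exists (l : 'I_r -> option 'I_m) (G G' : 'M[R]_r),
    inverse_pair w G G' /\ forall i : 'I_r, (i < k)%N -> w i != None ->
    exists l0, [/\ l i = Some l0, u l0 = w i & row i G = row l0 X].
  by have [l [G [G' [Gi GX]]]] := ind r (leqnn r); exists l, G, G'; split=> // i; apply: GX.
elim: k => [_|k IHk ltkr].
  by exists (fun=> None), (eid w), (eid w); split=> //; apply: inverse_pair_id.
have [l [G [G' [[cG cG' GG' G'G] GX]]]] := IHk (ltnW ltkr).
pose i := Ordinal ltkr.
case wi: (w i) => [v|]; last first.
  exists l, G, G'; split=> // j; rewrite ltnS leq_eqVlt => /orP[/eqP ej|]; last exact: GX.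
  by rewrite (_ : j = i) ?wi //; apply: val_inj.
(* The rows of [Y] are the generators in the coordinates of the current basis [G]. As [D *m Y] is
   the identity, [e_local] finds a generator whose [i]-th coordinate is a unit. *)
pose Y := X *m G'; pose D := G *m C.
have DY : D *m Y = eid w.
  by rewrite mulmxA -[D *m X]mulmxA CX (corner_r cG).
have YE : eid u *m Y *m eid w = Y.
  by rewrite mulmxA (corner_l cX) -mulmxA (corner_r cG').
have [|||l0 [z [ul cz zy yz]]] := @e_local v m u (fun l => D i l) (fun l => Y l i).
- move=> l1; have DE : eid w *m D *m eid u = D.
    by rewrite mulmxA (corner_l cG) -mulmxA (corner_r cC).
  by rewrite -[RHS](congr1 (fun N : 'M[R]_(_, _) => N i l1) DE) mulmx_emat mul_emat wi.
- by move=> l1; rewrite -[RHS](congr1 (fun N : 'M[R]_(_, _) => N l1 i) YE) mulmx_emat mul_emat wi.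
- by move: DY => /matrixP/(_ i i); rewrite !mxE wi eqxx => ->.
pose uu : 'cV[R]_r := \col_j (e v *+ (j == i)).
pose vv : 'rV[R]_r := row l0 Y - row i (eid w).
have ev : e v * e v = e v by rewrite e_orth eqxx.
have Yw : row l0 Y *m eid w = row l0 Y by rewrite -row_mul -mulmxA (corner_r cG').
have vE : vv *m eid w = vv by rewrite mulmxBl Yw -row_mul idmxK.
have uE : eid w *m uu = uu.
  apply/matrixP => a b; rewrite [LHS]mul_emat !mxE.
  by case: eqP => [->|_]; rewrite ?mulr0n ?mulr0 // wi /= ev.
have ue : uu *m (e v)%:M = uu.
  apply/matrixP => a b; rewrite mxE big_ord1 !mxE (ord1 b) eqxx mulr1n.
  by case: eqP => _; rewrite ?mulr0n ?mul0r // mulr1n ev.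
have vu : vv *m uu = (Y l0 i - e v)%:M.
  apply/matrixP => a b; rewrite (ord1 a) (ord1 b) !mxE eqxx mulr1n (bigD1 i) //= big1.
    rewrite addr0 -/Y !mxE eqxx !mulr1n wi /= mulrBl ev; congr (_ - _).
    have := congr1 (fun N : 'M[R]_(_, _) => N l0 i) (corner_r YE).
    by rewrite mulmx_emat wi mxE.
  by move=> k1 ne; rewrite !mxE (negbTE ne) mulr0n mulr0.
(* [H] replaces the [i]-th coordinate vector by the row [l0] of [Y]. Its inverse follows the rule
   for rank-one perturbations, [1 - uu (1 + vv uu)^-1 vv]: in the corner, [1 + vv uu] is [Y l0 i],
   with inverse [z]. *)
pose H := emat w + uu *m vv; pose H' := emat w - uu *m z%:M *m vv.
have ez : e v * z = z by rewrite -cz !mulrA ev.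
have ze : z * e v = z by rewrite -cz -!mulrA ev.
have sub_e : emat w *m emat w = emat w := ematK w.
have uez : uu *m (e v - z)%:M = uu - uu *m z%:M.
  rewrite -[X in _ = X - _]ue; apply/matrixP => a b.
  by rewrite !mxE !big_ord1 !mxE -mulrBr -mulrnBl.
have HH' : H *m H' = emat w.
  rewrite /H /H' mulmxBr !mulmxDl sub_e -[uu *m vv *m emat w]mulmxA vE !mulmxA uE.
  rewrite -[uu *m vv *m uu]mulmxA vu -[uu *m _%:M *m _%:M]mulmxA -scalar_mxM mulrBl yz ez.
  by rewrite uez mulmxBl [X in _ - X]addrC subrK addrK.
have H'H : H' *m H = emat w.
  rewrite /H /H' mulmxDr !mulmxBl sub_e -[uu *m _ *m vv *m emat w]mulmxA vE !mulmxA uE.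
  rewrite -[uu *m _ *m vv *m uu]mulmxA vu -[uu *m _%:M *m _%:M]mulmxA -scalar_mxM mulrBr zy ze.
  by rewrite uez mulmxBl subKr subrK.
have cH : emat w *m H = H by rewrite mulmxDr sub_e mulmxA uE.
have Hc : H *m emat w = H by rewrite mulmxDl sub_e -mulmxA vE.
have cH' : emat w *m H' = H' by rewrite mulmxBr sub_e !mulmxA uE.
have Hc' : H' *m emat w = H' by rewrite mulmxBl sub_e -!mulmxA vE mulmxA.
exists (fun j => if j == i then Some l0 else l j), (H *m G), (G' *m H'); split.
  split=> /=.
  - by rewrite mulmxA cH -mulmxA (corner_r cG).
  - by rewrite mulmxA (corner_l cG') -mulmxA Hc'.
  - by rewrite -mulmxA (mulmxA G) GG' [_ *m H']cH' HH'.
  - by rewrite -mulmxA (mulmxA H') H'H [_ *m G](corner_l cG) G'G.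
move=> j; rewrite ltnS leq_eqVlt => /orP[/eqP ej|ltj] wj.
  have -> : j = i by apply: val_inj.
  exists l0; rewrite eqxx wi ul; split=> //.
  rewrite row_mul; have -> : row i H = row l0 Y.
    rewrite linearD /= row_mul; have -> : row i uu = (e v)%:M.
      apply/matrixP => a b; rewrite (ord1 a) (ord1 b) !mxE !eqxx //.
    have scale_row p (N : 'M[R]_(p, r)) (u' : 'I_p -> option 'I_n) k1 :
        emat u' *m N = N -> u' k1 = Some v -> e v *: row k1 N = row k1 N.
      move=> <- uk; apply/rowP => b.
      by rewrite [LHS]mxE [row k1 _ 0 b]mxE mul_emat uk /= mulrA ev.
    rewrite mulmxBr !mul_scalar_mx (scale_row _ _ u) ?(scale_row _ _ w) //.
      by rewrite addrC subrK.
    exact: corner_l YE.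
  by rewrite -row_mul -mulmxA G'G (corner_r cX).
have neij : j == i = false by apply/eqP => e1; rewrite e1 ltnn in ltj.
rewrite neij; have [l1 [lj uj ej]] := GX j ltj wj; exists l1; split=> //.
rewrite row_mul linearD /= row_mul; have -> : row j uu = 0.
  by apply/matrixP => a b; rewrite !mxE neij mulr0n.
by rewrite mul0mx addr0 -row_mul (corner_l cG).
Qed.

(* Exchange applies to the rows of a and 1 - a, which together generate. *)
Lemma idem_exchange r (w : 'I_r -> option 'I_n) (a : 'M[R]_r) :
  eid w *m a *m eid w = a ->
  exists (b : 'I_r -> bool) (l : 'I_r -> 'I_r) (G G' : 'M[R]_r),
    inverse_pair w G G' /\ forall i, w i != None ->
      row i G = row (l i) (if b i then a else idmx_val (eid w) - a).
Proof.
move=> ca; pose a' := idmx_val (eid w) - a.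
have ca' : eid w *m a' *m eid w = a' by rewrite mulmxBr mulmxBl ca !idmxK.
pose u (k : 'I_(r + r)) := match fintype.split k with inl j => w j | inr j => w j end.
have Eu : emat u = block_mx (emat w) 0 0 (emat w).
  apply/matrixP => i j; rewrite mxE.
  case: (split_ordP i) => i' ->; case: (split_ordP j) => j' ->.
  - by rewrite block_mxEul mxE /u (unsplitK (inl i')) (inj_eq (@lshift_inj _ _)).
  - by rewrite block_mxEur mxE eq_lrshift mulr0n.
  - by rewrite block_mxEdl mxE eq_rlshift mulr0n.
  - by rewrite block_mxEdr mxE /u (unsplitK (inr i')) (inj_eq (@rshift_inj _ _)).
have ww : emat w *m emat w = emat w := ematK w.
have [|||l [G [G' [GP GX]]]] := @exchange _ _ u w (col_mx a a') (row_mx (emat w) (emat w)).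
- by rewrite /= Eu mul_mx_row mul_row_block !mulmx0 addr0 add0r !ww.
- rewrite /= Eu mul_block_col !mul0mx addr0 add0r mul_col_mx.
  by rewrite [emat w *m a](corner_l ca) [emat w *m a'](corner_l ca') (corner_r ca) (corner_r ca').
- by rewrite mul_row_col -mulmxDr addrC subrK ww.
pose sp i := if l i is Some l0 then fintype.split l0 else inl i.
exists (fun i => if sp i is inl _ then true else false).
exists (fun i => match sp i with inl j => j | inr j => j end), G, G'; split=> // i wi.
have [l0 [li _ ->]] := GX i wi; rewrite /sp li.
by case: (fintype.split l0) (splitK l0) => j <- /=; rewrite ?rowKu ?rowKd.
Qed.

(** A discarded basis vector keeps its place with the label [None], so parts of a basis need no
    renumbering. *)
Definition subw r (w : 'I_r -> option 'I_n) (b : 'I_r -> bool) i := if b i then w i else None.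

Lemma subw_l r (w : 'I_r -> option 'I_n) b : emat (subw w b) *m emat w = emat (subw w b).
Proof.
apply/matrixP => i j; rewrite mul_emat !mxE /subw; case: (b i); rewrite ?mul0r ?mul0rn //.
by case: eqP => _; rewrite ?mulr0 // eoK.
Qed.

Lemma subw_r r (w : 'I_r -> option 'I_n) b : emat w *m emat (subw w b) = emat (subw w b).
Proof.
apply/matrixP => i j; rewrite mul_emat !mxE /subw.
case: eqP => [_|_]; rewrite ?mulr0n ?mulr0 // !mulr1n.
by case: (b i); rewrite /= ?mulr0 // eoK.
Qed.

Lemma subw_compl r (w : 'I_r -> option 'I_n) b :
  emat (subw w (fun i => ~~ b i)) = emat w - emat (subw w b).
Proof.
apply/matrixP => i j; rewrite !mxE /subw -mulrnBl.
by case: (b i); rewrite /= ?subrr ?subr0.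
Qed.

Definition count_w r (w : 'I_r -> option 'I_n) v : nat := (\sum_i (w i == Some v))%N.
Definition size_w r (w : 'I_r -> option 'I_n) : nat := (\sum_i (w i != None))%N.

Lemma count_subw r (w : 'I_r -> option 'I_n) b v :
  count_w w v = (count_w (subw w b) v + count_w (subw w (fun i => ~~ b i)) v)%N.
Proof.
rewrite /count_w -big_split; apply: eq_bigr => i _; rewrite /subw.
by case: (b i); rewrite /= ?addn0.
Qed.

Lemma size_subw r (w : 'I_r -> option 'I_n) b :
  size_w w = (size_w (subw w b) + size_w (subw w (fun i => ~~ b i)))%N.
Proof.
rewrite /size_w -big_split; apply: eq_bigr => i _; rewrite /subw.
by case: (b i); rewrite /= ?addn0.
Qed.

Lemma size_w0 r (w : 'I_r -> option 'I_n) : size_w w = 0%N -> forall i, w i = None.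
Proof.
move=> /eqP; rewrite sum_nat_eq0 => /forallP w0 i; have := w0 i.
by rewrite eqb0 negbK => /eqP.
Qed.

Lemma emat_none r (w : 'I_r -> option 'I_n) : (forall i, w i = None) -> emat w = 0.
Proof. by move=> w0; apply/matrixP => i j; rewrite !mxE w0 mul0rn. Qed.

(** Exchange assigns to each basis vector labelled [v] a generator with the same label, and two rows
    of the invertible [G] cannot come from the same generator. *)
Lemma iso_count_le r s (w : 'I_r -> option 'I_n) (u : 'I_s -> option 'I_n) X C v :
  eid w *m C *m eid u = C -> eid u *m X *m eid w = X -> C *m X = eid w ->
  (count_w w v <= count_w u v)%N.
Proof.
move=> cC cX CX; have [l [G [G' [[cG cG' GG' _] GX]]]] := exchange cC cX CX.
have cnt p (t : 'I_p -> option 'I_n) : count_w t v = #|[set i | t i == Some v]%SET|.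
  rewrite /count_w -sum1_card [RHS]big_mkcond; apply: eq_bigr => i _.
  by rewrite inE; case: eqP.
rewrite !cnt.
have nn i : w i = Some v -> w i != None by move=> ->.
have [->|/set0Pn[i0]] := eqVneq [set i | w i == Some v]%SET finset.set0.
  by rewrite cards0.
rewrite inE => /eqP w0; have [d [_ _ _]] := GX i0 (nn _ w0).
pose g i := odflt d (l i).
have ginj : {in [set i | w i == Some v]%SET &, injective g}.
  move=> i j; rewrite !inE => /eqP wi /eqP wj.
  have [a [la _ ra]] := GX i (nn _ wi).
  have [b [lb _ rb]] := GX j (nn _ wj).
  rewrite /g la lb /= => eab; have : row i (G *m G') = row j (G *m G').
    by rewrite !row_mul ra rb eab.
  rewrite GG' => /rowP/(_ i); rewrite !mxE eqxx mulr1n wi /=.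
  by case: eqP => [->//|_] /eqP; rewrite mulr0n (negbTE (e_neq0 v)).
rewrite -(card_in_imset ginj); apply/subset_leq_card/fintype.subsetP => j /imsetP[i].
rewrite inE => /eqP wi ->; have [a [la ua _]] := GX i (nn _ wi).
by rewrite inE /g la /= ua wi.
Qed.

(** [x] and [e v - x] add up to [e v], so one of them is a unit of the corner. *)
Lemma local_idempotent v x :
  e v * x = x -> x * e v = x -> x * x = x -> x = 0 \/ x = e v.
Proof.
move=> ex xe xx; have ee : e v * e v = e v by rewrite e_orth eqxx.
pose y (l : 'I_2) := if l == ord0 then x else e v - x.
have [|||l [z [_ _ zy _]]] := @e_local v 2 (fun=> Some v) (fun=> e v) y.
- by move=> l; rewrite /= !ee.
- by move=> l; rewrite /y /=; case: ifP => _; rewrite ?mulrBr ?mulrBl ?ex ?xe ?ee.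
- by rewrite !big_ord_recl big_ord0 addr0 /y /= mulrBr ee ex addrC subrK.
move: zy; rewrite /y; case: ifP => _ zy.
  by right; rewrite -ex -zy -mulrA xx.
left; have : z * (e v - x) * x = e v * x by rewrite zy.
by rewrite -mulrA mulrBl ex xx subrr mulr0.
Qed.
End Graded.

(** * Splitting along homotopy idempotents *)

Section Decomposition.
Variables (A : pzRingType) (n : nat) (e : 'I_n -> A^c).
Local Notation R := (A^c).
Hypothesis e_orth : forall i j, e i * e j = if i == j then e i else 0.
Hypothesis e_neq0 : forall i, e i != 0.
Hypothesis e_local : forall v m (u : 'I_m -> option 'I_n) (c y : 'I_m -> R),
  (forall l, e v * c l * eo e (u l) = c l) ->
  (forall l, eo e (u l) * y l * e v = y l) ->
  \sum_l c l * y l = e v ->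
  exists l z, [/\ u l = Some v, e v * z * e v = z, z * y l = e v & y l * z = e v].
Local Notation emat := (emat e).
Local Notation eid := (eid e_orth).
Local Notation inverse_pair := (inverse_pair e_orth).

Record gcx := Gcx {
  gdim : nat;
  gw1 : 'I_gdim -> option 'I_n;
  gw0 : 'I_gdim -> option 'I_n;
  gM : 'M[R]_gdim;
  gMP : eid gw1 *m gM *m eid gw0 = gM }.

Arguments gw1 : clear implicits.
Arguments gw0 : clear implicits.

Definition mcx_of (X : gcx) : mcx A := Mcx (gMP X).

Definition gvec (X : gcx) : 'rV[int]_n :=
  \row_v ((count_w (gw0 X) v)%:Z - (count_w (gw1 X) v)%:Z).

Definition gsize (X : gcx) : nat := (size_w (gw1 X) + size_w (gw0 X))%N.

Section Split.
Variables (X : gcx) (G1 G1' G0 G0' : 'M[R]_(gdim X)) (b1 b0 : 'I_(gdim X) -> bool).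
Hypothesis P1 : inverse_pair (gw1 X) G1 G1'.
Hypothesis P0 : inverse_pair (gw0 X) G0 G0'.
(** The differential in new bases of the two terms; [comm] says that it is block diagonal for the
    chosen parts of these bases. *)
Let M' := G1 *m gM X *m G0'.
Hypothesis comm : emat (subw (gw1 X) b1) *m M' = M' *m emat (subw (gw0 X) b0).

Lemma split_proof : eid (subw (gw1 X) b1) *m (emat (subw (gw1 X) b1) *m M') *m
  eid (subw (gw0 X) b0) = emat (subw (gw1 X) b1) *m M'.
Proof.
rewrite comm -[LHS]mulmxA [_ *m emat _ *m eid _](_ : _ = M' *m emat (subw (gw0 X) b0)).
  by rewrite -comm mulmxA; congr (_ *m _); apply: ematK.
by rewrite -mulmxA; congr (_ *m _); apply: ematK.
Qed.

Definition split_cx : gcx := Gcx split_proof.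

Lemma gM_l : emat (gw1 X) *m gM X = gM X. Proof. exact: corner_l (gMP X). Qed.
Lemma gM_r : gM X *m emat (gw0 X) = gM X. Proof. exact: corner_r (gMP X). Qed.

Lemma split_extl (Y : mcx A) : ext_mx (mcx_of X) Y -> ext_mx (mcx_of split_cx) Y.
Proof.
have [c1 c1' _ i1] := P1; have [c0 c0' _ i0] := P0.
move=> ext f cf; have fl := corner_l cf; have fr := corner_r cf.
have [|a [b fE]] := ext (G1' *m f).
  by rewrite mulmxA [_ *m G1'](corner_l c1') -mulmxA fr.
have s1 := subw_l e_orth (gw1 X) b1; have s1' := subw_r e_orth (gw1 X) b1.
have f1 : emat (gw1 X) *m f = f by rewrite -fl mulmxA [_ *m eid _]s1'.
have fE' : f = M' *m (G0 *m a) + G1 *m b *m mM Y.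
  have [_ _ i1' _] := P1; rewrite -[f]f1 -[emat _]/(idmx_val (eid _)) -i1' -mulmxA fE.
  rewrite mulmxDr !mulmxA; congr (_ *m _ + _).
  by rewrite /M' -!mulmxA i0 [gM X *m _]gM_r.
exists (emat (subw (gw0 X) b0) *m (G0 *m a)), (emat (subw (gw1 X) b1) *m (G1 *m b)).
rewrite -[f in LHS]fl {1}fE' mulmxDr; congr (_ + _); last by rewrite !mulmxA.
transitivity (M' *m emat (subw (gw0 X) b0) *m (G0 *m a)).
  by rewrite [LHS]mulmxA; congr (_ *m _); apply: comm.
by rewrite [mM _]comm -[RHS]mulmxA [emat _ *m (emat _ *m _)]mulmxA (ematK e_orth) -[LHS]mulmxA.
Qed.

Lemma split_extr (Y : mcx A) : ext_mx Y (mcx_of X) -> ext_mx Y (mcx_of split_cx).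
Proof.
have [c1 c1' _ i1] := P1; have [c0 c0' _ i0] := P0.
move=> ext f cf; have fl := corner_l cf; have fr := corner_r cf.
have [|a [b fE]] := ext (f *m G0).
  by rewrite mulmxA fl -mulmxA (corner_r c0).
have s0 := subw_l e_orth (gw0 X) b0.
have f0 : f *m emat (gw0 X) = f by rewrite -fr -mulmxA [eid _ *m _]s0.
have fE' : f = mM Y *m (a *m G0') + b *m G1' *m M'.
  have [_ _ i0' _] := P0.
  have {1}-> : f = f *m G0 *m G0' by rewrite -mulmxA i0' [f *m _]f0.
  rewrite fE mulmxDl -mulmxA; congr (_ + _); rewrite -!mulmxA; congr (_ *m _).
  by rewrite /M' !mulmxA i1 [_ *m gM X]gM_l.
exists (a *m G0' *m emat (subw (gw0 X) b0)), (b *m G1').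
rewrite -[f in LHS]fr {1}fE' mulmxDl -!mulmxA; congr (_ + _).
by rewrite /= comm !mulmxA.
Qed.
End Split.

Lemma subw_commC (X : gcx) (N : 'M[R]_(gdim X)) b1 b0 :
  emat (gw1 X) *m N *m emat (gw0 X) = N ->
  emat (subw (gw1 X) b1) *m N = N *m emat (subw (gw0 X) b0) ->
  emat (subw (gw1 X) (fun i => ~~ b1 i)) *m N = N *m emat (subw (gw0 X) (fun i => ~~ b0 i)).
Proof.
move=> cN comm; rewrite !subw_compl mulmxBl mulmxBr comm.
by rewrite (@corner_l _ _ _ (eid (gw1 X)) (eid (gw0 X)) _ cN)
           (@corner_r _ _ _ (eid (gw1 X)) (eid (gw0 X)) _ cN).
Qed.

(** The splitting is recorded by what it hands down. The vanishing of extensions against any [Y],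
    used once on each side, also gives it between the two parts. *)
Definition splits (X X' X'' : gcx) :=
  [/\ gvec X = gvec X' + gvec X'', gsize X = (gsize X' + gsize X'')%N,
    forall Y, ext_mx (mcx_of X) Y -> ext_mx (mcx_of X') Y /\ ext_mx (mcx_of X'') Y &
    forall Y, ext_mx Y (mcx_of X) -> ext_mx Y (mcx_of X') /\ ext_mx Y (mcx_of X'')].

Lemma splits_by (X : gcx) G1 G1' G0 G0' (b1 b0 : 'I_(gdim X) -> bool) :
  inverse_pair (gw1 X) G1 G1' -> inverse_pair (gw0 X) G0 G0' ->
  emat (subw (gw1 X) b1) *m (G1 *m gM X *m G0') =
    (G1 *m gM X *m G0') *m emat (subw (gw0 X) b0) ->
  exists X' X'', splits X X' X'' /\
    gsize X' = (size_w (subw (gw1 X) b1) + size_w (subw (gw0 X) b0))%N.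
Proof.
move=> P1 P0 comm.
have cN : emat (gw1 X) *m (G1 *m gM X *m G0') *m emat (gw0 X) = G1 *m gM X *m G0'.
  have [c1 _ _ _] := P1; have [_ c0' _ _] := P0.
  by rewrite !mulmxA [_ *m G1](corner_l c1) -[_ *m G0' *m _]mulmxA [G0' *m _](corner_r c0').
have commC := subw_commC cN comm.
exists (split_cx comm), (split_cx commC); split=> //; split.
- apply/rowP => v; rewrite !mxE /=.
  rewrite (count_subw (gw0 X) b0) (count_subw (gw1 X) b1) !PoszD opprD addrACA.
  by [].
- by rewrite /gsize /= (size_subw (gw1 X) b1) (size_subw (gw0 X) b0) addnACA.
- by move=> Y ext; split; apply: (split_extl P1 P0).
- by move=> Y ext; split; apply: (split_extr P1 P0).
Qed.

(** A contraction is inverse to the differential, so the two terms are isomorphic and have equal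
    counts. *)
Lemma null_gvec X : null_mcx (mcx_of X) -> gvec X = 0.
Proof.
move=> [H [cH MH HM]]; apply/rowP => v; rewrite !mxE.
have le1 := iso_count_le e_neq0 e_local v cH (gMP X) HM.
have le2 := iso_count_le e_neq0 e_local v (gMP X) cH MH.
by rewrite (@anti_leq (count_w (gw0 X) v) (count_w (gw1 X) v)) ?subrr // le1.
Qed.

Lemma idem_endo_compl (X : gcx) a1 a0 : @idem_endo A (mcx_of X) a1 a0 ->
  @idem_endo A (mcx_of X) (emat (gw1 X) - a1) (emat (gw0 X) - a0).
Proof.
move=> [c1 c0 comm nul].
have sq r (E : idmx R r) a : E *m a *m E = a ->
    (idmx_val E - a) *m (idmx_val E - a) - (idmx_val E - a) = a *m a - a.
  move=> ca; rewrite mulmxBr !mulmxBl idmxK (corner_l ca) (corner_r ca).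
  by rewrite addrAC subrr sub0r opprB.
split.
- by rewrite /= mulmxBr mulmxBl c1 !(ematK e_orth).
- by rewrite /= mulmxBr mulmxBl c0 !(ematK e_orth).
- by rewrite /= mulmxBr mulmxBl comm gM_r gM_l.
- by rewrite (sq _ (eid (gw1 X)) _ c1) (sq _ (eid (gw0 X)) _ c0).
Qed.

Definition splits_lt X := exists X' X'',
  [/\ splits X X' X'', (gsize X' < gsize X)%N & (gsize X'' < gsize X)%N].

(** [X] is a single projective in degree -1, and its endomorphism ring is local. *)
Lemma idem_one (X : gcx) a1 a0 (j0 : 'I_(gdim X)) :
  @idem_endo A (mcx_of X) a1 a0 -> gw1 X j0 != None -> (gsize X <= 1)%N ->
  @null_endo A (mcx_of X) a1 a0 \/
  @null_endo A (mcx_of X) (emat (gw1 X) - a1) (emat (gw0 X) - a0).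
Proof.
move=> [c1 c0 comm [H [_ sq _]]] w1 sz.
have size1 : (0 < size_w (gw1 X))%N.
  by rewrite /size_w (bigD1 j0) //= w1.
have w0 : forall i, gw0 X i = None.
  by apply: size_w0; move: sz size1; rewrite /gsize; lia.
have only j : j != j0 -> gw1 X j = None.
  move=> ne; case wj: (gw1 X j) => [v|//]; move: sz.
  rewrite /gsize /size_w (bigD1 j0) //= w1 (bigD1 j) ?ne //= wj /=.
  by rewrite addnA -addnA ltnNge leq_addr.
have E0 : emat (gw0 X) = 0 := emat_none e w0.
have M0 : gM X = 0 by rewrite -[gM X]gM_r E0 mulmx0.
have a00 : a0 = 0 by rewrite -c0 /= E0 !mul0mx.
move: sq; rewrite /= M0 mul0mx => /eqP; rewrite subr_eq0 => /eqP sq.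
have ent (N : 'M[R]_(gdim X)) : emat (gw1 X) *m N *m emat (gw1 X) = N -> forall j k,
    N j k = N j0 j0 *+ ((j == j0) && (k == j0)).
  move=> cN j k; rewrite -[N in LHS]cN mulmx_emat mul_emat.
  case: (eqVneq j j0) => [->|/only->]; last by rewrite /= !mul0r mulr0n.
  case: (eqVneq k j0) => [->|/only->]; last by rewrite /= mulr0 mulr0n.
  by rewrite -[N in RHS]cN mulmx_emat mul_emat.
case wv: (gw1 X j0) w1 => [v|//] _.
pose x := a1 j0 j0.
have ex : e v * x = x.
  by have := corner_l c1 => /matrixP/(_ j0 j0); rewrite /= mul_emat wv.
have xe : x * e v = x.
  by have := corner_r c1 => /matrixP/(_ j0 j0); rewrite /= mulmx_emat wv.
have xx : x * x = x.
  have := sq => /matrixP/(_ j0 j0); rewrite mxE (bigD1 j0) //= big1 ?addr0 // => k ne.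
  by rewrite (ent _ c1 j0 k) (negbTE ne) andbF mulr0n mul0r.
have [x0|xv] := local_idempotent e_orth e_local ex xe xx.
  left; rewrite a00; suff -> : a1 = 0 by exists 0; rewrite !mulmx0 !mul0mx.
  by apply/matrixP => j k; rewrite (ent _ c1) mxE -/x x0 mul0rn.
have cE : emat (gw1 X) *m emat (gw1 X) *m emat (gw1 X) = emat (gw1 X).
  by rewrite !(ematK e_orth).
right; rewrite E0 a00 subr0; suff -> : a1 = emat (gw1 X).
  by rewrite subrr; exists 0; rewrite !mulmx0 !mul0mx.
apply/matrixP => j k; rewrite (ent _ c1) (ent _ cE) !mxE eqxx wv mulr1n -/x.
by rewrite xv.
Qed.

(** The homotopy [K] turns the endomorphism into [(b', 0)] with [b'] followed by the differential
    equal to 0. Either a basis vector in the image of [b'] spans a projective in degree -1 that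
    splits off, or [1 - b'] has a left inverse and the endomorphism is null. *)
Lemma kernel_step X a1 a0 K : @idem_endo A (mcx_of X) a1 a0 ->
  emat (gw0 X) *m K *m emat (gw1 X) = K -> a0 = K *m gM X ->
  ~ @null_endo A (mcx_of X) a1 a0 ->
  ~ @null_endo A (mcx_of X) (emat (gw1 X) - a1) (emat (gw0 X) - a0) ->
  splits_lt X.
Proof.
move=> idem cK a0K nn nn'; have [c1 c0 comm [H [cH sq1 sq0]]] := idem.
pose b' := a1 - gM X *m K.
have cMK : emat (gw1 X) *m (gM X *m K) *m emat (gw1 X) = gM X *m K.
  by rewrite mulmxA gM_l -mulmxA [K *m _](@corner_r _ _ _ (eid (gw0 X)) (eid (gw1 X)) K cK).
have cb : eid (gw1 X) *m b' *m eid (gw1 X) = b'.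
  by rewrite mulmxBr mulmxBl [_ *m a1 *m _]c1 [_ *m (gM X *m K) *m _]cMK.
have bM : b' *m gM X = 0.
  by rewrite mulmxBl -[a1 *m _]comm -mulmxA /= a0K mulmxA subrr.
have [b [l [G [G' [GP GX]]]]] := idem_exchange e_local cb.
have [cG cG' GG' G'G] := GP.
have [[j0 [w1 bj0]]|no] := pselect (exists j0, gw1 X j0 != None /\ b j0).
  (* Otherwise [X] would be this single projective, where the idempotent is trivial up to
     homotopy. *)
  have ltsz : (1 < gsize X)%N.
    by rewrite ltnNge; apply/negP => /(idem_one idem w1)[].
  pose b1 j := j == j0.
  have none i : subw (gw0 X) (fun=> false) i = None by [].
  have rowj0 : row j0 (G *m gM X) = 0.
    by rewrite row_mul (GX j0 w1) bj0 -row_mul bM row0.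
  have [||X' [X'' [sp sz]]] := splits_by (G1 := G) (G1' := G') (G0 := eid (gw0 X))
    (G0' := eid (gw0 X)) (b1 := b1) (b0 := fun=> false) GP.
  - exact: inverse_pair_id.
  - rewrite (emat_none e none) mulmx0 -mulmxA [gM X *m _]gM_r.
    apply/row_matrixP => i; rewrite row0; apply/rowP => k.
    rewrite mxE mul_emat [RHS]mxE /subw /b1; case: eqP => [->|_]; last by rewrite mul0r.
    suff -> : (G *m gM X) j0 k = 0 by rewrite mulr0.
    by have := rowj0 => /rowP/(_ k); rewrite mxE [RHS]mxE.
  have szX' : gsize X' = 1%N.
    rewrite sz /size_w (bigD1 j0) //= /subw /b1 eqxx w1 big1 ?big1 // => i; last first.
    by move=> /negbTE->.
  exists X', X''; split=> //; rewrite ?szX' //.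
  by have [_ -> _ _] := sp; rewrite szX' add1n.
case: nn; pose S0 : 'M[R]_(gdim X) := \matrix_i (if gw1 X i is Some _ then delta_mx 0 (l i) else 0).
have GS : G = S0 *m (emat (gw1 X) - b').
  apply/row_matrixP => i; rewrite row_mul rowK; case wi: (gw1 X i) => [v|].
    rewrite -rowE GX ?wi //; case: ifP => // bi; case: no; exists i; by rewrite wi.
  by rewrite mul0mx (row_none (corner_l cG) wi).
pose S := G' *m S0.
have SE : S *m (emat (gw1 X) - b') = emat (gw1 X) by rewrite -mulmxA -GS G'G.
have SM : S *m gM X = gM X.
  have e1 : (emat (gw1 X) - b') *m gM X = gM X by rewrite mulmxBl gM_l bM subr0.
  by rewrite -[in LHS]e1 mulmxA SE gM_l.
(* The homotopy that makes [(b', 0)] idempotent: [H] corrected for the passage from [a1] to [b']. *)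
pose h' := H - K *m a1 + K.
have h'M : h' *m gM X = 0.
  rewrite mulmxDl mulmxBl -[H *m gM X]sq0 -mulmxA -[a1 *m gM X]comm /= mulmxA -a0K.
  by rewrite [X in X + _]addrAC subrr sub0r addNr.
have bb : b' *m b' - b' = gM X *m h'.
  have a1MK : a1 *m (gM X *m K) = gM X *m K *m (gM X *m K).
    by rewrite [LHS]mulmxA -[a1 *m gM X]comm /= a0K !mulmxA.
  have -> : b' *m b' = a1 *m a1 - gM X *m K *m a1.
    by rewrite mulmxBr !mulmxBl a1MK subrr subr0.
  rewrite /b' /h' mulmxDr mulmxBr -[gM X *m H]sq1 mulmxA.
  by rewrite opprB addrA [LHS]addrAC; congr (_ + _); rewrite addrAC.
have bE : b' = - (gM X *m h').
  have e1 : (emat (gw1 X) - b') *m b' = - (gM X *m h').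
    by rewrite mulmxBl -bb opprB [emat _ *m b'](corner_l cb).
  by rewrite -[LHS](corner_l cb) -[_ (eid _)]SE -mulmxA e1 mulmxN mulmxA SM.
exists (emat (gw0 X) *m (K - h') *m emat (gw1 X)); split.
- by rewrite /= !mulmxA (ematK e_orth) -!mulmxA (ematK e_orth).
- rewrite /= (_ : gM X *m _ = gM X *m (K - h') *m emat (gw1 X)); last first.
    by rewrite !mulmxA gM_r.
  by rewrite mulmxBr -bE /b' addrC subrK; apply/esym/(corner_r c1).
- by rewrite -!mulmxA gM_l mulmxBl h'M subr0 -a0K /= (corner_l c0).
Qed.

(** A basis of P^0 adapted to [a0] deforms the homotopy idempotent to one with a true projection
    [Pi] in degree 0; a basis of P^-1 adapted to the new component in degree -1 then makes the
    differential block diagonal. If one block is empty, [kernel_step] applies to the endomorphism or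
    to its complement. *)
Lemma split_step X : ~ null_mcx (mcx_of X) ->
  ~ cx_indecomposable (cx_of (mcx_of X)) -> splits_lt X.
Proof.
move=> nn dec; have [a1 [a0 [idem [nn1 nn2]]]] : exists a1 a0,
    @idem_endo A (mcx_of X) a1 a0 /\ ~ @null_endo A (mcx_of X) a1 a0 /\
    ~ @null_endo A (mcx_of X) (emat (gw1 X) - a1) (emat (gw0 X) - a0).
  apply: contrapT => no; apply: dec; apply: (indecomposable_criterion nn) => a1 a0 idem.
  apply: contrapT => /not_orP[n1 n2]; apply: no; exists a1, a0; split=> //.
have [c1 c0 comm [H [cH sq1 sq0]]] := idem.
have [b0 [l [G [G' [GP GX]]]]] := idem_exchange e_local c0.
have [cG cG' GG' G'G] := GP.
pose D := emat (subw (gw0 X) b0).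
(* Modulo the image of the differential, [a0] fixes its own rows and kills those of [1 - a0], so it
   acts on the basis [G] as the projection [D]; the error comes from the homotopy [H]. *)
have [T TE] : exists T : 'M[R]_(gdim X), G *m a0 = D *m G + T *m gM X.
  suff /fin_all_exists[t tE] : forall i, exists t : 'rV[R]_(gdim X),
      row i (G *m a0) = row i (D *m G) + t *m gM X.
    exists (\matrix_i t i); apply/row_matrixP => i.
    by rewrite tE linearD /= [row i (_ *m gM X)]row_mul rowK.
  move=> i; have rD : row i (D *m G) = if b0 i then row i G else 0.
    rewrite -[G in RHS](corner_l cG); apply/rowP => j.
    rewrite mxE mul_emat /subw; case: (b0 i); last by rewrite mul0r mxE.
    by rewrite mxE mul_emat.
  case wi: (gw0 X i) => [v|]; last first.
    exists 0; rewrite mul0mx addr0 rD row_mul (row_none (corner_l cG) wi) mul0mx.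
    by case: ifP.
  rewrite rD row_mul GX ?wi //; case: ifP => _.
    exists (row (l i) H); rewrite -!row_mul -[H *m _]sq0 linearB /= addrC subrK.
    by [].
  exists (- row (l i) H); rewrite add0r mulNmx -!row_mul -[H *m _]sq0 mulmxBl.
  by rewrite [idmx_val _ *m a0](corner_l c0) -linearN opprB.
(* [(y, Pi)] is [(a1, a0)] changed by the homotopy [G' *m T]. *)
pose Pi := G' *m D *m G; pose y := a1 - gM X *m G' *m T.
have MPi : gM X *m Pi = y *m gM X.
  have e1 : gM X *m a0 = gM X *m Pi + gM X *m G' *m (T *m gM X).
    rewrite -[a0 in LHS](corner_l c0) -[idmx_val (mE0 _)]G'G -[G' *m G *m a0]mulmxA TE.
    by rewrite mulmxDr mulmxDr /Pi !mulmxA.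
  by rewrite mulmxBl -[a1 *m _]comm /= e1 !mulmxA addrK.
pose y' := emat (gw1 X) *m y *m emat (gw1 X).
have cy : eid (gw1 X) *m y' *m eid (gw1 X) = y'.
  by rewrite /y' /= !mulmxA (ematK e_orth) -!mulmxA (ematK e_orth).
have yM : y' *m gM X = gM X *m Pi.
  by rewrite /y' -mulmxA gM_l -mulmxA -MPi mulmxA gM_l.
have [b1 [l1 [F [F' [FP FX]]]]] := idem_exchange e_local cy.
have [cF cF' FF' F'F] := FP.
have PiG : Pi *m G' = G' *m D.
  rewrite /Pi -mulmxA GG' -mulmxA; congr (_ *m _); exact: subw_l.
have DD : D *m D = D := ematK e_orth _.
have comm' : emat (subw (gw1 X) b1) *m (F *m gM X *m G') = (F *m gM X *m G') *m D.
  apply/row_matrixP => i.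
  have -> : row i (emat (subw (gw1 X) b1) *m (F *m gM X *m G')) =
      if b1 i then row i (F *m gM X *m G') else 0.
    have cFM : emat (gw1 X) *m (F *m gM X *m G') = F *m gM X *m G'.
      by rewrite !mulmxA [_ *m F](corner_l cF).
    rewrite -[in RHS]cFM; apply/rowP => j.
    rewrite mxE mul_emat /subw; case: (b1 i); last by rewrite mul0r mxE.
    by rewrite [RHS]mxE mul_emat.
  rewrite -!mulmxA row_mul; case wi: (gw1 X i) => [v|]; last first.
    by rewrite row_mul (row_none (corner_l cF) wi) !mul0mx; case: ifP.
  rewrite !(row_mul _ F) FX ?wi //; case: (b1 i); rewrite -!row_mul; last first.
    rewrite mulmxBl !mulmxA [emat _ *m gM X]gM_l yM -[gM X *m Pi *m G']mulmxA PiG mulmxA.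
    by rewrite -[_ *m D *m D]mulmxA DD subrr row0.
  by rewrite !mulmxA yM -[gM X *m Pi *m G']mulmxA PiG mulmxA -[_ *m D *m D]mulmxA DD.
have [X' [X'' [sp sz]]] := splits_by FP GP comm'.
have sumsz : gsize X = (gsize X' + gsize X'')%N by case: sp.
case: (posnP (gsize X')) => [z'|p']; last first.
  case: (posnP (gsize X'')) => [z''|p'']; last first.
    by exists X', X''; split=> //; lia.
  have fullD : D = emat (gw0 X).
    have : size_w (gw0 X) = size_w (subw (gw0 X) b0).
      have := size_subw (gw0 X) b0; have := size_subw (gw1 X) b1.
      by move: sumsz; rewrite sz z'' addn0 /gsize; lia.
    rewrite (size_subw _ b0) => /eqP; rewrite -[X in _ == X]addn0 eqn_add2l => /eqP/size_w0 none.
    by have := emat_none e none; rewrite subw_compl => /eqP; rewrite subr_eq0 => /eqP->.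
  have TG : emat (gw0 X) - a0 = - (G' *m T) *m gM X.
    have := congr1 (mulmx G') TE; rewrite mulmxA G'G [_ *m a0](corner_l c0) => ->.
    rewrite mulmxDr fullD [_ *m G](corner_l cG) G'G opprD addrA subrr sub0r.
    by rewrite mulNmx mulmxA.
  apply: (@kernel_step X (emat (gw1 X) - a1) (emat (gw0 X) - a0)
    (emat (gw0 X) *m (- (G' *m T)) *m emat (gw1 X))).
  - exact: idem_endo_compl.
  - by rewrite !mulmxA (ematK e_orth) -!mulmxA (ematK e_orth).
  - rewrite -mulmxA gM_l -mulmxA -TG mulmxBr (ematK e_orth); congr (_ - _).
    exact/esym/(corner_l c0).
  - exact: nn2.
  - by rewrite !subKr.
have zeroD : D = 0.
  have /size_w0 none : size_w (subw (gw0 X) b0) = 0%N by move: z'; rewrite sz; lia.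
  exact: emat_none.
have TG : a0 = (G' *m T) *m gM X.
  have := congr1 (mulmx G') TE; rewrite mulmxA G'G [_ *m a0](corner_l c0) => ->.
  by rewrite zeroD mul0mx add0r mulmxA.
apply: (@kernel_step X a1 a0 (emat (gw0 X) *m (G' *m T) *m emat (gw1 X)) idem) => //.
  by rewrite !mulmxA (ematK e_orth) -!mulmxA (ematK e_orth).
rewrite -mulmxA gM_l -mulmxA -TG; exact/esym/(corner_l c0).
Qed.

Theorem decompose X : exists k (L : 'I_k -> gcx),
  [/\ forall l, cx_indecomposable (cx_of (mcx_of (L l))),
      gvec X = \sum_l gvec (L l),
      forall Y, ext_mx (mcx_of X) Y -> forall l, ext_mx (mcx_of (L l)) Y &
      forall Y, ext_mx Y (mcx_of X) -> forall l, ext_mx Y (mcx_of (L l))].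
Proof.
have [s] := ubnP (gsize X); elim: s X => // s IHs X; rewrite ltnS => leX.
have [nul|nn] := pselect (null_mcx (mcx_of X)).
  exists 0%N, (fun=> X); split; first by case.
  - by rewrite big_ord0 null_gvec.
  - by move=> Y _ [].
  - by move=> Y _ [].
have [ind|dec] := pselect (cx_indecomposable (cx_of (mcx_of X))).
  by exists 1%N, (fun=> X); split=> //; rewrite big_ord1.
have [X' [X'' [[gv _ el er] lt' lt'']]] := split_step nn dec.
have [k' [L' [ind' g' el' er']]] := IHs X' (leq_trans lt' leX).
have [k'' [L'' [ind'' g'' el'' er'']]] := IHs X'' (leq_trans lt'' leX).
exists (k' + k'')%N, (fun l => match fintype.split l with inl i => L' i | inr i => L'' i end).
split.
- by move=> l; case: fintype.split.
- rewrite gv g' g'' big_split_ord /=; congr (_ + _); apply: eq_bigr => i _.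
    by rewrite (unsplitK (inl i)).
  by rewrite (unsplitK (inr i)).
- by move=> Y /el[e1 e2] l; case: fintype.split => i; [apply: el' | apply: el''].
- by move=> Y /er[e1 e2] l; case: fintype.split => i; [apply: er' | apply: er''].
Qed.
End Decomposition.

(** * Cones of rigid complexes *)

Section ModuleSums.
Variable A : pzRingType.
Local Notation rmod := (lmodType A^c).
Local Notation msum := (@mod_sum A).

Lemma mkpairE (M N K : rmod) (f : {linear K -> M}) (g : {linear K -> N}) x :
  mkpair f g x = (f x, g x).
Proof. by []. Qed.

Lemma mod_sum_zerol (M : rmod) : mod_iso (msum (mod_zero A) M) M.
Proof.
apply: (@can_mod_iso _ _ _ (proj2 (mod_zero A) M) (fun x => (0, x))) => //.
by move=> [z x] /=; rewrite (thinmx0 z).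
Qed.

Lemma mod_sumA (M N K : rmod) : mod_iso (msum M (msum N K)) (msum (msum M N) K).
Proof.
apply: (@can_mod_iso _ _ _ (mkpair
   (mkpair (proj1 M (msum N K)) (proj1 N K \o proj2 M (msum N K)))
   (proj2 N K \o proj2 M (msum N K))) (fun x => (x.1.1, (x.1.2, x.2)))).
  by move=> [x [y z]].
by move=> [[x y] z].
Qed.

Lemma mod_sum_swap (M N K : rmod) : mod_iso (msum M (msum N K)) (msum N (msum M K)).
Proof.
apply: (@can_mod_iso _ _ _ (mkpair (proj1 N K \o proj2 M (msum N K))
   (mkpair (proj1 M (msum N K)) (proj2 N K \o proj2 M (msum N K))))
   (fun x => (x.2.1, (x.1, x.2.2)))).
  by move=> [x [y z]].
by move=> [x [y z]].
Qed.

Lemma big_mod_iso n (F G : 'I_n -> rmod) : (forall i, mod_iso (F i) (G i)) ->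
  mod_iso (\big[msum/mod_zero A]_(i < n) F i) (\big[msum/mod_zero A]_(i < n) G i).
Proof.
elim: n F G => [|n IHn] F G FG; first by rewrite !big_ord0; apply: mod_iso_refl.
by rewrite !big_ord_recl; apply: mod_iso_sum => //; apply: IHn.
Qed.

Lemma big_mod_iso_add n (F F' : 'I_n -> rmod) (M : rmod) v :
  mod_iso (F' v) (msum M (F v)) -> (forall i, i != v -> mod_iso (F' i) (F i)) ->
  mod_iso (\big[msum/mod_zero A]_(i < n) F' i)
    (msum M (\big[msum/mod_zero A]_(i < n) F i)).
Proof.
elim: n F F' v => [|n IHn] F F' v Fv FF; first by case: v Fv FF.
rewrite !big_ord_recl; case: (unliftP ord0 v) Fv FF => [v'|] -> Fv FF.
  apply: mod_iso_trans (mod_sum_swap _ _ _); apply: mod_iso_sum; first exact: FF.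
  by apply: (IHn _ _ v') => // i ne; apply: FF; rewrite (inj_eq lift_inj).
apply: mod_iso_trans (mod_iso_sym (mod_sumA _ _ _)).
by apply: mod_iso_sum => //; apply: big_mod_iso => i; apply: FF.
Qed.
End ModuleSums.

(** * Basic presilting complexes *)

Section BasicSum.
Variable A : pzRingType.
Implicit Types C D : complex A.
Local Notation csum := (@cx_sum A).
Local Notation czero := (cx_zero A).

Lemma bounded_proj_sum C D : bounded_proj C -> bounded_proj D -> bounded_proj (csum C D).
Proof.
move=> [pC [N zC]] [pD [M zD]]; split=> [i|]; first exact: fg_projective_sum.
exists (maxn N M) => i; rewrite gtn_max => /andP[ltN ltM].
by apply: is_zero_mod_sum; [apply: zC | apply: zD].
Qed.

Lemma mod_zero_is_zero : is_zero_mod (mod_zero A).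
Proof. by move=> x; apply: thinmx0. Qed.

Lemma two_term_sum C D : two_term C -> two_term D -> two_term (csum C D).
Proof.
move=> [bC zC] [bD zD]; split=> [|i n0 n1]; first exact: bounded_proj_sum.
by apply: is_zero_mod_sum; [apply: zC | apply: zD].
Qed.

Lemma two_term_zero : two_term czero.
Proof.
have z i : is_zero_mod (czero i) by apply: mod_zero_is_zero.
split=> //; split; last by exists 0%N => i _; apply: z.
by move=> i; apply: fg_projective_zero.
Qed.

Lemma two_term_cx_of (X : mcx A) : two_term (cx_of X).
Proof.
split; last exact: cx_of_zero.
split=> [[[|i]|[|i]]|]; try exact: fg_projective_fmod.
- by apply: fg_projective_zero; apply: cx_of_zero.
- by apply: fg_projective_zero; apply: cx_of_zero.
by exists 1%N => i lti; apply: cx_of_zero; lia.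
Qed.

Lemma big_summand r (F : 'I_r -> complex A) j : (forall i, bounded_proj (F i)) ->
  exists2 Y, bounded_proj Y & hiso (\big[csum/czero]_(i < r) F i) (csum (F j) Y).
Proof.
have bz := two_term_zero.1.
elim: r F j => [|r IHr] F j bF; first by case: j.
have bF' i : bounded_proj (F (lift ord0 i)) by [].
rewrite big_ord_recl; case: (unliftP ord0 j) => [j'|] ->; last first.
  exists (\big[csum/czero]_(i < r) F (lift ord0 i)); last exact: hiso_refl.
  by apply: (@big_ind _ (@bounded_proj A)) => // *; apply: bounded_proj_sum.
have [Y bY isoY] := IHr _ j' bF'; exists (csum (F ord0) Y).
  exact: bounded_proj_sum.
apply: hiso_trans (hiso_sum_swap _ _ _); apply: hiso_sum isoY; exact: hiso_refl.
Qed.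

Lemma basic_of_family k (L : 'I_k -> complex A) :
  (forall l, two_term (L l)) -> (forall l, cx_indecomposable (L l)) ->
  (forall l l', ext_zero (L l) (L l')) ->
  exists C, [/\ two_term C, presilting C, basic_cx C &
    forall l, direct_summand (L l) C].
Proof.
move=> tL iL eL.
(* The first member of each homotopy class is kept, which makes the sum basic. *)
pose B := [set l : 'I_k | `[< forall l' : 'I_k, (l' < l)%N -> ~ hiso (L l') (L l) >]]%SET.
have rep l : exists2 j, j \in B & hiso (L l) (L j).
  have [s] := ubnP (l : nat); elim: s l => // s IHs l; rewrite ltnS => les.
  have [lB|] := boolP (l \in B); first by exists l => //; apply: hiso_refl.
  rewrite inE => /asboolP/existsNP[l' /not_implyP[ltl /contrapT iso]].
  have [j jB isoj] := IHs l' (leq_trans ltl les); exists j => //.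
  exact: hiso_trans (hiso_sym iso) isoj.
pose F (i : 'I_#|B|) := L (enum_val i).
exists (\big[csum/czero]_(i < #|B|) F i); split.
- apply: (@big_ind _ (@two_term A)) => [|C D|i _]; [exact: two_term_zero | exact: two_term_sum | exact: tL].
- suff : ext_zero (\big[csum/czero]_(i < #|B|) F i) (\big[csum/czero]_(i < #|B|) F i) by [].
  apply: (@big_ind _ (fun C => ext_zero C _)) => [|C D|i _].
  + exact: ext_zero_zerol.
  + exact: ext_zero_suml.
  apply: (@big_ind _ (fun C => ext_zero _ C)) => [|C D|j _].
  + exact: ext_zero_zeror.
  + exact: ext_zero_sumr.
  exact: eL.
- exists #|B|, F; split=> [j|i j iso|]; last exact: hiso_refl.
    by split; [exact: (tL _).1 | exact: iL].
  apply: enum_val_inj; apply: val_inj.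
  have := enum_valP i; have := enum_valP j; rewrite !inE => /asboolP Bj /asboolP Bi.
  by case: (ltngtP (val (enum_val i)) (val (enum_val j))) => // [/Bj|/Bi] [] //; apply: hiso_sym.
move=> l; split; first exact: (tL l).1.
have [j jB iso] := rep l.
have [|Y bY isoY] := @big_summand _ F (enum_rank_in jB j).
  by move=> i; apply: (tL _).1.
exists Y => //; apply: hiso_trans isoY _; apply: hiso_sum (hiso_refl _).
by rewrite /F enum_rankK_in //; apply: hiso_sym.
Qed.
End BasicSum.

(** * Projective modules, g-vectors and the fan *)

Section Fan.
Variables (A : pzRingType) (n : nat) (e : 'I_n -> A^c).
Local Notation R := (A^c).
Hypothesis e_orth : forall i j, e i * e j = if i == j then e i else 0.
Hypothesis e_neq0 : forall i, e i != 0.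
Hypothesis e_sum : \sum_i e i = 1.
Hypothesis e_local : forall v m (u : 'I_m -> option 'I_n) (c y : 'I_m -> R),
  (forall l, e v * c l * eo e (u l) = c l) ->
  (forall l, eo e (u l) * y l * e v = y l) ->
  \sum_l c l * y l = e v ->
  exists l z, [/\ u l = Some v, e v * z * e v = z, z * y l = e v & y l * z = e v].
Local Notation emat := (emat e).
Local Notation eid := (eid e_orth).
Local Notation msum := (@mod_sum A).

Definition line (o : option 'I_n) : lmodType A^c := fmod (eid (fun _ : 'I_1 => o)).
Definition proj_mod (v : 'I_n) : lmodType A^c := line (Some v).

Lemma fmod_entryE r (w : 'I_r -> option 'I_n) (x : fmod (eid w)) j :
  val x 0 j * eo e (w j) = val x 0 j.
Proof. by rewrite -[in RHS](fmodP x) mulmx_emat. Qed.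

Lemma fmod_eq r (w : 'I_r -> option 'I_n) (x y : fmod (eid w)) :
  (forall j, val x 0 j = val y 0 j) -> x = y.
Proof. by move=> xy; apply: val_inj; apply/rowP. Qed.

Lemma tofmod_entry r (w : 'I_r -> option 'I_n) (x : 'rV[R]_r) j :
  val (tofmod (idmxK (eid w)) x) 0 j = x 0 j * eo e (w j).
Proof. by rewrite val_tofmod mulmx_emat. Qed.

Lemma fmap_entry r s (w : 'I_r -> option 'I_n) (u : 'I_s -> option 'I_n) M
    (x : fmod (eid w)) j :
  val (fmap (eid w) (eid u) M x) 0 j = (val x *m M) 0 j * eo e (u j).
Proof. by rewrite [fmap _ _ _ _]/(tofmod _ _) tofmod_entry. Qed.

Lemma fmod_recl r (w : 'I_r.+1 -> option 'I_n) :
  mod_iso (fmod (eid w)) (msum (line (w ord0)) (fmod (eid (fun i => w (lift ord0 i))))).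
Proof.
pose S1 : 'M[R]_(r.+1, 1) := \matrix_(i, j) (i == ord0)%:R.
pose S2 : 'M[R]_(r.+1, r) := \matrix_(i, j) (i == lift ord0 j)%:R.
have xS1 (x : 'rV[R]_r.+1) j : (x *m S1) 0 j = x 0 ord0.
  rewrite mxE (bigD1 ord0) //= mxE eqxx mulr1 big1 ?addr0 // => k ne.
  by rewrite mxE (negbTE ne) mulr0.
have xS2 (x : 'rV[R]_r.+1) j : (x *m S2) 0 j = x 0 (lift ord0 j).
  rewrite mxE (bigD1 (lift ord0 j)) //= mxE eqxx mulr1 big1 ?addr0 // => k ne.
  by rewrite mxE (negbTE ne) mulr0.
pose F1 := fmap (eid w) (eid (fun _ : 'I_1 => w ord0)) S1.
pose F2 := fmap (eid w) (eid (fun i => w (lift ord0 i))) S2.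
pose g (p : msum (line (w ord0)) (fmod (eid (fun i => w (lift ord0 i))))) : fmod (eid w) :=
  tofmod (idmxK (eid w)) (\row_i (if unlift ord0 i is Some j then val p.2 0 j else val p.1 0 0)).
have g0 p : val (g p) 0 ord0 = val p.1 0 0.
  by rewrite tofmod_entry mxE unlift_none; apply: fmod_entryE.
have g1 p j : val (g p) 0 (lift ord0 j) = val p.2 0 j.
  by rewrite tofmod_entry mxE liftK; apply: fmod_entryE.
apply: (@can_mod_iso _ _ _ (mkpair F1 F2) g).
  move=> x; apply: fmod_eq => i; rewrite mkpairE.
  case: (unliftP ord0 i) => [j|] ->; first by rewrite g1 fmap_entry xS2 fmod_entryE.
  by rewrite g0 fmap_entry xS1 fmod_entryE.
move=> [x y]; rewrite mkpairE; congr (_, _); apply: fmod_eq => j.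
  by rewrite fmap_entry xS1 g0 (ord1 j); apply: fmod_entryE.
by rewrite fmap_entry xS2 g1; apply: fmod_entryE.
Qed.

Lemma fmod_big r (w : 'I_r -> option 'I_n) :
  mod_iso (fmod (eid w)) (\big[msum/mod_zero A]_(i < r) line (w i)).
Proof.
elim: r w => [|r IHr] w.
  rewrite big_ord0; apply: (@can_mod_iso _ _ _ \0 (fun=> 0)) => x.
    by apply: val_inj; rewrite [LHS]thinmx0 [RHS]thinmx0.
  by rewrite [LHS]thinmx0 [RHS]thinmx0.
rewrite big_ord_recl; apply: mod_iso_trans (fmod_recl w) _.
by apply: mod_iso_sum; [apply: mod_iso_refl | apply: IHr].
Qed.

Lemma fmod_multiplicities r (w : 'I_r -> option 'I_n) :
  has_multiplicities proj_mod (fmod (eid w)) (count_w w).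
Proof.
rewrite /has_multiplicities; apply: mod_iso_trans (fmod_big w) _.
elim: r w => [|r IHr] w.
  rewrite big_ord0 (eq_bigr (fun=> mod_zero A)) => [|i _]; last first.
    by rewrite /count_w big_ord0 big_ord0.
  elim: (n) => [|k IHk]; first by rewrite big_ord0; apply: mod_iso_refl.
  rewrite big_ord_recl; apply: mod_iso_trans IHk _.
  exact/mod_iso_sym/mod_sum_zerol.
rewrite big_ord_recl.
apply: mod_iso_trans (mod_iso_sum (mod_iso_refl _) (IHr (fun i => w (lift ord0 i)))) _.
have cnt v : count_w w v = ((w ord0 == Some v) + count_w (fun i => w (lift ord0 i)) v)%N.
  by rewrite /count_w big_ord_recl.
case w0: (w ord0) cnt => [v|] cnt; last first.
  rewrite (_ : count_w w = count_w (fun i => w (lift ord0 i))); last exact/funext.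
  apply: mod_iso_trans (mod_sum_zerol _); apply: mod_iso_sum; last exact: mod_iso_refl.
  apply: (@can_mod_iso _ _ _ \0 (fun=> 0)) => x; last by rewrite [LHS]thinmx0 [RHS]thinmx0.
  apply: val_inj; rewrite -[RHS]fmodP; apply/rowP => j.
  by rewrite [RHS]mulmx_emat mulr0 [LHS]mxE.
apply: mod_iso_sym; apply: (@big_mod_iso_add _ _ _ _ _ v) => [|i ne].
  by rewrite [count_w w v]cnt eqxx big_ord_recl; apply: mod_iso_refl.
rewrite [count_w w i]cnt (inj_eq Some_inj) eq_sym (negbTE ne).
exact: mod_iso_refl.
Qed.

Lemma line_entry (o : option 'I_n) (x : line o) : val x 0 0 * eo e o = val x 0 0.
Proof. exact: fmod_entryE. Qed.

Lemma regular_proj_mod : mod_iso (regular_mod A) (\big[msum/mod_zero A]_(i < n) proj_mod i).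
Proof.
apply: mod_iso_trans (fmod_big (fun i => Some i)).
pose f (x : (A^c)^o) : fmod (eid (fun i => Some i)) := tofmod (idmxK (eid _)) (\row_i (x : R)).
have f_entry x j : val (f x) 0 j = (x : R) * e j by rewrite tofmod_entry mxE.
have flin : linear f.
  move=> a x y; apply: fmod_eq => j.
  transitivity (a * val (f x) 0 j + val (f y) 0 j); last first.
    by rewrite [val (a *: _ + _)]linearP [RHS]mxE [X in _ = X + _]mxE.
  by rewrite [LHS]f_entry !f_entry mulrDl mulrA.
pose fl := GRing.isLinear.Build A^c _ _ *:%R f flin.
pose F : {linear (A^c)^o -> fmod (eid (fun i => Some i))} := HB.pack f fl.
pose g (y : fmod (eid (fun i => Some i))) : (A^c)^o := \sum_i val y 0 i.
apply: (@can_mod_iso _ _ _ F g) => [x|y].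
  rewrite /g (eq_bigr (fun j => (x : R) * e j)) => [|j _]; last exact: f_entry.
  by rewrite -mulr_sumr e_sum mulr1.
apply: fmod_eq => j; rewrite f_entry mulr_suml (bigD1 j) //= big1 ?addr0 => [|i ne].
  exact: fmod_entryE.
by rewrite -(fmod_entryE y) /= -mulrA e_orth (negbTE ne) mulr0.
Qed.

Lemma line_map o o' (f : {linear line o -> line o'}) : exists x,
  [/\ eo e o * x = x, x * eo e o' = x & forall y, val (f y) 0 0 = val y 0 0 * x].
Proof.
have [M cM fM] := fmap_full f.
have Ml := corner_l cM; have Mr := corner_r cM.
exists (M 0 0); split.
- by rewrite -[M in RHS]Ml mul_emat.
- by rewrite -[M in RHS]Mr mulmx_emat.
by move=> y; rewrite fM val_fmap // mxE big_ord1.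
Qed.

Definition line_gen v : proj_mod v := tofmod (idmxK (eid _)) (const_mx (e v)).

Lemma line_genE v : val (line_gen v) 0 0 = e v.
Proof. by rewrite tofmod_entry mxE /= e_orth eqxx. Qed.

(** The projection to one summand is multiplication by an idempotent of the local corner at [v]. *)
Lemma proj_mod_indecomposable v : mod_indecomposable (proj_mod v).
Proof.
split=> [z|X Y [f [g fg gf]]].
  have := congr1 (fun x : proj_mod v => val x 0 0) (z (line_gen v)).
  by rewrite line_genE [RHS]mxE => /eqP; rewrite (negbTE (e_neq0 v)).
have glin : linear g by move=> a x y; apply: (can_inj fg); rewrite linearP !gf.
pose gl := GRing.isLinear.Build A^c _ _ *:%R g glin.
pose G : {linear msum X Y -> proj_mod v} := HB.pack g gl.
have GE y : G y = g y by [].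
pose p : {linear proj_mod v -> proj_mod v} := G \o mkpair (proj1 X Y \o f) \0.
have [x [ex xe px]] := line_map p.
have pE y : p y = g ((f y).1, 0) by [].
have pp : x * x = x.
  have pK : p (p (line_gen v)) = p (line_gen v) by rewrite !pE gf.
  by have := congr1 (fun y : proj_mod v => val y 0 0) pK; rewrite !px line_genE ex.
have eqv (a b : proj_mod v) : val a 0 0 = val b 0 0 -> a = b.
  by move=> ab; apply: fmod_eq => j; rewrite (ord1 j).
have [x0|x1] := local_idempotent e_orth e_local ex xe pp; [left=> a|right=> b].
  have p0 : p (g (a, 0)) = 0 by apply: eqv; rewrite px x0 mulr0 [RHS]mxE.
  have := congr1 f p0; rewrite pE !gf linear0; by case.
have p1 : p (g (0, b)) = g (0, b).
  by apply: eqv; rewrite px x1; apply: line_entry.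
by have := congr1 f p1; rewrite pE !gf; case.
Qed.

(** An isomorphism factors [e i] through [e j], which [e_local] allows only when [i = j]. *)
Lemma proj_mod_inj i j : mod_iso (proj_mod i) (proj_mod j) -> i = j.
Proof.
move=> [f [g fg gf]].
have glin : linear g by move=> a x y; apply: (can_inj fg); rewrite linearP !gf.
pose gl := GRing.isLinear.Build A^c _ _ *:%R g glin.
pose G : {linear proj_mod j -> proj_mod i} := HB.pack g gl.
have [x [ex xe fx]] := line_map f; have [y [ey ye gy]] := line_map G.
have xy : x * y = e i.
  have := congr1 (fun y : proj_mod i => val y 0 0) (fg (line_gen i)).
  by rewrite [val (g _)]/(val (G _)) gy fx line_genE ex.
have [|||l [z []]] := @e_local i 1 (fun=> Some j) (fun=> x) (fun=> y).
- by move=> _; rewrite ex xe.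
- by move=> _; rewrite ey ye.
- by rewrite big_ord1.
by case.
Qed.

Lemma proj_mod_basic : basic_decomposition proj_mod.
Proof.
split; [exact: proj_mod_indecomposable | exact: proj_mod_inj | exact: regular_proj_mod].
Qed.

Implicit Types X : gcx e_orth.

Lemma gvec_is_gvector X : is_gvector proj_mod (cx_of (mcx_of X)) (gvec X).
Proof.
exists (count_w (@gw0 _ _ _ _ X)), (count_w (@gw1 _ _ _ _ X)); split=> //.
  exact: fmod_multiplicities.
exact: fmod_multiplicities.
Qed.

(** The g-vector is the sum of those of the indecomposable summands, so its multiple by [c] is the
    point of their cone with all coefficients equal to [c]. *)
Theorem rigid_in_gfan (K : realType) X (c : K) :
  ext_mx (mcx_of X) (mcx_of X) -> 0 <= c ->
  gfan_support proj_mod (c *: map_mx intr (gvec X)).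
Proof.
move=> ext c0; have [k [L [ind gE el er]]] := decompose e_neq0 e_local X.
have [C [tC pC bC dC]] : exists C, [/\ two_term C, presilting C, basic_cx C &
    forall l, direct_summand (cx_of (mcx_of (L l))) C].
  apply: basic_of_family => [l|l|l l'] //; first exact: two_term_cx_of.
  by apply: ext_zero_cx_of; apply: er; apply: el.
exists (gcone proj_mod C); first by exists C.
exists k, (fun l => cx_of (mcx_of (L l))), (fun l => gvec (L l)), (fun=> c); split.
  by move=> l; split=> //; [exact: two_term_cx_of | exact: gvec_is_gvector].
by rewrite gE raddf_sum scaler_sumr.
Qed.
End Fan.

(** * The completed path algebra *)

Section PathSeries.
Variables (k : fieldType) (Q : quiver).
Local Notation kQhat := (cpath_alg k Q).
Local Notation path := (qpath Q).
Local Notation pelt := (path_elt k).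
Local Notation V := (vertex Q).
Implicit Types (F G : kQhat) (p q r : path) (a b : arrow Q) (v w : V).

Definition pstart p : V := (val p).1.
Definition pend p : V := walk_end (val p).1 (val p).2.
Definition vert v : kQhat := pelt (trivial_path v).

Lemma cpaE F G p :
  (F * G) p = \sum_(i < (plen p).+1) F (take_path i p) * G (drop_path i p).
Proof. by []. Qed.

Lemma cpaD F G p : (F + G) p = F p + G p.
Proof. by []. Qed.

Lemma cpa1 p : (1 : kQhat) p = (plen p == 0%N)%:R.
Proof. by []. Qed.

Lemma cpaN F p : (- F) p = - F p.
Proof. by []. Qed.

Lemma cpa_sum (T : Type) (s : seq T) (P : pred T) (F : T -> kQhat) p :
  (\sum_(i <- s | P i) F i) p = \sum_(i <- s | P i) F i p.
Proof. by elim/big_rec2: _ => // i y x _ <-. Qed.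

Lemma mul_pelt r G p :
  (pelt r * G) p = if take_path (plen r) p == r then G (drop_path (plen r) p) else 0.
Proof.
rewrite cpaE; have [ler|ltr] := leqP (plen r) (plen p); last first.
  rewrite big1 => [|i _]; last first.
    rewrite /path_elt; case: eqP => [e|_]; last by rewrite mul0r.
    by have := plen_take_le i p; rewrite e leqNgt ltr.
  case: eqP => // e; have := plen_take_le (plen r) p.
  by rewrite {1}e leqNgt ltr.
pose j : 'I_(plen p).+1 := Ordinal (ler : (plen r < (plen p).+1)%N).
rewrite (bigD1 j) //= big1 ?addr0 => [|i ne].
  by rewrite /path_elt /=; case: eqP => _; rewrite ?mul1r ?mul0r.
rewrite /path_elt; case: eqP => [e|_]; last by rewrite mul0r.
by case/eqP: ne; apply: val_inj; rewrite /= -e plen_take // -ltnS.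
Qed.

Lemma pelt_mul r G p : (G * pelt r) p =
  if drop_path (plen p - plen r) p == r then G (take_path (plen p - plen r) p) else 0.
Proof.
rewrite cpaE; set n := (plen p - plen r)%N.
have ltn : (n < (plen p).+1)%N by rewrite ltnS leq_subr.
rewrite (bigD1 (Ordinal ltn)) //= big1 ?addr0 => [|i ne].
  by rewrite /path_elt /=; case: eqP => _; rewrite ?mulr1 ?mulr0.
rewrite /path_elt; case: eqP => [e|_]; last by rewrite mulr0.
case/eqP: ne; apply: val_inj; rewrite /= /n -e plen_drop subKn //.
by rewrite -ltnS.
Qed.

Lemma drop_plen_path p : drop_path (plen p) p = trivial_path (pend p).
Proof.
by apply: qpath_inj; rewrite /= ?take_size ?drop_size.
Qed.

Lemma trivial_path_eq v w : (trivial_path v == trivial_path w) = (v == w).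
Proof. by apply/eqP/eqP => [[]|->]. Qed.

Lemma vert_mul v G p : (vert v * G) p = if pstart p == v then G p else 0.
Proof. by rewrite mul_pelt take0_path drop0_path trivial_path_eq. Qed.

Lemma mul_vert v G p : (G * vert v) p = if pend p == v then G p else 0.
Proof. by rewrite pelt_mul subn0 drop_plen_path take_plen_path trivial_path_eq. Qed.

Lemma vert_orth v w : vert v * vert w = if v == w then vert v else 0.
Proof.
apply/funext => p; rewrite vert_mul; case: (eqVneq v w) => [->|ne].
  rewrite /vert /path_elt /pstart; case: eqP => // ne.
  by case: eqP => // e; case: ne; rewrite e.
case: eqP => // e; rewrite /vert /path_elt; case: eqP => // e'.
by move: ne; rewrite -e /pstart e' eqxx.
Qed.

Lemma vert_sum : \sum_v vert v = 1.
Proof.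
apply/funext => p; rewrite cpa_sum cpa1; have [p0|p1] := eqVneq (plen p) 0%N.
  rewrite (bigD1 (pstart p)) //= big1 ?addr0 => [|v ne].
    by rewrite /vert /path_elt -plen0_path // eqxx.
  rewrite /vert /path_elt; case: eqP => // e.
  by move: ne; rewrite /pstart e eqxx.
rewrite big1 // => v _; rewrite /vert /path_elt; case: eqP => // e.
by move: p1; rewrite e.
Qed.

Definition cst (c : k) : kQhat := fun p => if plen p == 0%N then c else 0.

Lemma cst_mul c G p : (cst c * G) p = c * G p.
Proof.
rewrite cpaE big_ord_recl /= drop0_path /cst plen_take // eqxx big1 ?addr0 // => i _.
by rewrite plen_take ?mul0r // lift0 ltn_ord.
Qed.

Lemma mul_cst c G p : (G * cst c) p = G p * c.
Proof.
rewrite cpaE big_ord_recr /= take_plen_path /cst plen_drop subnn eqxx big1 ?add0r // => i _.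
by rewrite plen_drop subn_eq0 leqNgt ltn_ord mulr0.
Qed.

Lemma cst_central c G : cst c * G = G * cst c.
Proof. by apply/funext => p; rewrite cst_mul mul_cst mulrC. Qed.

Lemma trivial_coef F G v :
  (F * G) (trivial_path v) = F (trivial_path v) * G (trivial_path v).
Proof. by rewrite cpaE big_ord1; congr (F _ * G _); apply: qpath_inj. Qed.

Lemma exp_low F i p : (forall v, F (trivial_path v) = 0) -> (plen p < i)%N -> (F ^+ i) p = 0.
Proof.
move=> F0; elim: i p => // i IHi p ltp; rewrite exprS cpaE big1 // => -[j /= ltj] _.
have [->|j0] := posnP j; first by rewrite take0_path F0 mul0r.
by rewrite IHi ?mulr0 // plen_drop; lia.
Qed.

(** The geometric series in [1 - F]: at a path [p] only the powers up to the length of [p]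
    contribute. *)
Lemma unit_inverse F : (forall v, F (trivial_path v) = 1) ->
  exists G, F * G = 1 /\ G * F = 1.
Proof.
move=> F1; pose N : kQhat := 1 - F.
have N0 v : N (trivial_path v) = 0 by rewrite /N cpaD cpaN F1 cpa1 /= subrr.
pose S n : kQhat := \sum_(i < n) N ^+ i.
pose G : kQhat := fun p => S (plen p).+1 p.
have GS n p : (plen p < n)%N -> G p = S n p.
  move=> ltp; rewrite /G /S -(subnKC ltp) big_split_ord /= cpaD [X in _ + X](_ : _ = 0) ?addr0 //.
  by rewrite cpa_sum big1 // => i _; rewrite exp_low // ltn_addr.
have FN : F = 1 - N by rewrite subKr.
have FS n : F * S n = 1 - N ^+ n.
  by rewrite -[RHS]opprB subrX1 -mulNr opprB -FN.
have SF n : S n * F = 1 - N ^+ n.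
  rewrite -FS FN mulrBl mulrBr mul1r mulr1; congr (_ - _).
  by rewrite mulr_suml mulr_sumr; apply: eq_bigr => i _; rewrite -exprSr exprS.
have low n p : (plen p < n)%N -> (1 - N ^+ n) p = (1 : kQhat) p.
  by move=> ltp; rewrite cpaD cpaN exp_low // subr0.
exists G; split; apply/funext => p; rewrite -(low (plen p).+1) //.
  by rewrite -FS; apply: (@cpa_mul_trunc _ _ _ _ _ _ (plen p).+1) => // q; apply: GS.
by rewrite -SF; apply: (@cpa_mul_trunc _ _ _ _ _ _ (plen p).+1) => // q; apply: GS.
Qed.

(** After scaling, adding [1 - vert v] makes all constant terms equal to 1; the inverse in the full
    algebra is then cut back to the corner. *)
Lemma corner_inverse v F : vert v * F * vert v = F -> F (trivial_path v) != 0 ->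
  exists Z, [/\ vert v * Z * vert v = Z, F * Z = vert v & Z * F = vert v].
Proof.
move=> cF F0; pose c := (F (trivial_path v))^-1; pose f := cst c * F + (1 - vert v).
have vv : vert v * vert v = vert v by rewrite vert_orth eqxx.
have vF : vert v * F = F by rewrite -cF !mulrA vv.
have Fv : F * vert v = F by rewrite -cF -!mulrA vv.
have [w|G [fG Gf]] := @unit_inverse f.
  rewrite /f cpaD cst_mul !cpaD cpa1 cpaN -[F]vF vert_mul /= /vert /path_elt trivial_path_eq.
  rewrite /pstart /=; case: eqP => [->|_]; last by rewrite mulr0 add0r subr0.
  by rewrite subrr addr0 mulVf.
have vf : vert v * f = cst c * F.
  by rewrite mulrDr mulrBr mulr1 vv subrr addr0 mulrA -cst_central -mulrA vF.
have fv : f * vert v = cst c * F.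
  by rewrite mulrDl mulrBl mul1r vv subrr addr0 -mulrA Fv.
have vG : vert v * G = G * vert v.
  by rewrite -[LHS]mul1r -Gf -mulrA (mulrA f) fv -vf -!mulrA fG mulr1.
exists (cst c * (vert v * G)); split.
- by rewrite mulrA -cst_central -!mulrA -vG; do 2!rewrite (mulrA (vert v) (vert v)) vv.
- by rewrite mulrA -cst_central -(mulrA _ F) (mulrA F) Fv mulrA -vf -mulrA fG mulr1.
by rewrite vG -!mulrA vF mulrA cst_central -mulrA -vf mulrA -vG -mulrA Gf mulr1.
Qed.

(** Being 0 on words that are not paths, it can be used without proofs of composability. *)
Definition coef F v (s : seq (arrow Q)) : k :=
  if insub (v, s) is Some p then F p else 0.

Lemma coefE F p : coef F (val p).1 (val p).2 = F p.
Proof. by rewrite /coef -surjective_pairing valK. Qed.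

Definition arr a : kQhat := arrow_elt k a.

(** Left division by an arrow. For a trivial [p] the word [[:: a]] does not remember the vertex,
    hence the test on [pstart p]. *)
Definition lquo a F : kQhat := fun p =>
  if pstart p == tgt a then coef F (src a) (a :: (val p).2) else 0.

Definition rquo a F : kQhat := fun p =>
  if pend p == src a then coef F (val p).1 (rcons (val p).2 a) else 0.

Lemma composable_rcons v s a :
  composable v (rcons s a) = composable v s && (walk_end v s == src a).
Proof. by rewrite -cats1 composable_cat /= andbT eq_sym. Qed.

Lemma arr_mul_cons a G v b s (c : composable v (b :: s)) (c' : composable (tgt b) s) :
  (arr a * G) (exist _ (v, b :: s) c) = if b == a then G (exist _ (tgt b, s) c') else 0.
Proof.
rewrite mul_pelt; have /= /andP[/eqP sb _] := c.
case: (eqVneq b a) => [ba|ne].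
  rewrite (_ : take_path _ _ == _); last first.
    by apply/eqP/qpath_inj; rewrite /= ?take0 -?ba.
  by congr G; apply: qpath_inj; rewrite /= ?take0 ?drop0.
by case: eqP => // /(congr1 (fun p => (val p).2)) /= [ba]; rewrite ba eqxx in ne.
Qed.

Lemma arr_mul_trivial a G v : (arr a * G) (trivial_path v) = 0.
Proof. by rewrite mul_pelt; case: eqP => // /(congr1 (fun p => (val p).2)). Qed.

Lemma mul_arr_rcons a G v b s (c : composable v (rcons s b)) (c' : composable v s) :
  (G * arr a) (exist _ (v, rcons s b) c) = if b == a then G (exist _ (v, s) c') else 0.
Proof.
rewrite pelt_mul; have := c; rewrite composable_rcons => /andP[_ /eqP sb].
have sz : (plen (exist _ (v, rcons s b) c : path) - plen (arrow_path a))%N = size s.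
  by rewrite /plen /= size_rcons subSS subn0.
rewrite sz; case: (eqVneq b a) => [ba|ne].
  rewrite (_ : drop_path _ _ == _); last first.
    apply/eqP/qpath_inj; rewrite /= -cats1 ?take_size_cat ?drop_size_cat //.
      by rewrite sb ba.
    by rewrite ba.
  by congr G; apply: qpath_inj; rewrite /= -?cats1 ?take_size_cat.
have dr : drop (size s) (rcons s b) = [:: b] by rewrite -cats1 drop_size_cat.
case: eqP => // /(congr1 (fun p => (val p).2)) /=.
by rewrite dr => -[ba]; rewrite ba eqxx in ne.
Qed.

Lemma mul_arr_trivial a G v : (G * arr a) (trivial_path v) = 0.
Proof. by rewrite pelt_mul; case: eqP => // /(congr1 (fun p => (val p).2)). Qed.

Lemma lquo_decomp F : (forall v, F (trivial_path v) = 0) ->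
  F = \sum_a arr a * lquo a F.
Proof.
move=> F0; apply/funext => -[[v [|b s]] c]; rewrite cpa_sum.
  rewrite (_ : exist _ (v, [::]) c = trivial_path v :> path); last exact: qpath_inj.
  by rewrite F0 big1 // => a _; rewrite arr_mul_trivial.
have /= /andP[/eqP sb c'] := c.
rewrite (bigD1 b) //= big1 ?addr0 => [|a ne]; last first.
  by rewrite (arr_mul_cons _ _ _ c') eq_sym (negbTE ne).
rewrite (arr_mul_cons _ _ _ c') eqxx /lquo /pstart /= eqxx -{1}(coefE F) /=.
by rewrite sb.
Qed.

Lemma rquo_decomp F : (forall v, F (trivial_path v) = 0) ->
  F = \sum_a rquo a F * arr a.
Proof.
move=> F0; apply/funext => -[[v s] c]; rewrite cpa_sum.
elim/last_ind: s c => [|s b _] c.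
  rewrite (_ : exist _ (v, [::]) c = trivial_path v :> path); last exact: qpath_inj.
  by rewrite F0 big1 // => a _; rewrite mul_arr_trivial.
have := c; rewrite composable_rcons => /andP[c' /eqP sb].
rewrite (bigD1 b) //= big1 ?addr0 => [|a ne]; last first.
  by rewrite (mul_arr_rcons _ _ _ c') eq_sym (negbTE ne).
by rewrite (mul_arr_rcons _ _ _ c') eqxx /rquo /pend /= sb eqxx -{1}(coefE F).
Qed.
End PathSeries.

(** * Sides of the arrows *)

(** Take a permutation with the most agreements: at a disagreement, composing with a transposition
    would mend one value and spoil none. *)
Lemma perm_extension (T U : finType) (f g : T -> U) : injective f -> injective g ->
  exists s : {perm U}, forall a, s (f a) = g a.
Proof.
move=> finj ginj; pose ok (s : {perm U}) := #|[set a | s (f a) == g a]%SET|.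
case: (@arg_maxnP _ (1%g : {perm U}) xpredT ok) => // s _ smax.
exists s => a; apply/eqP/negPn/negP => na.
have := smax (s * tperm (s (f a)) (g a))%g isT; rewrite /= leqNgt => /negP[].
apply: proper_card; apply/properP; split.
  apply/fintype.subsetP => b; rewrite !inE permM => /eqP sb; rewrite sb.
  rewrite tpermD // -?sb; last by rewrite sb (inj_eq ginj); apply: contraNneq na => ->; rewrite sb.
  by rewrite (inj_eq perm_inj) (inj_eq finj); apply: contraNneq na => ->; rewrite sb.
by exists a; rewrite !inE // permM tpermL.
Qed.

Section FibreLabel.
Variables (T U : finType) (f : T -> U).

Definition label a : bool := index a (enum [set b | f b == f a]%SET) == 0%N.

Lemma label_inj a b : (#|[set c | f c == f a]%SET| <= 2)%N ->
  f a = f b -> label a = label b -> a = b.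
Proof.
rewrite /label => le2 fab; rewrite -fab cardE in le2 *.
set s := enum _ in le2 *.
have as_ : a \in s by rewrite mem_enum inE.
have bs : b \in s by rewrite mem_enum inE fab.
have la := as_; have lb := bs; rewrite -index_mem in la; rewrite -index_mem in lb.
move=> lab; rewrite -(nth_index a as_) -(nth_index a bs); congr nth.
move: (size s) le2 (index a s) (index b s) la lb lab => n le2 [|[|i]] [|[|j]] //; lia.
Qed.
End FibreLabel.

Lemma two_of_fibre (T : finType) (S : {set T}) a b c : (#|S| <= 2)%N ->
  a \in S -> b \in S -> c \in S -> a != b -> c != b -> a = c.
Proof.
move=> le2 aS bS cS ab cb; apply/eqP/negPn/negP => ac.
have : [set a; b; c]%SET \subset S.
  by apply/fintype.subsetP => x; rewrite !inE => /orP[/orP[]|] /eqP->.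
move=> /subset_leq_card; rewrite leqNgt (leq_ltn_trans le2) //.
by rewrite cardsU cards2 cards1 ab (_ : _ :&: _ = finset.set0) ?cards0 //;
  apply/setP => x; rewrite !inE; case: eqP => [->|_]; rewrite ?(negbTE ac) //=;
  case: eqP => // ->; rewrite eq_sym (negbTE cb).
Qed.

Section Sides.
Variables (k : fieldType) (Q : quiver) (I : path_ideal k Q) (SB : special_biserial I).
Local Notation V := (vertex Q).
Implicit Types a b c : arrow Q.

Definition follows a b : bool :=
  (tgt a == src b) && `[< ~ in_path_ideal I (arrow_elt k a * arrow_elt k b) >].

Lemma followsE a b : follows a b ->
  tgt a = src b /\ ~ in_path_ideal I (arrow_elt k a * arrow_elt k b).
Proof. by move=> /andP[/eqP ? /asboolP]. Qed.

Lemma follows_right a b b' : follows a b -> follows a b' -> b = b'.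
Proof. by move=> /followsE[? ?] /followsE[? ?]; apply: (SB2 SB) (a) _ _ _ _ _ _. Qed.

Lemma follows_left a a' b : follows a b -> follows a' b -> a = a'.
Proof. by move=> /followsE[? ?] /followsE[? ?]; apply: (SB3 SB) (b) _ _ _ _ _ _. Qed.

Definition side_out a : V * bool := (src a, label (@src Q) a).

(** [a] enters by the side from which its successor leaves; without a successor, by the side
    opposite to that of the other arrow ending there; if neither has one, the label separates
    them. *)
Definition side_in a : V * bool := (tgt a,
  if [pick b | follows a b] is Some b then (side_out b).2
  else if [pick b | [exists a', [&& a' != a, tgt a' == tgt a & follows a' b]]]
    is Some b then ~~ (side_out b).2 else label (@tgt Q) a).

Lemma side_out_inj : injective side_out.
Proof.
move=> a b [sab lab]; apply: label_inj (lab) => //; exact: (SB1_src SB).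
Qed.

Lemma side_follows a b : follows a b -> side_in a = side_out b.
Proof.
move=> ab; have [tab _] := followsE ab; rewrite /side_in; case: pickP => [b' ab'|/(_ b)].
  by rewrite (follows_right ab ab') /side_out tab (follows_right ab ab').
by rewrite ab.
Qed.

Lemma side_in_matched a b a' : follows a b -> a' != a -> tgt a' = tgt a ->
  (forall c, ~~ follows a' c) -> (side_in a').2 = ~~ (side_in a).2.
Proof.
move=> ab ne ta nf; rewrite (side_follows ab) /side_in /=.
case: pickP => [c|_]; first by rewrite (negbTE (nf c)).
case: pickP => [c /existsP[a'' /and3P[ne'' /eqP ta'' fc]]|/(_ b)]; last first.
  by move=> /existsP[]; exists a; rewrite eq_sym ne ta eqxx.
have ea : a'' = a.
  apply: (@two_of_fibre _ [set c | tgt c == tgt a]%SET _ a'); rewrite ?inE ?ta'' ?ta //.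
    exact: (SB1_tgt SB).
  by rewrite eq_sym.
by rewrite ea in fc; rewrite (follows_right ab fc).
Qed.

Lemma side_in_inj : injective side_in.
Proof.
move=> a a' eq_in; have := eq_in => -[ta _]; apply/eqP/negPn/negP => ne.
have [/existsP[b ab]|/existsPn na] := boolP [exists b, follows a b].
  have [/existsP[b' ab']|/existsPn na'] := boolP [exists b, follows a' b].
    move: eq_in; rewrite (side_follows ab) (side_follows ab') => /side_out_inj bb.
    by case/eqP: ne; rewrite -bb in ab'; apply: follows_left ab'.
  have := side_in_matched ab _ (esym ta) na'; rewrite eq_in eq_sym => /(_ ne).
  by case: (_.2).
have [/existsP[b' ab']|/existsPn na'] := boolP [exists b, follows a' b].
  have := side_in_matched ab' ne ta na; rewrite eq_in; by case: (_.2).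
have tgt2 := SB1_tgt SB (tgt a).
have third c : c \in [:: a; a'] -> (side_in c).2 = label (@tgt Q) c.
  move=> cs; rewrite /side_in; case: pickP => [b cb|_].
    by move: cs; rewrite !inE => /orP[]/eqP ec; move: cb; rewrite ec ?(negbTE (na b)) ?(negbTE (na' b)).
  case: pickP => // b /existsP[a'' /and3P[ne'' /eqP ta'' fb]].
  have nn : (a'' != a) && (a'' != a').
    by apply/andP; split; apply: contraTneq fb => ->; rewrite ?na ?na'.
  have t'' : tgt a'' = tgt a.
    by move: cs; rewrite !inE => /orP[]/eqP ec; rewrite ta'' ec.
  case/andP: nn => n1 n2; have : a = a'' ; last by move=> e; rewrite e eqxx in n1.
  apply: (two_of_fibre tgt2 _ _ _ ne n2); by rewrite inE ?t'' ?ta ?eqxx.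
case/eqP: ne; apply: (label_inj (f := @tgt Q)) => //.
by rewrite -!third ?inE ?eqxx ?orbT // eq_in.
Qed.

Lemma side_perm : exists sigma : {perm V * bool}, forall a, sigma (side_out a) = side_in a.
Proof. exact: perm_extension side_out_inj side_in_inj. Qed.
End Sides.

(** * Strings in the quotient algebra *)

Section Strings.
Variables (k : fieldType) (Q : quiver) (I : path_ideal k Q).
Local Notation kQhat := (cpath_alg k Q).
Local Notation V := (vertex Q).
Local Notation S := (V * bool)%type.
Local Notation R := ((complete_path_quotient I)^c).
Local Notation path := (qpath Q).
Local Notation arr := (arr k).
Local Notation vert := (vert k).
Variables (so ta : arrow Q -> S) (sigma : {perm S}).
Hypothesis so_inj : injective so.
Hypothesis so_src : forall a, (so a).1 = src a.
Hypothesis ta_tgt : forall a, (ta a).1 = tgt a.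
Hypothesis sigma_so : forall a, sigma (so a) = ta a.
Hypothesis not_follows : forall a b, tgt a = src b -> ta a != so b ->
  in_path_ideal I (arrow_elt k a * arrow_elt k b).
Implicit Types (F G : kQhat) (p q : path) (a b : arrow Q) (v : V) (w : seq (arrow Q)) (s t : S).

Lemma arr_path_algebra a : path_algebra (arr a).
Proof.
exists 2%N => p lep; rewrite /arr /arrow_elt /path_elt; case: eqP => // e.
by move: lep; rewrite e.
Qed.

Lemma path_ideal_sum (T : finType) (F : T -> kQhat) :
  (forall i, in_path_ideal I (F i)) -> in_path_ideal I (\sum_i F i).
Proof.
move=> IF; apply: (@big_ind _ (in_path_ideal I)) => [|F1 F2|i _]; [exact: path_ideal0 | exact: path_idealD | exact: IF].
Qed.

Lemma lquo_supp a F p : lquo a F p != 0 -> tgt a = pstart p /\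
  exists2 q, F q != 0 & val q = (src a, a :: (val p).2).
Proof.
rewrite /lquo; case: (_ =P tgt a) => [pa|_]; last by rewrite eqxx.
rewrite /coef; case: insubP => [q _ e|_]; last by rewrite eqxx.
by move=> Fq; split=> //; exists q.
Qed.

Lemma rquo_supp a F p : rquo a F p != 0 -> src a = pend p /\
  exists2 q, F q != 0 & val q = ((val p).1, rcons (val p).2 a).
Proof.
rewrite /rquo; case: (_ =P src a) => [pa|_]; last by rewrite eqxx.
rewrite /coef; case: insubP => [q _ e|_]; last by rewrite eqxx.
by move=> Fq; split=> //; exists q.
Qed.

Definition chain (w : seq (arrow Q)) := sorted (fun a b => ta a == so b) w.

(** Split off the first arrow [a]. If the rest of the path is still bad, induction applies;
    otherwise the break lies between [a] and the next arrow, and their product is in the ideal. *)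
Lemma bad_in_ideal N F :
  (forall p, F p != 0 -> ~~ chain (val p).2 /\ (plen p < N)%N) -> in_path_ideal I F.
Proof.
elim: N F => [|N IHN] F Fbad.
  rewrite (_ : F = 0); first exact: path_ideal0.
  by apply/funext => p; apply/eqP/negPn/negP => /Fbad[].
rewrite (lquo_decomp (F := F)) => [|v]; last first.
  by apply/eqP/negPn/negP => /Fbad[].
apply: path_ideal_sum => a.
pose G1 : kQhat := fun p => if chain (val p).2 then 0 else lquo a F p.
pose G2 : kQhat := fun p => if chain (val p).2 then lquo a F p else 0.
have -> : lquo a F = G1 + G2.
  by apply/funext => p; rewrite cpaD /G1 /G2; case: ifP; rewrite ?addr0 ?add0r.
have lenq p q : F q != 0 -> val q = (src a, a :: (val p).2) -> (plen p < N)%N.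
  by move=> /Fbad[_ ltq] e; move: ltq; rewrite /plen e.
rewrite mulrDr; apply: path_idealD.
  apply: path_idealMl; first exact: arr_path_algebra.
  apply: IHN => p; rewrite /G1; case: ifP => [_|ch]; first by rewrite eqxx.
  by move=> /lquo_supp[_ [q Fq e]]; split=> //; apply: lenq e.
rewrite (lquo_decomp (F := G2)) => [|v]; last first.
  rewrite /G2 /=; apply/eqP/negPn/negP => /lquo_supp[_ [q /Fbad[]]] e _.
  by move: e; rewrite /= => /[swap] ->.
rewrite mulr_sumr; apply: path_ideal_sum => b; rewrite mulrA.
have [no|/existsNP[p /eqP Gp]] := pselect (forall p, lquo b G2 p = 0).
  by rewrite (_ : lquo b G2 = 0) ?mulr0; [exact: path_ideal0 | apply/funext].
have [_ [q G2q eq]] := lquo_supp Gp.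
have ch : chain (val q).2 by apply: contraTT G2q; rewrite /G2 => /negbTE ->; rewrite eqxx.
move: G2q; rewrite /G2 ch => /lquo_supp[taq [r /Fbad[bad _] er]].
move: bad ch; rewrite er eq /chain /= => nc cq.
have ab : ta a != so b by move: nc; rewrite cq andbT.
apply: path_idealMr.
  exists N => p' lep; apply/eqP/negPn/negP => /lquo_supp[_ [q' G2q' eq']].
  have : lquo a F q' != 0 by apply: contraNneq G2q' => e; rewrite /G2 e; case: ifP.
  move=> /lquo_supp[_ [r' Fr' er']]; have := lenq _ _ Fr' er'.
  by rewrite /plen eq' /= ltnNge (leq_trans lep).
by apply: not_follows => //; rewrite taq /pstart eq.
Qed.

Lemma bad_in_closure F :
  (forall p, F p != 0 -> ~~ chain (val p).2) -> adic_closure (in_path_ideal I) F.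
Proof.
move=> Fbad N; exists (fun p => if (plen p < N)%N then F p else 0) => [|p ->//].
apply: (@bad_in_ideal N) => p; case: ifP => [_ /Fbad//|_].
by rewrite eqxx.
Qed.

Fixpoint run s (w : seq (arrow Q)) t : bool :=
  if w is a :: w' then (so a == s) && run (ta a) w' t else s == t.

Lemma run_rcons s w a t : run s (rcons w a) t = run s w (so a) && (ta a == t).
Proof.
elim: w s => [|b w IHw] s /=; first by rewrite eq_sym.
by rewrite IHw andbA.
Qed.

Lemma run_sh s w t : run s w t -> t = sh sigma (size w) s.
Proof.
elim: w s => [|a w IHw] s /= => [/eqP->//|/andP[/eqP<- /IHw->]].
by rewrite -sigma_so /sh -iterSr.
Qed.

Lemma run_end s w t : run s w t -> walk_end s.1 w = t.1.
Proof.
elim: w s => [|a w IHw] s /= => [/eqP->//|/andP[_ /IHw<-]].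
by rewrite ta_tgt.
Qed.

Lemma run_uniq s w t a w' : w = a :: w' -> run s w t = (s == so a) && (t == ta (last a w')) && chain w.
Proof.
move=> ->; rewrite /chain; elim: w' a s => [|b w' IHw] a s /=.
  by rewrite andbT eq_sym [ta a == t]eq_sym.
rewrite [_ && run _ _ _](IHw b (ta a)) /=.
by rewrite [so a == s]eq_sym; case: eqP => //= _; case: eqP; rewrite ?andbF.
Qed.

(* The class of x is locked, as a product of classes is convertible to a class. *)
Fact cls_key : unit. Proof. by []. Qed.
Definition cls : kQhat -> R := locked_with cls_key (quot_pi (closure_ideal I)).
Canonical cls_unlockable := [unlockable fun cls].

Lemma clsM x y : cls x * cls y = cls (y * x).
Proof. rewrite unlock; exact: quot_piM. Qed.

Lemma clsD x y : cls (x + y) = cls x + cls y.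
Proof. rewrite unlock; exact: quot_piD. Qed.

Lemma cls0 : cls 0 = 0.
Proof. by apply: (addIr (cls 0)); rewrite -clsD !add0r. Qed.

Lemma cls_sum (T : finType) (P : pred T) (F : T -> kQhat) :
  cls (\sum_(i | P i) F i) = \sum_(i | P i) cls (F i).
Proof. exact: (big_morph _ clsD cls0). Qed.

Lemma cls_eq x y : cls x = cls y <-> adic_closure (in_path_ideal I) (x - y).
Proof. rewrite unlock; exact: quot_pi_eq. Qed.

Lemma cls_surj (x : R) : exists F, cls F = x.
Proof.
exists (generic_quotient.repr (x : quot_ring (closure_ideal I))).
by rewrite unlock; apply: quot_pi_surj.
Qed.

Lemma cls_zero x : in_path_ideal I x -> cls x = 0.
Proof. by move=> Ix; rewrite -cls0; apply/cls_eq; rewrite subr0 => N; exists x. Qed.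

Definition ev v : R := cls (vert v).

Definition al s : R := if [pick a | so a == s] is Some a then cls (arr a) else 0.

Lemma al_so a : al (so a) = cls (arr a).
Proof.
rewrite /al; case: pickP => [b /eqP/so_inj->//|/(_ a)].
by rewrite eqxx.
Qed.

Lemma alP s : al s = 0 \/ exists2 a, so a = s & al s = cls (arr a).
Proof.
by rewrite /al; case: pickP => [a /eqP <-|_]; [right; exists a | left].
Qed.

(** The support condition is imposed on some lift [F], since a class has no well-defined
    coefficients. *)
Definition string s t (x : R) : Prop := exists2 F, x = cls F &
  forall p, F p != 0 -> ((val p).2 != [::]) && run s (val p).2 t.

Lemma vert_arr a : vert (src a) * arr a * vert (tgt a) = arr a.
Proof.
apply/funext => p; rewrite mul_vert vert_mul /arr /arrow_elt /path_elt.
by case: (p =P arrow_path a) => [->|_]; rewrite /pend /pstart /= ?eqxx ?if_same.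
Qed.

Lemma ev_idem v : ev v * ev v = ev v.
Proof. by rewrite clsM vert_orth eqxx. Qed.

Lemma ev_al s : ev (sigma s).1 * al s * ev s.1 = al s.
Proof.
have [->|[a <- ->]] := alP s; first by rewrite mulr0 mul0r.
by rewrite sigma_so so_src ta_tgt !clsM mulrA vert_arr.
Qed.

Lemma al_flip s : al (flip (sigma s)) * al s = 0.
Proof.
have [->|[a <- ->]] := alP s; first by rewrite mulr0.
have [->|[b]] := alP (flip (sigma (so a))); first by rewrite mul0r.
rewrite sigma_so => sb ->; rewrite clsM; apply: cls_zero; apply: not_follows.
  by rewrite -ta_tgt -so_src sb.
by rewrite sb; case: (ta a) => v c; rewrite /flip /= -pair_eqE /= eqxx; case: c.
Qed.

Lemma string_ev s t x : string s t x -> ev t.1 * x * ev s.1 = x.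
Proof.
move=> [F -> Fst]; rewrite !clsM mulrA; congr cls; apply/funext => p.
rewrite mul_vert vert_mul; case: (eqVneq (F p) 0) => [->|/Fst]; first by rewrite !if_same.
case: p => [[v [|a w]] c] //= /andP[/eqP sa rw]; rewrite /pend /pstart /walk_end /=.
have /= /andP[/eqP sv _] := c.
have -> : v == s.1 by rewrite -sa so_src sv.
by have := run_end rw; rewrite ta_tgt /walk_end => ->; rewrite eqxx.
Qed.

Lemma string_orbit s t x : string s t x -> x = 0 \/ exists n, t = sh sigma n.+1 s.
Proof.
move=> [F -> Fst]; have [no|/existsNP[p /eqP /Fst]] := pselect (forall p, F p = 0).
  by left; rewrite -cls0; congr cls; apply/funext.
by case: (val p).2 => // a w /run_sh ->; right; exists (size w).
Qed.

Lemma string0 s t : string s t 0.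
Proof. by exists 0; [rewrite cls0 | move=> p; rewrite eqxx]. Qed.

Lemma central_cst c : central (cls (cst c : kQhat)).
Proof. by move=> x; have [F <-] := cls_surj x; rewrite !clsM cst_central. Qed.

Lemma split_trivial F v : (forall p, F p != 0 -> (val p).2 = [::] -> (val p).1 = v) ->
  exists2 G, F = cst (F (trivial_path v)) * vert v + G &
    forall p, G p != 0 -> (val p).2 != [::] /\ G p = F p.
Proof.
move=> Fv; exists (fun p => if (val p).2 == [::] then 0 else F p) => [|p].
  apply/funext => p; rewrite cpaD cst_mul /vert /path_elt.
  case: eqP => [->|ne] /=; first by rewrite mulr1 addr0.
  rewrite mulr0 add0r; case: eqP => // p0; apply/eqP/negPn/negP => Fp.
  by case: ne; apply: qpath_inj => //=; apply: Fv.
by have [_|] := eqVneq (val p).2 [::]; rewrite ?eqxx.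
Qed.

Lemma trivial_run s t F v : (forall p, F p != 0 -> run s (val p).2 t) ->
  cls (cst (F (trivial_path v)) * vert v : kQhat) =
  cls (cst (F (trivial_path v)) : kQhat) * ev v *+ (s == t).
Proof.
move=> Frun; case: eqP => [_|st]; first by rewrite mulr1n clsM cst_central.
have -> : F (trivial_path v) = 0.
  by apply/eqP/negPn/negP => /Frun /= /eqP.
rewrite mulr0n -cls0; congr cls; apply/funext => p.
by rewrite cst_mul mul0r.
Qed.

(** All strings from [s] begin with the one arrow leaving by [s]. Dividing by it leaves a constant
    term, which gives [c], and strings from the next side. *)
Lemma string_left s t x : string s t x -> exists c y,
  [/\ central c, string (sigma s) t y &
      x = (c * ev (sigma s).1 *+ (sigma s == t) + y) * al s].
Proof.
move=> [F -> Fst]; have [[a ea]|no] := pselect (exists a, so a = s); last first.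
  exists 0, 0; split=> [z||]; [by rewrite mul0r mulr0|exact: string0|].
  rewrite mul0r mul0rn addr0 mul0r -cls0; congr cls; apply/funext => p.
  apply/eqP/negPn/negP => /Fst; case: (val p).2 => // a w /= /andP[/eqP ea _].
  by apply: no; exists a.
pose L := lquo a F.
have Lrun p : L p != 0 -> run (ta a) (val p).2 t.
  by move=> /lquo_supp[_ [q /Fst]] /[swap] -> /= /andP[].
have [|G LE Gsupp] := @split_trivial L (tgt a).
  by move=> p /lquo_supp[->].
exists (cls (cst (L (trivial_path (tgt a))) : kQhat)), (cls G); split.
- exact: central_cst.
- exists G => // p /[dup] Gp /Gsupp[-> GL]; rewrite -ea sigma_so /=.
  by apply: Lrun; rewrite -GL.
rewrite -ea sigma_so al_so ta_tgt -(trivial_run _ Lrun) -clsD -LE clsM; congr cls.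
rewrite [LHS]lquo_decomp => [|v]; last by apply/eqP/negPn/negP => /Fst.
rewrite (bigD1 a) //= big1 ?addr0 // => b ne.
rewrite (_ : lquo b F = 0) ?mulr0 //; apply/funext => p; apply/eqP/negPn/negP.
move=> /lquo_supp[_ [q /Fst]] /[swap] -> /= /andP[/eqP eb _].
by case/eqP: ne; apply: so_inj; rewrite eb ea.
Qed.

Lemma string_right s t x : string s t x -> exists c y,
  [/\ central c, string s ((sigma^-1)%g t) y &
      x = al ((sigma^-1)%g t) * (c * ev s.1 *+ (s == (sigma^-1)%g t) + y)].
Proof.
move=> [F -> Fst]; set u := (sigma^-1)%g t.
have ut a : ta a = t -> so a = u by move=> ea; rewrite /u -ea -sigma_so permK.
have [[a ea]|no] := pselect (exists a, so a = u); last first.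
  exists 0, 0; split=> [z||]; [by rewrite mul0r mulr0|exact: string0|].
  rewrite mul0r mul0rn addr0 mulr0 -cls0; congr cls; apply/funext => p.
  apply/eqP/negPn/negP => /Fst; case/lastP: (val p).2 => // w a.
  rewrite run_rcons => /and3P[_ _ /eqP/ut ea].
  by apply: no; exists a.
pose L := rquo a F.
have Lrun p : L p != 0 -> run s (val p).2 u.
  by move=> /rquo_supp[_ [q /Fst]] /[swap] -> /=; rewrite run_rcons ea => /and3P[].
have [|G LE Gsupp] := @split_trivial L s.1.
  move=> p /[dup] /Lrun /[swap] /rquo_supp[ap _] /[swap] p0.
  by rewrite p0 => /= /eqP ->; move: ap; rewrite /pend p0 -ea so_src.
exists (cls (cst (L (trivial_path s.1)) : kQhat)), (cls G); split.
- exact: central_cst.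
- by exists G => // p /[dup] Gp /Gsupp[-> GL]; apply: Lrun; rewrite -GL.
rewrite -(trivial_run _ Lrun) -clsD -LE -ea al_so clsM; congr cls.
rewrite [LHS]rquo_decomp => [|v]; last by apply/eqP/negPn/negP => /Fst.
rewrite (bigD1 a) //= big1 ?addr0 // => b ne.
rewrite (_ : rquo b F = 0) ?mul0r //; apply/funext => p; apply/eqP/negPn/negP.
move=> /rquo_supp[_ [q /Fst]] /[swap] -> /=; rewrite run_rcons => /and3P[_ _ /eqP/ut eb].
by case/eqP: ne; apply: so_inj; rewrite eb ea.
Qed.

(** Paths that change sides vanish in the quotient; the others are sorted by their first and last
    sides. Trivial paths are excluded by [v != v']. *)
Lemma string_decomp v v' x : v != v' -> ev v' * x * ev v = x ->
  exists2 x' : S -> S -> R,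
    (forall s t, s.1 = v -> t.1 = v' -> string s t (x' s t)) &
    x = \sum_(s | s.1 == v) \sum_(t | t.1 == v') x' s t.
Proof.
move=> ne; have [F0 <-] := cls_surj x; rewrite !clsM => <-.
set F := _ * _.
have Fsupp p : F p != 0 -> pstart p = v /\ pend p = v'.
  rewrite /F vert_mul mul_vert; case: (_ =P v) => [->|_]; last by rewrite eqxx.
  by case: (_ =P v') => [->|_]; last by rewrite eqxx.
pose F' s t : kQhat := fun p => if ((val p).2 != [::]) && run s (val p).2 t then F p else 0.
exists (fun s t => cls (F' s t)) => [s t _ _|].
  by exists (F' s t) => // p; rewrite /F'; case: ifP; rewrite ?eqxx.
under eq_bigr do rewrite -cls_sum.
rewrite -cls_sum; apply/cls_eq; apply: bad_in_closure => p.
apply: contraNN => ch; rewrite cpaD cpaN cpa_sum subr_eq0.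
under eq_bigr do rewrite cpa_sum.
have [Fp0|/Fsupp[vp v'p]] := eqVneq (F p) 0.
  rewrite Fp0 eq_sym; apply/eqP; rewrite big1 // => s _; rewrite big1 // => t _.
  by rewrite /F' Fp0 if_same.
case pw: (val p).2 ch => [|a w] ch.
  by case/eqP: ne; rewrite -vp -v'p /pend pw.
have srcp : src a = v.
  by have := valP p; rewrite pw /= => /andP[/eqP->].
have endp : tgt (last a w) = v'.
  by rewrite -v'p /pend pw /walk_end /= last_map.
have F'E s t : F' s t p = F p *+ ((s == so a) && (t == ta (last a w))).
  rewrite /F' pw (_ : a :: w != [::]) // (run_uniq _ _ (erefl (a :: w))) ch andbT.
  by rewrite andTb; case: (_ && _).
rewrite (bigD1 (so a)) ?so_src ?srcp //= (bigD1 (ta (last a w))) ?ta_tgt ?endp //=.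
rewrite F'E !eqxx mulr1n big1 ?addr0 => [|t /andP[_ /negbTE nt]]; last by rewrite F'E nt andbF.
rewrite big1 ?addr0 // => s /andP[_ /negbTE ns].
by rewrite big1 // => t _; rewrite F'E ns.
Qed.
End Strings.

(** * Density of the fan *)

Section Vertices.
Variables (k : fieldType) (Q : quiver) (I : path_ideal k Q).
Local Notation kQhat := (cpath_alg k Q).
Local Notation V := (vertex Q).
Local Notation R := ((complete_path_quotient I)^c).
Local Notation ev := (ev I).
Local Notation cls := (cls I).
Local Notation vert := (vert k).

(* Vertices whose idempotent dies in the quotient carry no projective. *)
Definition live : {set V} := [set v | ev v != 0]%SET.
Definition live_vertex (i : 'I_#|live|) : V := enum_val i.
Definition live_idem i : R := ev (live_vertex i).
Definition live_index v : option 'I_#|live| := [pick i | live_vertex i == v].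

Lemma live_vertex_inj : injective live_vertex.
Proof. exact: enum_val_inj. Qed.

Lemma live_vertexK i : live_index (live_vertex i) = Some i.
Proof.
rewrite /live_index; case: pickP => [j /eqP/live_vertex_inj->//|/(_ i)].
by rewrite eqxx.
Qed.

Lemma eo_live_index o : eo live_idem (obind live_index o) = eo ev o.
Proof.
case: o => //= v; rewrite /live_index; case: pickP => [i /eqP/= <-//|no] /=.
have [vl|] := boolP (v \in live); last by rewrite inE negbK => /eqP.
by have := no (enum_rank_in vl v); rewrite /live_vertex enum_rankK_in ?eqxx.
Qed.

Lemma obind_live o i : (obind live_index o == Some i) = (o == Some (live_vertex i)).
Proof.
case: o => //= v; rewrite /live_index; case: pickP => [j /eqP <-|no].
  by rewrite !(inj_eq Some_inj) (inj_eq live_vertex_inj).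
by apply/esym/eqP => -[e]; move: (no i); rewrite e eqxx.
Qed.

Lemma live_orth i j : live_idem i * live_idem j = if i == j then live_idem i else 0.
Proof.
rewrite /live_idem clsM vert_orth eq_sym (inj_eq live_vertex_inj).
by case: eqP => [->//|_]; apply: cls0.
Qed.

Lemma live_neq0 i : live_idem i != 0.
Proof. by have := enum_valP i; rewrite inE. Qed.

Lemma cls1 : cls 1 = 1.
Proof. by rewrite unlock. Qed.

Lemma live_sum : \sum_i live_idem i = 1.
Proof.
rewrite -cls1 -vert_sum cls_sum -(big_enum_val (A := mem live) ev) [RHS](bigID (mem live)) /=.
rewrite [X in _ = _ + X]big1 ?addr0 // => v.
by rewrite inE negbK => /eqP.
Qed.

Definition vo (o : option 'I_#|live|) : kQhat := if o is Some i then vert (live_vertex i) else 0.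

Lemma cls_vo o : cls (vo o) = eo live_idem o.
Proof. by case: o => //=; apply: cls0. Qed.

(** Lift to series. A lift with non-zero constant term is invertible in its corner. If there were
    none, the lift [D] of 0 would have constant term 1, hence be invertible, and the idempotent at
    [v] would vanish. *)
Lemma live_local v m (u : 'I_m -> option 'I_#|live|) (c y : 'I_m -> R) :
  (forall l, live_idem v * c l * eo live_idem (u l) = c l) ->
  (forall l, eo live_idem (u l) * y l * live_idem v = y l) ->
  \sum_l c l * y l = live_idem v ->
  exists l z, [/\ u l = Some v, live_idem v * z * live_idem v = z,
    z * y l = live_idem v & y l * z = live_idem v].
Proof.
move=> cE yE cy; pose w := live_vertex v.
have ww : vert w * vert w = vert w by rewrite vert_orth eqxx.
have /fin_all_exists[F FE] : forall l, exists F, cls F = y l.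
  by move=> l; apply: cls_surj.
have /fin_all_exists[G GE] : forall l, exists G, cls G = c l.
  by move=> l; apply: cls_surj.
pose Y l := vert w * F l * vo (u l); pose C l := vo (u l) * G l * vert w.
have YE l : cls (Y l) = y l by rewrite -[RHS]yE /Y -!clsM cls_vo FE mulrA.
have CE l : cls (C l) = c l by rewrite -[RHS]cE /C -!clsM cls_vo GE mulrA.
have [[l Yl]|no] := pselect (exists l, Y l (trivial_path w) != 0).
  have ul : u l = Some v.
    move: Yl; rewrite /Y; case: (u l) => [i|] /=; last by rewrite mulr0 eqxx.
    rewrite mul_vert /pend /=; case: (_ =P live_vertex i) => [/live_vertex_inj->//|_].
    by rewrite eqxx.
  have cY : vert w * Y l * vert w = Y l.
    by rewrite /Y ul /= -!mulrA ww !mulrA ww.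
  have [Z [cZ YZ ZY]] := corner_inverse cY Yl.
  exists l, (cls Z); split=> //; rewrite -?YE clsM ?YZ ?ZY //.
  by rewrite clsM mulrA cZ.
pose D := vert w - \sum_l Y l * C l.
have D0 : cls D = 0.
  have : cls (vert w) = cls (\sum_l Y l * C l).
    rewrite cls_sum -[LHS]cy; apply: eq_bigr => l _.
    by rewrite -clsM YE CE.
  by move/cls_eq => cD; rewrite -cls0; apply/cls_eq; rewrite subr0.
have cD : vert w * D * vert w = D.
  rewrite mulrBr mulrBl !ww mulr_sumr mulr_suml; congr (_ - _).
  by apply: eq_bigr => l _; rewrite /Y /C -!mulrA ww !mulrA ww.
have [|Z [_ DZ _]] := corner_inverse cD.
  rewrite /D cpaD cpaN cpa_sum big1 ?subr0 => [|l _].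
    by rewrite /vert /path_elt eqxx oner_eq0.
  rewrite trivial_coef (_ : Y l _ = 0) ?mul0r //.
  by apply/eqP/negPn/negP => Yl; apply: no; exists l.
have := live_neq0 v; rewrite /live_idem -/w /ev -DZ -clsM D0 mulr0 eqxx.
by [].
Qed.
End Vertices.

Lemma count_lt_ord w m : (\sum_(y < w) (y < m))%N = minn m w.
Proof. by elim: w => [|w IHw]; rewrite ?big_ord0 ?big_ord_recr /= ?IHw; lia. Qed.

(** * The presentation attached to a weight *)

Section Presentation.
Variables (k : fieldType) (Q : quiver) (I : path_ideal k Q) (SB : special_biserial I).
Local Notation V := (vertex Q).
Local Notation R := ((complete_path_quotient I)^c).
Variables (sigma : {perm V * bool}).
Hypothesis sigma_side : forall a, sigma (side_out a) = side_in I a.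

Lemma not_follows_in_ideal a b : tgt a = src b -> side_in I a != side_out b ->
  in_path_ideal I (arrow_elt k a * arrow_elt k b).
Proof.
move=> tab; apply: contraNP => nI; apply/eqP/(side_follows SB).
by rewrite /follows tab eqxx; apply/asboolP.
Qed.

Variable h : V -> int.
Local Notation strand := (strand h).

Definition pres_vertex (sgn : strand -> option V) (j : 'I_#|{: strand}|) :=
  obind (live_index I) (sgn (enum_val j)).

Lemma pres_proof :
  eid (@live_orth _ _ I) (pres_vertex (@minus_vertex V h)) *m
    pres sigma h (ev I) (al I (@side_out Q)) *m
  eid (@live_orth _ _ I) (pres_vertex (@plus_vertex V h)) =
  pres sigma h (ev I) (al I (@side_out Q)).
Proof.
apply/matrixP => j i; rewrite mulmx_emat mul_emat !eo_live_index.
apply: pres_support => [v|s]; first exact: ev_idem.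
exact: (@ev_al _ _ I (@side_out Q) (side_in I)).
Qed.

Definition pres_gcx : gcx (@live_orth _ _ I) := Gcx pres_proof.

(** A live vertex of weight [m] contributes [max 0 m] strands to P^0 and [max 0 (- m)] to P^-1. *)
Lemma pres_gvec i : gvec pres_gcx 0 i = h (live_vertex i).
Proof.
rewrite mxE /count_w /= /pres_vertex; set v := live_vertex i.
have cnt (sgn : strand -> option V) (m : int) :
    (forall y : 'I_(width h).+1, (sgn (v, y) == Some v) = (y%:Z < m)) ->
    (forall w y, w != v -> sgn (w, y) != Some v) -> m <= (width h)%:Z ->
    (\sum_(j < #|{: strand}|) (obind (live_index I) (sgn (enum_val j)) == Some i))%N%:Z =
    Num.max 0 m.
  move=> sv sw lem; under eq_bigr do rewrite obind_live.
  rewrite -(big_enum_val (A := {: strand}) (fun z => (sgn z == Some v) : nat)) /=.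
  rewrite (eq_bigr (fun z => (sgn (z.1, z.2) == Some v) : nat)) => [|[]] //.
  rewrite -(pair_bigA _ (fun w y => (sgn (w, y) == Some v) : nat)) /= (bigD1 v) //=.
  rewrite [X in (_ + X)%N]big1 ?addn0 => [|w ne]; last first.
    by rewrite big1 // => y _; rewrite (negbTE (sw w y ne)).
  under eq_bigr do rewrite sv.
  case: m lem {sv} => m lem.
    by rewrite count_lt_ord; lia.
  by rewrite big1; lia.
have hw := width_ge h v.
rewrite (cnt _ (h v)) ?(cnt _ (- h v)); try lia.
- by move=> y; rewrite /minus_vertex /minus_strand /=; case: ifP; rewrite ?eqxx.
- by move=> w y ne; rewrite /minus_vertex; case: ifP => // _; apply: contraNneq ne => -[->].
- by move=> y; rewrite /plus_vertex /plus_strand /=; case: ifP; rewrite ?eqxx.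
by move=> w y ne; rewrite /plus_vertex; case: ifP => // _; apply: contraNneq ne => -[->].
Qed.

Lemma pres_ext : acyclic_leaves sigma h -> ext_mx (mcx_of pres_gcx) (mcx_of pres_gcx).
Proof.
move=> ac f cf; have so_inj := side_out_inj SB.
have nf := not_follows_in_ideal.
apply: (@pres_rigid R V sigma h (ev I) (al I (@side_out Q))
  (string (@side_out Q) (side_in I)) _ _ _ _ _ _ _ _ ac f).
- exact: ev_idem.
- exact: (@ev_al _ _ I (@side_out Q) (side_in I)).
- exact: (@al_flip _ _ I (@side_out Q) (side_in I)).
- exact: string_ev.
- exact: string_left.
- exact: (@string_right _ _ I (@side_out Q) (side_in I)).
- exact: string_orbit.
- exact: string_decomp.
move=> j i; rewrite -[RHS](congr1 (fun M : 'M[R]_(_, _) => M j i) cf) /=.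
by rewrite mulmx_emat mul_emat !eo_live_index.
Qed.
End Presentation.

(** Rounding [t] down to multiples of [1 / M] costs at most [1 / M], and the added 1 costs
    [1 / (N M)] after rescaling; [M] is chosen so that [2 / M < eps]. *)
Lemma rescaled_dense (R : realType) n (S : set 'rV[R]_n) :
  (forall (g : 'I_n -> int) (N0 : nat), exists2 N : nat, (N0 < N)%N &
     forall c : R, 0 <= c -> S (\row_i (c * (N%:Z * g i + 1)%:~R))) ->
  closure S = [set: 'rV[R]_n]%classic.
Proof.
move=> SP; apply/seteqP; split=> // t _ B /nbhs_ballP[eps /= eps0 ballB].
pose M := (Num.bound (2 / eps)).+1.
have M0 : 0 < M%:R :> R by rewrite ltr0n.
have Meps : 2 / M%:R < eps.
  rewrite ltr_pdivrMr // mulrC -ltr_pdivrMr //.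
  apply: lt_trans (archi_boundP _) _; first by rewrite divr_ge0 ?ltW.
  by rewrite ltr_nat.
have [N ltN SN] := SP (fun i => Num.floor (t 0 i * M%:R)) 0%N.
have N0 : 0 < N%:R :> R by rewrite ltr0n.
have N1 : (N%:R : R)^-1 <= 1 by rewrite invf_le1 // ler1n.
pose c : R := (N%:R * M%:R)^-1.
have c0 : 0 <= c by rewrite invr_ge0 mulr_ge0 ?ltW.
exists (\row_i (c * (N%:Z * Num.floor (t 0 i * M%:R) + 1)%:~R)); split; first exact: SN.
apply: ballB; split=> // i j; rewrite mxE (ord1 i) -ball_normE /=.
set fl := Num.floor _.
have /andP[le1 le2] := floor_itv (t 0 j * M%:R); rewrite -/fl in le1 le2.
have -> : c * (N%:Z * fl + 1)%:~R = fl%:~R / M%:R + N%:R^-1 / M%:R :> R.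
  rewrite /c rmorphD rmorphM /= -[N%:Z%:~R]/(N%:R).
  by field; rewrite ?gt_eqF.
have -> : t 0 j = (t 0 j * M%:R) / M%:R by rewrite mulfK // gt_eqF.
rewrite rmorphD /= in le2.
rewrite -mulrDl -mulrBl normrM [`|M%:R^-1|]gtr0_norm ?invr_gt0 //.
apply: le_lt_trans Meps; rewrite ler_pM2r ?invr_gt0 // ler_norml.
have Ni : 0 <= (N%:R : R)^-1 by rewrite invr_ge0 ltW.
by apply/andP; split; lra.
Qed.

Theorem theorem1p3 (R : realType) (k : closedFieldType) (Q : quiver)
  (Qconn : quiver_connected Q) (I : path_ideal k Q)
  (SB : special_biserial I) :
  g_tame (complete_path_quotient I) R.
Proof.
have [sigma sigmaE] := side_perm SB.
exists #|live I|, (proj_mod (@live_orth _ _ I)); split.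
  by apply: proj_mod_basic; [exact: live_neq0 | exact: live_sum | exact: live_local].
apply: rescaled_dense => g N0.
(* The weight must be defined at every vertex; over a vertex whose idempotent is 0 the strands span
   the zero module, and 0 is taken there. *)
pose g' v := if live_index I v is Some i then g i else 0.
have [N ltN ac] := blowup_acyclic sigma g' N0; exists N => // c c0.
have ext := pres_ext SB (sigma_side := sigmaE) ac.
have := @rigid_in_gfan _ _ _ _ (@live_neq0 _ _ I) (@live_local _ _ I) R _ c (@ext) c0.
congr (gfan_support _ _); apply/rowP => i; rewrite !mxE; congr (c * _%:~R).
have := pres_gvec sigmaE (blowup g' N) i; rewrite mxE => ->.
by rewrite /blowup /g' live_vertexK.
Qed.
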